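(* Let $g>0$, $n\ge 0$. Let $\rho\in\mathrm{Hom}(\Lambda_{g,n},\mathrm{GL}_2\mathbb{C})$ be a reducible representation (i.e. its image leaves a line of $\mathbb{C}^2$ invariant), with conjugacy class $[\rho]\in\chi_{g,n}(\mathrm{GL}_2\mathbb{C})$. Then the orbit $\Gamma_{g,n}\cdot[\rho]$ is finite if and only if one of the following conditions is satisfied. (1) $\rho$ is a direct sum of scalar representations (i.e. homomorphisms $\Lambda_{g,n}\to\mathbb{C}^*$) with finite images. (2) $g=1$, $n>0$, and there are a root of unity $\mu\in\mathbb{C}^*\setminus\{1\}$, a tuple $\mathbf{c}=(c_1,\dots,c_n)\in\mathbb{C}^n$ with $\sum_{i=1}^n c_i=1$, and a scalar representation $\lambda$ with finite image such that $[\rho]\in\Gamma_{g,n}\cdot[\lambda\otimes\rho_{\mu,\mathbf{c}}]$, where $\rho_{\mu,\mathbf{c}}\in\mathrm{Hom}(\Lambda_{1,n},\mathrm{GL}_2\mathbb{C})$ is given by $$\rho_{\mu,\mathbf{c}}(\alpha_1)=\begin{pmatrix}\mu&0\\0&1\end{pmatrix},\quad \rho_{\mu,\mathbf{c}}(\beta_1)=\begin{pmatrix}1&-\frac1{\mu-1}\\0&1\end{pmatrix},\quad \rho_{\mu,\mathbf{c}}(\gamma_i)=\begin{pmatrix}1&c_i\\0&1\end{pmatrix}\ (1\le i\le n).$$ Moreover, the cardinality of a finite orbit satisfies the following estimates, for $\rho=\lambda_1\oplus\lambda_2$ in case (1) and $\rho=\lambda\otimes\rho_{\mu,\mathbf{c}}$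 in case (2) respectively: (1) $\frac12\max\{\mathrm{card}(\mathrm{Im}(\lambda_i))^{2g-1}\mid i\in\{1,2\}\}\le\mathrm{card}(\Gamma_{g,n}\cdot[\rho])\le\mathrm{card}(\mathrm{Im}(\rho))^{2g}$; (2) $\max\{N_2,\ \phi(N)(2N-\phi(N))N^{n'-1}\}\le\mathrm{card}(\Gamma_{g,n}\cdot[\rho])\le(N^2-1)N^{n'-1}N_2^2$, where $\phi$ is the Euler totient function, $n'=\mathrm{card}\{i\in\{1,\dots,n\}\mid\rho(\gamma_i)\notin\mathbb{C}^*I_2\}$, $N=\mathrm{order}(\mu)$ and $N_2=\mathrm{card}(\mathrm{Im}(\lambda))$.
   Context: $\Sigma_g$ is a compact oriented surface of genus $g$, $Y^n=\{y_1,\dots,y_n\}$ a set of $n$ distinct points, $y_0\in\Sigma_g\setminus Y^n$, $\Lambda_{g,n}=\pi_1(\Sigma_g\setminus Y^n,y_0)$. $\hat\Gamma_{g,n}$ (full mapping class group) is the group of orientation preserving homeomorphisms of $\Sigma_g$ preserving $Y^n$ setwise, modulo isotopies relative to $Y^n$; the pure mapping class group $\Gamma_{g,n}\subset\hat\Gamma_{g,n}$ is the subgroup of classes fixing each $y_i$. $\hat\Gamma_{g,n}^\bullet$ is defined like $\hat\Gamma_{g,n}$ but with homeomorphisms also fixing $y_0$ and isotopies relative to $Y^n\cup\{y_0\}$. For a group $G$, $\chi_{g,n}(G)=\mathrm{Hom}(\Lambda_{g,n},G)/G$ (conjugation). For $h\in\hat\Gamma^\bullet_{g,n}$ and $\rho\in\mathrm{Hom}(\Lambda_{g,n},G)$,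 $(h\cdot\rho)(\alpha)=\rho((h^{-1})_*\alpha)$; this induces an action of $\hat\Gamma_{g,n}$, hence of $\Gamma_{g,n}$, on $\chi_{g,n}(G)$. Standard generators: $\Lambda_{g,n}=\langle\alpha_1,\beta_1,\dots,\alpha_g,\beta_g,\gamma_1,\dots,\gamma_n\mid[\alpha_1,\beta_1]\cdots[\alpha_g,\beta_g]\gamma_1\cdots\gamma_n=1\rangle$ with $[a,b]=aba^{-1}b^{-1}$, $\gamma_j$ a simple loop around $y_j$. They are chosen so that a subgroup $\hat\Gamma^\circ_{g,n}\subset\hat\Gamma^\bullet_{g,n}$ which surjects onto $\hat\Gamma_{g,n}$ is generated by elements $\tau_i$ (Dehn twists) and $\sigma_k$ (half-twists exchanging $y_k$ and $y_{k+1}$) acting on $\Lambda_{g,n}$ as follows (unlisted generators are fixed): - $\tau_{2k}$ ($1\le k\le g$): $\alpha_k\mapsto\alpha_k\beta_k$. - $\tau_{2k-1}$ ($1\le k\le g$): $\beta_k\mapsto\beta_k\alpha_k$. - $\tau_{2g+k}$ ($1\le k\le g-1$): $\alpha_{k+1}\mapsto\Theta_k^{-1}\alpha_{k+1}$, $\alpha_k\mapsto\alpha_k\Theta_k$, $\beta_k\mapsto\Theta_k^{-1}\beta_k\Theta_k$, with $\Theta_k=\alpha_{k+1}\beta_{k+1}^{-1}\alpha_{k+1}^{-1}\beta_k$. - $\tau_{3g-1+k}$ ($1\le k\le n-1$): $\alpha_g\mapsto\alpha_g\Xi_k$, $\beta_g\mapsto\Xi_k^{-1}\beta_g\Xi_k$,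 $\gamma_i\mapsto\Xi_k^{-1}\gamma_i\Xi_k$ for $1\le i\le k$, with $\Xi_k=(\gamma_1\cdots\gamma_k)^{-1}\beta_g$. - $\sigma_k$ ($1\le k\le n-1$): $\gamma_k\mapsto\gamma_k\gamma_{k+1}\gamma_k^{-1}$, $\gamma_{k+1}\mapsto\gamma_k$. For a scalar representation $\lambda$, $(\lambda\otimes\rho)(x)=\lambda(x)\rho(x)$. $I_2$ is the identity matrix. *)

(* Defs.v *)
From HB Require Import structures.
From mathcomp Require Import all_boot all_order all_algebra.
From mathcomp Require Import generic_quotient perm complex finmap.
From mathcomp Require Import mathcomp_extra boolp classical_sets functions.
From mathcomp Require Import cardinality reals topology normedtype trigo.
From mathcomp Require Import lra.

Set Implicit Arguments.
Unset Strict Implicit.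
Unset Printing Implicit Defensive.

Import Order.TTheory GRing.Theory Num.Theory.
Import numFieldNormedType.Exports.

Local Open Scope classical_set_scope.
Local Open Scope ring_scope.
Local Open Scope quotient_scope.

Lemma paste_continuous (R : realType) (T S : topologicalType)
    (k : T -> R) (f g : T -> S) :
  continuous k -> continuous f -> continuous g ->
  (forall x, k x = 0 -> f x = g x) ->
  continuous (fun x => if k x <= 0 then f x else g x).
Proof.
move=> ck cf cg fg x U; case: (ltrgtP (k x) 0) => k0 /= Ux.
- have N : nbhs (k x) [set z | z < 0].
    by apply: open_nbhs_nbhs; split; [exact: open_lt|].
  apply: (@filterS2 _ (nbhs x) _ _ _ _ _ (cf x U Ux) (ck x _ N)).
  by move=> y /= ? /ltW ->.
- have N : nbhs (k x) [set z | 0 < z].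
    by apply: open_nbhs_nbhs; split; [exact: open_gt|].
  apply: (@filterS2 _ (nbhs x) _ _ _ _ _ (cg x U Ux) (ck x _ N)).
  by move=> y /= ?; rewrite ltNge => /negbTE ->.
- have Vx := Ux; rewrite fg // in Vx.
  apply: (@filterS2 _ (nbhs x) _ _ _ _ _ (cf x U Ux) (cg x U Vx)).
  by move=> y /= ? ?; case: ifP.
Qed.

(* Fundamental groups.  Loops and homotopies are parametrized by the whole    *)
(* line instead of [0, 1]: a map defined on [0, 1] extends to R by clamping   *)
(* its parameter, and a loop is homotopic to its clamped version, so that the *)
(* group of homotopy classes is the usual one.                                *)
Section Loops.
Context {R : realType} {S : topologicalType}.

Record loop (A : set S) (x : S) := Loop {
  loop_fun :> R -> S;
  loop_continuous : continuous loop_fun;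
  loop_in : forall t, A (loop_fun t);
  loop_start : loop_fun 0 = x;
  loop_end : loop_fun 1 = x }.

HB.instance Definition _ A x := gen_eqMixin (loop A x).
HB.instance Definition _ A x := gen_choiceMixin (loop A x).

Definition homotopic A x (l m : loop A x) := exists H : R * R -> S,
  [/\ continuous H, (forall p, A (H p)),
      (forall t, H (0, t) = l t /\ H (1, t) = m t) &
      (forall s, H (s, 0) = x /\ H (s, 1) = x)].

Context {A : set S} {x : S} (Ax : A x).
Implicit Types l m : loop A x.

Lemma loop_eq l m : l =1 m -> l = m.
Proof.
case: l m => [l c i s e] [m c' i' s' e'] /= /funext lm.
by subst m; congr Loop; exact: Prop_irrelevance.
Qed.

Definition cat_fun (l m : R -> S) (t : R) :=
  if t - 2^-1 <= 0 then l (2 * t) else m (2 * t - 1).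

Lemma continuous_affine (a b : R) : continuous (fun t : R => a * t + b).
Proof.
by move=> t; apply: cvgD; [apply: cvgMr; exact: cvg_id|exact: cvg_cst].
Qed.

Lemma continuous_loop_comp (T : topologicalType) l (f : T -> R) :
  continuous f -> continuous (fun t => l (f t)).
Proof.
move=> cf t; apply: (@continuous_comp _ _ _ f l); first exact: cf.
exact: loop_continuous.
Qed.

Lemma continuous_comp2 (T : topologicalType) (H : R * R -> S) (f h : T -> R) :
  continuous H -> continuous f -> continuous h ->
  continuous (fun p => H (f p, h p)).
Proof.
move=> cH cf ch p.
apply: (@continuous2_cvg _ _ _ _ (nbhs p) _ f h (fun a b => H (a, b))).
- have -> : (fun z : R * R => H (z.1, z.2)) = H by apply/funext => -[].
  exact: cH.
- exact: cf.
- exact: ch.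
Qed.

Lemma continuous_affine1 (a b : R) :
  continuous (fun p : R * R => a * p.1 + b).
Proof.
move=> p; apply: (@continuous_comp _ _ _ fst (fun t => a * t + b)).
  exact: cvg_fst.
exact: continuous_affine.
Qed.

Lemma continuous_affine2 (a b : R) :
  continuous (fun p : R * R => a * p.2 + b).
Proof.
move=> p; apply: (@continuous_comp _ _ _ snd (fun t => a * t + b)).
  exact: cvg_snd.
exact: continuous_affine.
Qed.

Lemma continuous1 : continuous (fst : R * R -> R).
Proof. by move=> p; exact: cvg_fst. Qed.

Lemma continuous2 : continuous (snd : R * R -> R).
Proof. by move=> p; exact: cvg_snd. Qed.

Fact cat_subproof l m :
  [/\ continuous (cat_fun l m), (forall t, A (cat_fun l m t)),
      cat_fun l m 0 = x & cat_fun l m 1 = x].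
Proof.
have nz : (2 : R) != 0 by rewrite pnatr_eq0.
split.
- apply: paste_continuous.
  + have := @continuous_affine 1 (- 2^-1).
    by under eq_fun do rewrite mul1r.
  + apply: continuous_loop_comp.
    by have := @continuous_affine 2 0; under eq_fun do rewrite addr0.
  + exact/continuous_loop_comp/continuous_affine.
  + move=> t /eqP; rewrite subr_eq0 => /eqP ->.
    by rewrite divff // subrr loop_start loop_end.
- by move=> t; rewrite /cat_fun; case: ifP => _; exact: loop_in.
- by rewrite /cat_fun sub0r oppr_le0 invr_ge0 ler0n mulr0 loop_start.
- rewrite /cat_fun ifF ?mulr1; last first.
    by apply: negbTE; rewrite subr_le0 -ltNge invf_lt1 // ltr1n.
  by rewrite -{1}[2]/(1 + 1) addrK loop_end.
Qed.

Definition cat_loop l m : loop A x :=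
  let: And4 c i s e := cat_subproof l m in Loop c i s e.

Lemma cat_loopE l m : cat_loop l m =1 cat_fun l m.
Proof. by rewrite /cat_loop; case: cat_subproof. Qed.

Definition cst_loop : loop A x :=
  @Loop A x (cst x) (@cst_continuous _ _ x) (fun=> Ax) erefl erefl.

Fact rev_subproof l :
  [/\ continuous (fun t : R => l (1 - t)), (forall t, A (l (1 - t))),
      l (1 - 0) = x & l (1 - 1) = x].
Proof.
split=> [|t||].
- apply: continuous_loop_comp.
  have := @continuous_affine (- 1) 1.
  by under eq_fun do rewrite mulN1r addrC.
- exact: loop_in.
- by rewrite subr0 loop_end.
- by rewrite subrr loop_start.
Qed.

Definition rev_loop l : loop A x :=
  let: And4 c i s e := rev_subproof l in Loop c i s e.

Lemma rev_loopE l t : rev_loop l t = l (1 - t).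
Proof. by rewrite /rev_loop; case: rev_subproof. Qed.

Lemma homotopic_reparam l m l' (f h : R -> R) :
  continuous f -> continuous h -> f 0 = h 0 -> f 1 = h 1 ->
  l =1 l' \o f -> m =1 l' \o h -> homotopic l m.
Proof.
move=> cf ch f0 f1 lE mE.
exists (fun p => l' (f p.2 + p.1 * (h p.2 - f p.2))); split.
- apply: continuous_loop_comp => p.
  have cfp : {for p, continuous (fun p : R * R => f p.2)}.
    by apply: continuous_comp; [exact: cvg_snd|exact: cf].
  have chp : {for p, continuous (fun p : R * R => h p.2)}.
    by apply: continuous_comp; [exact: cvg_snd|exact: ch].
  apply: (@continuousD _ _ _ (fun p : R * R => f p.2)
    (fun p : R * R => p.1 * (h p.2 - f p.2))) => //.
  apply: (@continuousM _ _ fst (fun p : R * R => h p.2 - f p.2)).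
    exact: cvg_fst.
  exact: continuousB.
- by move=> p; exact: loop_in.
- by move=> t /=; rewrite mul0r addr0 mul1r addrC subrK lE mE.
- move=> s /=; rewrite -f0 -f1 !subrr !mulr0 !addr0.
  by rewrite -[l' (f 0)]lE -[l' (f 1)]lE loop_start loop_end.
Qed.

Lemma homotopic_refl l : homotopic l l.
Proof.
by apply: (@homotopic_reparam l l l id id) => // t; exact: cvg_id.
Qed.

Lemma homotopic_sym l m : homotopic l m -> homotopic m l.
Proof.
move=> [H [cH AH Hlm Hx]]; exists (fun p => H (-1 * p.1 + 1, p.2)); split.
- exact: (continuous_comp2 cH (@continuous_affine1 _ _) continuous2).
- by move=> p; exact: AH.
- by move=> t; rewrite /= mulr0 add0r mulr1 addNr; have [] := Hlm t.
- by move=> s /=; exact: Hx.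
Qed.

Lemma homotopic_trans l m r :
  homotopic l m -> homotopic m r -> homotopic l r.
Proof.
move=> [H [cH AH Hlm Hx]] [K [cK AK Kmr Kx]].
exists (fun p => if 1 * p.1 + - 2^-1 <= 0 then H (2 * p.1 + 0, p.2)
                 else K (2 * p.1 + - 1, p.2)); split.
- apply: (@paste_continuous _ _ _ (fun p : R * R => 1 * p.1 + - 2^-1)
    (fun p => H (2 * p.1 + 0, p.2)) (fun p => K (2 * p.1 + - 1, p.2))).
  + exact: continuous_affine1.
  + exact: (continuous_comp2 cH (@continuous_affine1 _ _) continuous2).
  + exact: (continuous_comp2 cK (@continuous_affine1 _ _) continuous2).
  + move=> p p0; have -> : 2 * p.1 + 0 = 1 by lra.
    have -> : 2 * p.1 + - 1 = 0 by lra.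
    by have [_ ->] := Hlm p.2; have [->] := Kmr p.2.
- by move=> p; case: ifP.
- move=> t /=; rewrite ifT ?ifF; [|lra|lra].
  have -> : 2 * 0 + 0 = 0 :> R by lra.
  have -> : 2 * 1 + - 1 = 1 :> R by lra.
  by have [] := Hlm t; have [] := Kmr t.
- by move=> s /=; case: ifP => _; [exact: Hx|exact: Kx].
Qed.

Lemma homotopic_cat l l' m m' :
  homotopic l l' -> homotopic m m' ->
  homotopic (cat_loop l m) (cat_loop l' m').
Proof.
move=> [H [cH AH Hl Hx]] [K [cK AK Km Kx]].
exists (fun p => if 1 * p.2 + - 2^-1 <= 0 then H (p.1, 2 * p.2 + 0)
                 else K (p.1, 2 * p.2 + - 1)); split.
- apply: (@paste_continuous _ _ _ (fun p : R * R => 1 * p.2 + - 2^-1)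
    (fun p => H (p.1, 2 * p.2 + 0)) (fun p => K (p.1, 2 * p.2 + - 1))).
  + exact: continuous_affine2.
  + exact: (continuous_comp2 cH continuous1 (@continuous_affine2 _ _)).
  + exact: (continuous_comp2 cK continuous1 (@continuous_affine2 _ _)).
  + move=> p p0; have -> : 2 * p.2 + 0 = 1 by lra.
    have -> : 2 * p.2 + - 1 = 0 by lra.
    by have [_ ->] := Hx p.1; have [->] := Kx p.1.
- by move=> p; case: ifP.
- move=> t; rewrite !cat_loopE /cat_fun /= mul1r addr0.
  by case: ifP => _; [have [] := Hl (2 * t)|have [] := Km (2 * t - 1)].
- move=> s /=; rewrite ifT ?ifF; [|lra|lra].
  have -> : 2 * 0 + 0 = 0 :> R by lra.
  have -> : 2 * 1 + - 1 = 1 :> R by lra.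
  by have [] := Hx s; have [] := Kx s.
Qed.

Lemma homotopic_rev l l' :
  homotopic l l' -> homotopic (rev_loop l) (rev_loop l').
Proof.
move=> [H [cH AH Hl Hx]]; exists (fun p => H (p.1, -1 * p.2 + 1)); split.
- exact: (continuous_comp2 cH continuous1 (@continuous_affine2 _ _)).
- by move=> p; exact: AH.
- move=> t /=; rewrite !rev_loopE mulN1r addrC; exact: Hl.
- move=> s /=; have -> : -1 * 0 + 1 = 1 :> R by lra.
  have -> : -1 * 1 + 1 = 0 :> R by lra.
  by have [] := Hx s.
Qed.

Lemma cat_loop1l l : homotopic (cat_loop cst_loop l) l.
Proof.
apply: (@homotopic_reparam _ _ l
  (fun t => if 2 * t + -1 <= 0 then 0 else 2 * t + -1) id) => //.
- apply: (@paste_continuous R R R (fun t : R => 2 * t + -1) (fun=> 0)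
    (fun t => 2 * t + -1)) => [||| t ->] //.
  + exact: continuous_affine.
  + exact: cst_continuous.
  + exact: continuous_affine.
- by move=> t; exact: cvg_id.
- by rewrite ifT; lra.
- by rewrite ifF; lra.
- move=> t; rewrite cat_loopE /cat_fun /=.
  have -> : (t - 2^-1 <= 0) = (2 * t + -1 <= 0) by apply/idP/idP; lra.
  by case: ifP; rewrite ?loop_start.
Qed.

Lemma cat_loop1r l : homotopic (cat_loop l cst_loop) l.
Proof.
apply: (@homotopic_reparam _ _ l
  (fun t => if 2 * t + -1 <= 0 then 2 * t + 0 else 1) id) => //.
- apply: (@paste_continuous R R R (fun t : R => 2 * t + -1)
    (fun t => 2 * t + 0) (fun=> 1)) => [||| t /=].
  + exact: continuous_affine.
  + exact: continuous_affine.
  + exact: cst_continuous.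
  + lra.
- by move=> t; exact: cvg_id.
- by rewrite ifT; lra.
- by rewrite ifF; lra.
- move=> t; rewrite cat_loopE /cat_fun /= addr0.
  have -> : (t - 2^-1 <= 0) = (2 * t + -1 <= 0) by apply/idP/idP; lra.
  by case: ifP; rewrite ?loop_end.
Qed.

Lemma cat_loopV l : homotopic (cat_loop (rev_loop l) l) cst_loop.
Proof.
apply: (@homotopic_reparam _ _ l
  (fun t => if 2 * t + -1 <= 0 then -2 * t + 1 else 2 * t + -1) (cst 1)) => //.
- apply: (@paste_continuous R R R (fun t : R => 2 * t + -1)
    (fun t => -2 * t + 1)) => [||| t /=]; try exact: continuous_affine.
  lra.
- exact: cst_continuous.
- by rewrite ifT /=; lra.
- by rewrite ifF /=; lra.
- move=> t; rewrite cat_loopE /cat_fun /= rev_loopE.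
  have -> : (t - 2^-1 <= 0) = (2 * t + -1 <= 0) by apply/idP/idP; lra.
  by case: ifP => // _; congr (l _); lra.
- by move=> t /=; rewrite loop_end.
Qed.

Lemma cat_loopA l m r :
  homotopic (cat_loop l (cat_loop m r)) (cat_loop (cat_loop l m) r).
Proof.
apply: homotopic_sym.
pose f (t : R) := if 1 * t + - 4^-1 <= 0 then 2 * t + 0 else
  if 1 * t + - 2^-1 <= 0 then 1 * t + 4^-1 else 2^-1 * t + 2^-1.
apply: (@homotopic_reparam _ _ (cat_loop l (cat_loop m r)) f id) => //.
- apply: (@paste_continuous R R R (fun t : R => 1 * t + - 4^-1)
    (fun t => 2 * t + 0)) => [||| t t0].
  + exact: continuous_affine.
  + exact: continuous_affine.
  + apply: (@paste_continuous R R R (fun t : R => 1 * t + - 2^-1)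
      (fun t => 1 * t + 4^-1)) => [||| t t0]; try exact: continuous_affine.
    lra.
  + by rewrite ifT; lra.
- by move=> t; exact: cvg_id.
- by rewrite /f ifT; lra.
- by rewrite /f !ifF; lra.
- move=> t; rewrite /= !cat_loopE /cat_fun !cat_loopE /cat_fun /f.
  case: (lerP t 4^-1) => t4.
    rewrite (ifT (b := t - 2^-1 <= 0)); last lra.
    rewrite (ifT (b := 2 * t - 2^-1 <= 0)); last lra.
    rewrite (ifT (b := 1 * t + - 4^-1 <= 0)); last lra.
    by rewrite ifT; [congr (l _); lra|lra].
  case: (lerP t 2^-1) => t2.
    rewrite (ifT (b := t - 2^-1 <= 0)); last lra.
    rewrite (ifF (b := 2 * t - 2^-1 <= 0)); last lra.
    rewrite (ifF (b := 1 * t + - 4^-1 <= 0)); last lra.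
    rewrite (ifT (b := 1 * t + - 2^-1 <= 0)); last lra.
    rewrite ifF; last lra.
    by rewrite ifT; [congr (m _); lra|lra].
  rewrite (ifF (b := t - 2^-1 <= 0)); last lra.
  rewrite (ifF (b := 1 * t + - 4^-1 <= 0)); last lra.
  rewrite (ifF (b := 1 * t + - 2^-1 <= 0)); last lra.
  rewrite ifF; last lra.
  by rewrite ifF; [congr (r _); lra|lra].
Qed.

End Loops.

Section FundamentalGroup.
Context {R : realType} {S : topologicalType}.
Implicit Types (A : set S) (x : S).

Definition homotopicb A x : rel (loop A x) := fun l m : @loop R S A x =>
  `[< homotopic l m >].

Lemma homotopicb_refl A x : reflexive (@homotopicb A x).
Proof. by move=> l; apply/asboolP; exact: homotopic_refl. Qed.

Lemma homotopicb_sym A x : symmetric (@homotopicb A x).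
Proof. by move=> l m; apply/asboolP/asboolP; exact: homotopic_sym. Qed.

Lemma homotopicb_trans A x : transitive (@homotopicb A x).
Proof.
move=> m l r /asboolP lm /asboolP mr; apply/asboolP.
exact: homotopic_trans lm mr.
Qed.

Canonical homotopy_equiv A x := EquivRel (@homotopicb A x)
  (@homotopicb_refl A x) (@homotopicb_sym A x) (@homotopicb_trans A x).

Definition pi1 A x (Ax : A x) := {eq_quot (homotopy_equiv A x)}.

HB.instance Definition _ A x (Ax : A x) := Choice.on (pi1 Ax).

Context {A : set S} {x : S} {Ax : A x}.

Definition hclass (l : loop A x) : pi1 Ax := \pi l.

Definition hrepr (a : pi1 Ax) : loop A x := repr a.

Lemma hreprK : cancel hrepr hclass.
Proof. exact: reprK. Qed.

Lemma hclassP l m : hclass l = hclass m <-> homotopic l m.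
Proof. by split=> [/eqmodP /asboolP|h]; last exact/eqmodP/asboolP. Qed.

Lemma hrepr_class l : homotopic (hrepr (hclass l)) l.
Proof. by apply/hclassP; rewrite hreprK. Qed.

Definition pi1_mul (a b : pi1 Ax) := hclass (cat_loop (hrepr a) (hrepr b)).
Definition pi1_inv (a : pi1 Ax) := hclass (rev_loop (hrepr a)).

Lemma hclass_cat l m : hclass (cat_loop l m) = pi1_mul (hclass l) (hclass m).
Proof.
apply/hclassP; apply: homotopic_cat; apply: homotopic_sym;
  exact: hrepr_class.
Qed.

Lemma hclass_rev l : hclass (rev_loop l) = pi1_inv (hclass l).
Proof. by apply/hclassP/homotopic_rev/homotopic_sym/hrepr_class. Qed.

Let mulA : associative pi1_mul.
Proof.
move=> a b c; rewrite -[a]hreprK -[b]hreprK -[c]hreprK -!hclass_cat.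
exact/hclassP/cat_loopA.
Qed.

Let mul1l : left_id (hclass (cst_loop Ax)) pi1_mul.
Proof.
by move=> a; rewrite -[a]hreprK -hclass_cat; exact/hclassP/cat_loop1l.
Qed.

Let mul1r : right_id (hclass (cst_loop Ax)) pi1_mul.
Proof.
by move=> a; rewrite -[a]hreprK -hclass_cat; exact/hclassP/cat_loop1r.
Qed.

Let mulVl : left_inverse (hclass (cst_loop Ax)) pi1_inv pi1_mul.
Proof.
move=> a; rewrite -[a]hreprK -hclass_rev -hclass_cat.
exact/hclassP/cat_loopV.
Qed.

Let mulVr : right_inverse (hclass (cst_loop Ax)) pi1_inv pi1_mul.
Proof.
move=> a; rewrite -[LHS]mul1l -{1}(mulVl (pi1_inv a)) -mulA.
by rewrite [pi1_mul (pi1_inv a) _]mulA mulVl mul1l mulVl.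
Qed.

HB.instance Definition _ :=
  isGroup.Build (pi1 Ax) mulA mul1l mul1r mulVl mulVr.

End FundamentalGroup.

Section Orientation.
Context {R : realType} {S : topologicalType}.

Definition open_embedding (f : R * R -> S) :=
  [/\ continuous f, injective f & forall U, open U -> open (f @` U)].

Definition circle_pt (p : R * R) (r t : R) : R * R :=
  (p.1 + r * cos (2 * pi * t), p.2 + r * sin (2 * pi * t)).

(* f^-1 \o e maps the small positively oriented circles centred at p to loops *)
(* with winding number 1 around q; m and theta are polar coordinates centred  *)
(* at q along such a loop, the angle being counted in turns.                  *)
Definition positive_at (e f : R * R -> S) (p q : R * R) :=
  exists2 d : R, 0 < d & forall r, 0 < r < d ->
    exists m theta : R -> R,
    [/\ continuous m, continuous theta, (forall t, 0 < m t),
        theta 1 = theta 0 + 1 &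
        forall t, 0 <= t <= 1 ->
          e (circle_pt p r t) = f (circle_pt q (m t) (theta t))].

Definition same_orientation (e f : R * R -> S) :=
  forall p q, e p = f q -> positive_at e f p q.

End Orientation.

(* The charts are the inverse maps of the elements of positive_chart, which   *)
(* form a maximal oriented atlas.  The genus is not a field: it is fixed by   *)
(* the presentation in is_standard below.                                     *)
Record oriented_surface (R : realType) := OrientedSurface {
  surface_space :> topologicalType;
  positive_chart : set (R * R -> surface_space);
  surface_hausdorff : hausdorff_space surface_space;
  surface_compact : compact [set: surface_space];
  surface_connected : connected [set: surface_space];
  positive_chart_open : positive_chart `<=` open_embedding;
  positive_chart_cover :
    forall x : surface_space, exists2 f, positive_chart f & range f x;
  positive_chart_same :
    forall e f, positive_chart e -> positive_chart f -> same_orientation e f;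
  positive_chart_max : forall e, open_embedding e ->
    (forall f, positive_chart f -> same_orientation e f) -> positive_chart e }.

Arguments positive_chart {R} o _.

Record punctured_surface (R : realType) (n : nat) := PuncturedSurface {
  punctured_space :> oriented_surface R;
  puncture : 'I_n -> punctured_space;
  base : punctured_space;
  puncture_inj : injective puncture;
  base_in : (~` range puncture) base }.

Arguments puncture {R n} p i.
Arguments base {R n} p.

Definition Lambda (R : realType) (n : nat) (X : punctured_surface R n) :=
  @pi1 R X _ _ (@base_in R n X).
HB.instance Definition _ R n (X : punctured_surface R n) := Group.on (Lambda X).

Definition loop_class (R : realType) (n : nat) (X : punctured_surface R n)
    (l : @loop R X (~` range (puncture X)) (base X)) : Lambda X :=
  @hclass R X _ _ (@base_in R n X) l.

Definition loop_repr (R : realType) (n : nat) (X : punctured_surface R n)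
    (a : Lambda X) : @loop R X (~` range (puncture X)) (base X) :=
  @hrepr R X _ _ (@base_in R n X) a.

Section MappingClasses.
Context {R : realType} {n : nat} {X : punctured_surface R n}.

(* Orientation preserving homeomorphisms preserving the punctures setwise.    *)
(* The positive charts form a maximal oriented atlas of a connected surface,  *)
(* so preserving the orientation amounts to preserving this atlas.            *)
Record homeo := Homeo {
  homeo_fun :> X -> X;
  homeo_inv : X -> X;
  homeo_continuous : continuous homeo_fun;
  homeo_inv_continuous : continuous homeo_inv;
  homeoK : cancel homeo_fun homeo_inv;
  homeoVK : cancel homeo_inv homeo_fun;
  homeo_orientation :
    forall f, positive_chart X f <-> positive_chart X (homeo_fun \o f);
  homeo_punctures : homeo_fun @` range (puncture X) = range (puncture X) }.

HB.instance Definition _ := gen_eqMixin homeo.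
HB.instance Definition _ := gen_choiceMixin homeo.

Lemma homeo_eq (h k : homeo) : h =1 k -> h = k.
Proof.
case: h k => [h h' c c' hK h'K o p] [k k' d d' kK k'K o' p'] /= /funext hk.
subst k; have hk' : h' = k'.
  by apply/funext => x; rewrite -[x in LHS]k'K hK.
subst k'; congr Homeo; exact: Prop_irrelevance.
Qed.

Let one_punctures :
  (id : X -> X) @` range (puncture X) = range (puncture X).
Proof. exact: image_id. Qed.

Definition homeo_one : homeo := @Homeo id id
  (fun x => cvg_id) (fun x => cvg_id) (fun=> erefl) (fun=> erefl)
  (fun f => iff_refl _) one_punctures.

Fact homeo_mul_subproof (h k : homeo) :
  [/\ continuous (h \o k), continuous (homeo_inv k \o homeo_inv h),
      (forall f, positive_chart X f <-> positive_chart X ((h \o k) \o f)) &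
      (h \o k) @` range (puncture X) = range (puncture X)].
Proof.
split.
- by move=> x; apply: continuous_comp; exact: homeo_continuous.
- by move=> x; apply: continuous_comp; exact: homeo_inv_continuous.
- move=> f; rewrite (homeo_orientation k) (homeo_orientation h).
  by rewrite compA.
- by rewrite -image_comp !homeo_punctures.
Qed.

Definition homeo_mul (h k : homeo) : homeo :=
  let: And4 c c' o p := homeo_mul_subproof h k in
  Homeo c c' (can_comp (@homeoK h) (@homeoK k))
    (can_comp (@homeoVK k) (@homeoVK h)) o p.

Lemma homeo_mulE h k : homeo_mul h k =1 h \o k.
Proof. by rewrite /homeo_mul; case: homeo_mul_subproof. Qed.

Fact homeo_inv_subproof (h : homeo) :
  (forall f, positive_chart X f <-> positive_chart X (homeo_inv h \o f)) /\
  homeo_inv h @` range (puncture X) = range (puncture X).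
Proof.
split.
- move=> f; rewrite (homeo_orientation h (homeo_inv h \o f)) compA.
  by have -> : h \o homeo_inv h = id by apply/funext => x; exact: homeoVK.
- rewrite -[in LHS](homeo_punctures h) image_comp.
  by rewrite (_ : _ \o _ = id) ?image_id //; apply/funext => x; exact: homeoK.
Qed.

Definition homeo_V (h : homeo) : homeo :=
  let: conj o p := homeo_inv_subproof h in
  Homeo (@homeo_inv_continuous h) (@homeo_continuous h) (@homeoVK h)
    (@homeoK h) o p.

Lemma homeo_VE h : homeo_V h =1 homeo_inv h.
Proof. by rewrite /homeo_V; case: homeo_inv_subproof. Qed.

Let homeo_mulA : associative homeo_mul.
Proof. by move=> h k l; apply: homeo_eq => x; rewrite !(homeo_mulE, compE). Qed.

Let homeo_mul1l : left_id homeo_one homeo_mul.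
Proof. by move=> h; apply: homeo_eq => x; rewrite homeo_mulE. Qed.

Let homeo_mul1r : right_id homeo_one homeo_mul.
Proof. by move=> h; apply: homeo_eq => x; rewrite homeo_mulE. Qed.

Let homeo_mulVl : left_inverse homeo_one homeo_V homeo_mul.
Proof.
by move=> h; apply: homeo_eq => x; rewrite homeo_mulE /= homeo_VE homeoK.
Qed.

Let homeo_mulVr : right_inverse homeo_one homeo_V homeo_mul.
Proof.
by move=> h; apply: homeo_eq => x; rewrite homeo_mulE /= homeo_VE homeoVK.
Qed.

HB.instance Definition _ := isGroup.Build homeo
  homeo_mulA homeo_mul1l homeo_mul1r homeo_mulVl homeo_mulVr.

Definition isotopic (h k : homeo) := exists H : R * X -> X,
  [/\ continuous H,
      (forall t, exists m : homeo, forall x, H (t, x) = m x),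
      (forall x, H (0, x) = h x /\ H (1, x) = k x) &
      (forall t i, H (t, puncture X i) = h (puncture X i))].

Definition mapping_class (h : homeo) : set homeo := [set k | isotopic h k].

Definition pure_mapping_class_group : set (set homeo) :=
  mapping_class @` [set h : homeo | forall i, h (puncture X i) = puncture X i].

Definition fixes_base : {pred homeo} := fun h => `[< h (base X) = base X >].

Record pointed_homeo := PointedHomeo {
  pointed_val :> homeo;
  _ : pointed_val \in fixes_base }.

HB.instance Definition _ := [isSub for pointed_val].
HB.instance Definition _ := [Choice of pointed_homeo by <:].

Fact fixes_base_closed : group_closed fixes_base.
Proof.
split; first exact/asboolP.
move=> h k /asboolP hb /asboolP kb; apply/asboolP.
rewrite homeo_mulE /= homeo_VE -[in LHS]kb homeoK.
exact: hb.
Qed.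

HB.instance Definition _ :=
  SubChoice_isSubGroup.Build homeo fixes_base pointed_homeo fixes_base_closed.

Lemma pointed_base (h : pointed_homeo) : h (base X) = base X.
Proof. by case: h => h /= /asboolP. Qed.

Local Notation A := (~` range (puncture X)).
Local Notation loopX := (@loop R X A (base X)).

Lemma homeo_complement (h : homeo) x : A x -> A (h x).
Proof.
move=> Ax Yhx; apply: Ax; move: Yhx; rewrite -{1}(homeo_punctures h).
by move=> -[y Yy /(can_inj (@homeoK h)) <-].
Qed.

Fact push_subproof (h : pointed_homeo) (l : loopX) :
  [/\ continuous (h \o l), (forall t, A (h (l t))),
      h (l 0) = base X & h (l 1) = base X].
Proof.
split.
- move=> t; apply: continuous_comp; first exact: loop_continuous.
  exact: homeo_continuous.
- by move=> t; apply: homeo_complement; exact: loop_in.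
- by rewrite loop_start pointed_base.
- by rewrite loop_end pointed_base.
Qed.

Definition push_loop (h : pointed_homeo) (l : loopX) :
    loopX :=
  let: And4 c i s e := push_subproof h l in Loop c i s e.

Lemma push_loopE h l : push_loop h l =1 h \o l.
Proof. by rewrite /push_loop; case: push_subproof. Qed.

Lemma homotopic_push h l m :
  homotopic l m -> homotopic (push_loop h l) (push_loop h m).
Proof.
move=> [H [cH AH Hlm Hx]]; exists (h \o H); split.
- move=> p; apply: continuous_comp; first exact: cH.
  exact: homeo_continuous.
- by move=> p; apply: homeo_complement; exact: AH.
- by move=> t; rewrite !push_loopE /=; have [-> ->] := Hlm t.
- by move=> s /=; have [-> ->] := Hx s; rewrite pointed_base.
Qed.

Definition push (h : pointed_homeo) (a : Lambda X) : Lambda X :=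
  loop_class (push_loop h (loop_repr a)).

Lemma push_class h (l : loopX) :
  push h (loop_class l) = loop_class (push_loop h l).
Proof. by apply/hclassP; apply: homotopic_push; exact: hrepr_class. Qed.

Section CharacterVariety.
Context {G : groupType}.
Implicit Type rho : Lambda X -> G.

Definition conj_class rho : set (Lambda X -> G) :=
  [set rho' | exists p : G, forall a, rho' a = (p * rho a * p^-1)%g].

Definition act (h : pointed_homeo) rho : Lambda X -> G :=
  fun a => rho (push h^-1%g a).

(* A mapping class acts on conjugacy classes through any of its               *)
(* representatives fixing the base point.                                     *)
Definition pure_orbit rho : set (set (Lambda X -> G)) :=
  [set c | exists (m : set homeo) (h : pointed_homeo),
    [/\ pure_mapping_class_group m, m h & c = conj_class (act h rho)]].

End CharacterVariety.

End MappingClasses.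

Arguments homeo {R n} X.
Arguments pointed_homeo {R n} X.

Inductive generated (G : groupType) (T : set G) : G -> Prop :=
| generated_in x : T x -> generated T x
| generated1 : generated T 1%g
| generatedM x y : generated T x -> generated T y -> generated T (x * y)%g
| generatedV x : generated T x -> generated T x^-1%g.

(* The elementary moves, indexed from 0:                                      *)
(*   tau_alpha k = tau_(2(k+1)),        tau_beta k = tau_(2(k+1)-1),          *)
(*   tau_theta k (k+1) = tau_(2g+k+1),  tau_xi (g-1) k = tau_(3g-1+k+1),      *)
(*   half_twist k (k+1) = sigma_(k+1).                                        *)
Inductive move (g n : nat) :=
| tau_alpha (k : 'I_g)
| tau_beta (k : 'I_g)
| tau_theta (k l : 'I_g) of l = k.+1 :> nat
| tau_xi (m : 'I_g) (k : 'I_n) of m.+1 = g & (k.+1 < n)%N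
| half_twist (k l : 'I_n) of l = k.+1 :> nat.

Section Words.
Context {g n : nat} {G : groupType}.
Variables (a b : 'I_g -> G) (c : 'I_n -> G).
Local Open Scope group_scope.

Definition surface_relation : Prop :=
  (\prod_(i < g) (a i * b i * (a i)^-1 * (b i)^-1)) * (\prod_(j < n) c j) = 1.

Definition theta (k l : 'I_g) : G := a l * (b l)^-1 * (a l)^-1 * b k.

Definition xi (m : 'I_g) (k : 'I_n) : G :=
  (\prod_(i < n | (i <= k)%N) c i)^-1 * b m.

Definition move_alpha (s : move g n) : 'I_g -> G :=
  match s with
  | tau_alpha k => [eta a with k |-> a k * b k]
  | tau_theta k l _ =>
      [eta a with k |-> a k * theta k l, l |-> (theta k l)^-1 * a l]
  | tau_xi m k _ _ => [eta a with m |-> a m * xi m k]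
  | _ => a
  end.

Definition move_beta (s : move g n) : 'I_g -> G :=
  match s with
  | tau_beta k => [eta b with k |-> b k * a k]
  | tau_theta k l _ =>
      [eta b with k |-> (theta k l)^-1 * b k * theta k l]
  | tau_xi m k _ _ => [eta b with m |-> (xi m k)^-1 * b m * xi m k]
  | _ => b
  end.

Definition move_gamma (s : move g n) : 'I_n -> G :=
  match s with
  | tau_xi m k _ _ =>
      fun i => if (i <= k)%N then (xi m k)^-1 * c i * xi m k else c i
  | half_twist k l _ => [eta c with k |-> c k * c l * (c k)^-1, l |-> c k]
  | _ => c
  end.

Definition move_puncture (s : move g n) : 'I_n -> 'I_n :=
  match s with half_twist k l _ => tperm k l | _ => id end.

End Words.

Section StandardGenerators.
Context {R : realType} {g n : nat} {X : punctured_surface R n}.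
Variables (a b : 'I_g -> Lambda X) (c : 'I_n -> Lambda X).

Definition is_presentation : Prop :=
  [/\ surface_relation a b c,
      (forall (G : groupType) (a' b' : 'I_g -> G) (c' : 'I_n -> G),
         surface_relation a' b' c' ->
         exists f : {multiplicative Lambda X -> G},
           [/\ f \o a =1 a', f \o b =1 b' & f \o c =1 c']) &
      (forall (G : groupType) (f f' : {multiplicative Lambda X -> G}),
         f \o a =1 f' \o a -> f \o b =1 f' \o b -> f \o c =1 f' \o c ->
         f =1 f')].

Definition unit_disc : set (R * R) := [set p | p.1 ^+ 2 + p.2 ^+ 2 <= 1].

(* d is represented by the boundary of an embedded disc centred at the        *)
(* puncture y_j and containing no other puncture.                             *)
Definition is_simple_loop_around (j : 'I_n) (d : Lambda X) :=
  exists e : R * R -> X, exists l,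
  [/\ continuous e, {in unit_disc &, injective e}, e (0, 0) = puncture X j,
      (forall p i, unit_disc p -> e p = puncture X i -> i = j) &
      d = loop_class l /\
      (forall t, 0 <= t <= 1 -> l t = e (circle_pt (0, 0) 1 t))].

Definition realizes (s : move g n) (h : pointed_homeo X) : Prop :=
  [/\ push h \o a =1 move_alpha a b c s, push h \o b =1 move_beta a b c s,
      push h \o c =1 move_gamma b c s &
      forall i, h (puncture X i) = puncture X (move_puncture s i)].

(* The last field states that the elements T s generate a group of pointed    *)
(* homeomorphisms which maps onto the full mapping class group.  The T s are  *)
(* Dehn twists and half-twists in the geometric construction; only their      *)
(* effect on Lambda and on the punctures is recorded.                         *)
Record is_standard : Prop := IsStandard {
  standard_presentation : is_presentation;
  standard_loops : forall j, is_simple_loop_around j (c j);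
  standard_moves : exists T : move g n -> pointed_homeo X,
    (forall s, realizes s (T s)) /\
    (forall h : homeo X,
       exists2 k : pointed_homeo X, generated (range T) k & isotopic h k) }.

End StandardGenerators.

Section UnitGroup.
Context {A : unitRingType}.

Record units := Units { units_val :> A; _ : units_val \is a GRing.unit }.

HB.instance Definition _ := [isSub for units_val].
HB.instance Definition _ := [Choice of units by <:].

Lemma unitsP (x : units) : units_val x \is a GRing.unit.
Proof. by case: x. Qed.

Fact units_mul_subproof (x y : units) :
  units_val x * units_val y \is a GRing.unit.
Proof. by rewrite unitrMl ?unitsP. Qed.

Fact units_inv_subproof (x : units) : (units_val x)^-1 \is a GRing.unit.
Proof. by rewrite unitrV unitsP. Qed.

Definition units_one := Units (unitr1 A).
Definition units_mul x y := Units (units_mul_subproof x y).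
Definition units_inv x := Units (units_inv_subproof x).

Let units_mulA : associative units_mul.
Proof. by move=> x y z; apply: val_inj; rewrite /= mulrA. Qed.

Let units_mul1l : left_id units_one units_mul.
Proof. by move=> x; apply: val_inj; rewrite /= mul1r. Qed.

Let units_mul1r : right_id units_one units_mul.
Proof. by move=> x; apply: val_inj; rewrite /= mulr1. Qed.

Let units_mulVl : left_inverse units_one units_inv units_mul.
Proof. by move=> x; apply: val_inj; rewrite /= mulVr ?unitsP. Qed.

Let units_mulVr : right_inverse units_one units_inv units_mul.
Proof. by move=> x; apply: val_inj; rewrite /= mulrV ?unitsP. Qed.

HB.instance Definition _ := isGroup.Build units
  units_mulA units_mul1l units_mul1r units_mulVl units_mulVr.

End UnitGroup.
Arguments units A : clear implicits.

Definition GL2 (R : realType) := units 'M[R[i]]_2.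
HB.instance Definition _ R := Group.on (GL2 R).

Definition Cstar (R : realType) := units R[i].
HB.instance Definition _ R := Group.on (Cstar R).

Definition mx2 (K : Type) (a b c d : K) : 'M[K]_2 :=
  \matrix_(i < 2, j < 2)
    if i == 0 then (if j == 0 then a else b) else (if j == 0 then c else d).

(* Only meaningful for finite A: fset_set A is empty otherwise. *)
Definition set_card (T : choiceType) (A : set T) : nat := #|` fset_set A|%fset.

Section Representations.
Context {R : realType} {n : nat} {X : punctured_surface R n}.

Definition reducible (rho : Lambda X -> GL2 R) : Prop :=
  exists2 v : 'cV[R[i]]_2, v != 0 &
    forall x, exists k : R[i], units_val (rho x) *m v = k *: v.

Definition is_direct_sum (rho : Lambda X -> GL2 R)
    (lambda1 lambda2 : Lambda X -> Cstar R) : Prop :=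
  exists p : GL2 R, forall x, units_val (p * rho x * p^-1)%g =
    mx2 (units_val (lambda1 x)) 0 0 (units_val (lambda2 x)).

Fact twist_subproof (k : Cstar R) (m : GL2 R) :
  units_val k *: units_val m \is a GRing.unit.
Proof. by rewrite unitmxZ; exact: unitsP. Qed.

Definition twist (lambda : Lambda X -> Cstar R) (rho : Lambda X -> GL2 R) :
    Lambda X -> GL2 R :=
  fun x => Units (twist_subproof (lambda x) (rho x)).

(* rho = rho_(mu,c) in genus 1, where k : 'I_1 is the index of alpha_1 and    *)
(* beta_1.                                                                    *)
Definition is_rho_mu_c {g : nat} (alpha beta : 'I_g -> Lambda X)
    (gamma : 'I_n -> Lambda X) (mu : R[i]) (c : 'I_n -> R[i])
    (rho : Lambda X -> GL2 R) : Prop :=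
  [/\ (forall k, units_val (rho (alpha k)) = mx2 mu 0 0 1),
      (forall k, units_val (rho (beta k)) = mx2 1 (- (mu - 1)^-1) 0 1) &
      (forall i, units_val (rho (gamma i)) = mx2 1 (c i) 0 1)].

End Representations.

(* Main.v *)
(* Up to conjugation, a reducible representation is x |-> l(x) (chi(x), tau(x); *)
(* 0, 1) for characters l, chi and a cocycle tau of chi.  Isotopic homeomorphisms *)
(* fixing the base point act on Lambda by maps which agree up to an inner         *)
(* automorphism, so a pure class sends each gamma_i to a conjugate and the tau    *)
(* moves give enough elements of the orbit.                                       *)
(* On a character with image mu_N these moves act by transvections: by Euclid's   *)
(* algorithm its orbit contains every assignment of values in mu_N to the alpha's *)
(* and beta's for which the last handle carries a generator of mu_N, the values   *)
(* at the gamma's being fixed.                                                    *)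
(* If the orbit of rho is finite, iterating twists shows that l and chi have      *)
(* finite image, and that tau vanishes on every handle where chi is trivial.  If  *)
(* the extension does not split, some element of the orbit has                    *)
(* chi(alpha_g) <> 1, chi(beta_g) = 1, tau(beta_g) <> 0 and chi trivial on the    *)
(* other handles; twisting again forces chi to be trivial on all gamma's and the  *)
(* genus to be 1, which is case (2).                                              *)
(* For the estimates, a class in case (1) is determined by the images of the      *)
(* alpha's and beta's, and a class is obtained from at most two values of each    *)
(* lambda_i.  In case (2) it is determined by l, by (chi(alpha_1), chi(beta_1))   *)
(* <> (1, 1) and by the translations at the gamma's up to a common factor, which  *)
(* are those of rho multiplied by N-th roots of unity.                            *)

Require Import Defs.
From HB Require Import structures.
From mathcomp Require Import all_boot all_order all_algebra.
From mathcomp Require Import complex finmap perm ring lra zify.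
From mathcomp Require Import boolp classical_sets functions cardinality reals.
From mathcomp Require Import topology normedtype.
From mathcomp Require cyclic.

Set Implicit Arguments.
Unset Strict Implicit.
Unset Printing Implicit Defensive.

Import Order.TTheory GRing.Theory Num.Theory.
Import numFieldNormedType.Exports.
Local Open Scope classical_set_scope.
Local Open Scope ring_scope.

(** * Mapping classes and the fundamental group *)

(** Up to conjugation, a reducible representation is a character [l] times the matrices of affine
    maps z -> chi(x) z + tau(x), where [chi] is a character and [tau] a cocycle for it
    ([reducible_triangular]). If these maps have a common fixed point, that is, if [tau] is a
    coboundary, then the representation is a direct sum of characters ([split_direct_sum]). All that
    is used of mapping classes is collected in [surface_action]: the twists act by explicit
    substitutions, and a pure class sends each gamma_i to a conjugate of itself
    ([standard_surface_action]), so that the values of a character at the punctures are constant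
    along its orbit.

    Characters: the twists in one handle act on the pair of values there by elementary operations,
    and Euclid's algorithm concentrates the pair in one entry. The twists between handles and around
    punctures then gather the whole image in the last handle and spread it again. For an image of
    order N this yields [char_orbit]: every assignment of N-th roots of unity to the handles is
    reached, provided that the last handle carries a primitive one.

    Finite orbits: among the powers of one twist, two must give conjugate representations. Comparing
    them shows that both diagonal characters have finite order ([torsion_exponent]) and that [tau]
    vanishes on handles where [chi] is trivial ([good_handle]). If [tau] is not a coboundary,
    [exists_special] finds an element of the orbit in which beta_g is a nonzero translation, alpha_g
    is not a translation, and [chi] is trivial on the other handles. Then [special_c] and
    [special_genus] make all gamma_i translations and the genus 1, and a rescaling gives rho_(mu,c)
    ([finite_orbit_form]).

    Counting: a direct sum in the orbit is determined by its values on the handles, which bounds the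
    orbit from above. Conjugation can at most exchange the two diagonal characters
    ([triangular_conj]), so the N^(2g-1) characters supplied by [char_orbit] give at least half as
    many classes. In the non-split case a class is determined by [l], by the nontrivial values of
    [chi] on the handle, and by the translations at the punctures up to a common factor, each of
    which only changes by an N-th root of unity. Conversely these roots can be prescribed
    independently ([scale_all]) together with any primitive pair of values of [chi]
    ([unipotent_reach]). The upper bounds also prove that the orbits of both forms are finite. *)

Section Push.
Context {R : realType} {n : nat} {X : punctured_surface R n}.
Local Notation A := (~` range (puncture X)).
Local Notation loopX := (@loop R X A (base X)).
Implicit Types h k : pointed_homeo X.

Lemma push_mul h k x : push (h * k)%g x = push h (push k x).
Proof.
rewrite -[x]hreprK [hclass _](erefl : _ = loop_class _) !push_class.
congr loop_class; apply: loop_eq => t; rewrite !push_loopE /= push_loopE /=.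
by rewrite homeo_mulE.
Qed.

Lemma push_one x : push (1%g : pointed_homeo X) x = x.
Proof.
rewrite -[x]hreprK [hclass _](erefl : _ = loop_class _) push_class.
by congr loop_class; apply: loop_eq => t; rewrite push_loopE.
Qed.

Lemma push_morph h x y : push h (x * y)%g = (push h x * push h y)%g.
Proof.
have E (l m : loopX) :
    (loop_class l * loop_class m)%g = loop_class (cat_loop l m).
  by rewrite /loop_class hclass_cat.
rewrite -[x]hreprK -[y]hreprK [hclass _](erefl : _ = loop_class _).
rewrite [hclass (hrepr y)](erefl : _ = loop_class _).
rewrite E !push_class E; congr loop_class; apply: loop_eq => t.
rewrite push_loopE /= !cat_loopE /cat_fun.
by case: ifP; rewrite push_loopE.
Qed.

Lemma isotopic_refl (h : homeo X) : isotopic h h.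
Proof.
exists (fun p => h p.2); split=> //.
- move=> p; apply: cvg_comp; first exact: cvg_snd.
  exact: homeo_continuous.
- by move=> t; exists h.
Qed.

(* Both products are images of paths from (0, 0) to (1, 1) in the square under *)
(* (s, t) |-> H (s, l t), and these paths are homotopic by convexity. *)
Lemma isotopic_push h k : isotopic h k ->
  exists u : Lambda X, forall x, (push h x * u)%g = (u * push k x)%g.
Proof.
move=> [H [cH Hm H01 Hp]].
(* The path ([lo], [hi]) follows the image of the loop under the initial map and then the track of
   the base point; ([hi], [lo]) follows the track first and then the image under the final map. *)
pose lo (t : R) : R := if 2 * t + -1 <= 0 then 0 else 2 * t + -1.
pose hi (t : R) : R := if 2 * t + -1 <= 0 then 2 * t + 0 else 1.
have clo : continuous lo.
  apply: (@paste_continuous R R R (fun t : R => 2 * t + -1) (fun=> 0)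
    (fun t => 2 * t + -1)) => [||| t ->] //; first exact: continuous_affine.
  - exact: cst_continuous.
  - exact: continuous_affine.
have chi : continuous hi.
  apply: (@paste_continuous R R R (fun t : R => 2 * t + -1)
    (fun t => 2 * t + 0) (fun=> 1)) => [||| t /=].
  - exact: continuous_affine.
  - exact: continuous_affine.
  - exact: cst_continuous.
  - lra.
have cH2 (T : topologicalType) (f : T -> R) (m : T -> X) :
    continuous f -> continuous m -> continuous (fun p => H (f p, m p)).
  move=> cf cm p.
  apply: (@continuous2_cvg _ _ _ _ (nbhs p) _ f m (fun a b => H (a, b))).
  - have -> : (fun z : R * X => H (z.1, z.2)) = H by apply/funext => -[].
    exact: cH.
  - exact: cf.
  - exact: cm.
have AH t x : A x -> A (H (t, x)).
  by move=> Ax; have [m ->] := Hm t; exact: homeo_complement.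
have H0 : H (0, base X) = base X by have [-> _] := H01 (base X); rewrite pointed_base.
have H1 : H (1, base X) = base X by have [_ ->] := H01 (base X); rewrite pointed_base.
have cdelta : continuous (fun t : R => H (t, base X)).
  by apply: cH2 => t; [exact: cvg_id|exact: cvg_cst].
pose delta : loopX := Loop cdelta (fun t => AH t _ (@base_in R n X)) H0 H1.
exists (loop_class delta) => x.
rewrite -[x]hreprK [hclass _](erefl : _ = loop_class _) !push_class.
set l := hrepr x.
have E (p q : loopX) :
    (loop_class p * loop_class q)%g = loop_class (cat_loop p q).
  by rewrite /loop_class hclass_cat.
rewrite !E; apply/hclassP.
pose F (p : R * R) := H (p.1, l p.2).
have cF : continuous F.
  apply: cH2; first exact: continuous1.
  by apply: continuous_loop_comp; exact: continuous2.
have cmix (f e : R -> R) : continuous f -> continuous e ->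
    continuous (fun p : R * R => f p.2 + p.1 * (e p.2 - f p.2)).
  move=> cf ce p.
  have cfp : {for p, continuous (fun p : R * R => f p.2)}.
    by apply: continuous_comp; [exact: cvg_snd|exact: cf].
  have cep : {for p, continuous (fun p : R * R => e p.2)}.
    by apply: continuous_comp; [exact: cvg_snd|exact: ce].
  apply: (@continuousD _ _ _ (fun p : R * R => f p.2)
    (fun p : R * R => p.1 * (e p.2 - f p.2))) => //.
  apply: (@continuousM _ _ fst (fun p : R * R => e p.2 - f p.2)).
    exact: cvg_fst.
  exact: continuousB.
exists (fun p => F (lo p.2 + p.1 * (hi p.2 - lo p.2),
                    hi p.2 + p.1 * (lo p.2 - hi p.2))); split.
- by apply: (continuous_comp2 cF); apply: cmix.
- by move=> p; exact: (AH _ _ (loop_in l _)).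
- move=> t /=; rewrite !mul0r !mul1r !addr0 ![_ + (_ - _)]addrC !subrK.
  rewrite !cat_loopE /cat_fun /= !push_loopE /= /F /lo /hi /=.
  have -> : (t - 2^-1 <= 0) = (2 * t + -1 <= 0) by apply/idP/idP; lra.
  case: ifP => _ /=; rewrite ?addr0 ?loop_start ?loop_end.
    by have [-> _] := H01 (l (2 * t)).
  by have [_ ->] := H01 (l (2 * t - 1)).
- have lo0 : lo 0 = 0 by rewrite /lo ifT; lra.
  have hi0 : hi 0 = 0 by rewrite /hi ifT; lra.
  have lo1 : lo 1 = 1 by rewrite /lo ifF; lra.
  have hi1 : hi 1 = 1 by rewrite /hi ifF; lra.
  move=> s; rewrite /= lo0 hi0 lo1 hi1 !subrr !mulr0 !addr0 /F /=.
  by rewrite loop_start loop_end.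
Qed.

End Push.

(** * Generation by the standard loops, and the pure mapping class group as an abstract action *)

Section Generation.
Context {G : groupType} (T : set G).

Definition generated_pred : {pred G} := fun x => `[< generated T x >].

(** The subgroup is packaged as a group in its own right, so that it can serve as the target in the
    universal property of a presentation. *)
Record generated_group := GeneratedGroup {
  generated_val :> G;
  _ : generated_val \in generated_pred }.

HB.instance Definition _ := [isSub for generated_val].
HB.instance Definition _ := [Choice of generated_group by <:].

Fact generated_closed : group_closed generated_pred.
Proof.
split; first exact/asboolP/generated1.
move=> h k /asboolP hb /asboolP kb; apply/asboolP.
by apply: generatedM => //; exact: generatedV.
Qed.

HB.instance Definition _ :=
  SubChoice_isSubGroup.Build G generated_pred generated_group generated_closed.

End Generation.

Section Morphisms.
Context {G H : groupType}.

Lemma multiplicative1 (f : {multiplicative G -> H}) : f 1%g = 1%g.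
Proof. by apply: (@mulIg _ (f 1%g)); rewrite -gmulfM !mul1g. Qed.

Lemma multiplicativeV (f : {multiplicative G -> H}) : {morph f : x / x^-1%g}.
Proof.
by move=> x; apply: (@mulIg _ (f x)); rewrite -gmulfM !mulVg multiplicative1.
Qed.

Lemma multiplicative_surface_word (f : {multiplicative G -> H}) g n
    (a b : 'I_g -> G) (c : 'I_n -> G) :
  f (\prod_(i < g) (a i * b i * (a i)^-1 * (b i)^-1) * \prod_(j < n) c j)%g
  = (\prod_(i < g) (f (a i) * f (b i) * (f (a i))^-1 * (f (b i))^-1) *
      \prod_(j < n) f (c j))%g.
Proof.
have fM := @gmulfM _ _ f; have f1 := multiplicative1 f.
rewrite fM (big_morph f fM f1) (big_morph f fM f1).
by congr (_ * _)%g; apply: eq_bigr => i _; rewrite !fM !multiplicativeV.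
Qed.

Lemma surface_relation_inj (f : {multiplicative G -> H}) g n
    (a b : 'I_g -> G) (c : 'I_n -> G) : injective f ->
  surface_relation (f \o a) (f \o b) (f \o c) -> surface_relation a b c.
Proof.
move=> fI rel; apply: fI; rewrite multiplicative_surface_word.
by rewrite multiplicative1.
Qed.

End Morphisms.

Section Presentation.
Context {R : realType} {g n : nat} {X : punctured_surface R n}.
Variables (a b : 'I_g -> Lambda X) (c : 'I_n -> Lambda X).

Definition generators : set (Lambda X) := range a `|` range b `|` range c.

(* The universal property yields a morphism onto the subgroup generated by the *)
(* generators, and its composite with the inclusion must be the identity. *)
Lemma presentation_generated : is_presentation a b c ->
  forall x, generated generators x.
Proof.
move=> [rel ex un] x.
pose H : groupType := generated_group generators.
have P y : generators y -> y \in generated_pred generators.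
  by move=> gy; exact/asboolP/generated_in.
have Pa i : a i \in generated_pred generators by apply: P; left; left; exists i.
have Pb i : b i \in generated_pred generators by apply: P; left; right; exists i.
have Pc i : c i \in generated_pred generators by apply: P; right; exists i.
pose a' i : H := GeneratedGroup (Pa i).
pose b' i : H := GeneratedGroup (Pb i).
pose c' i : H := GeneratedGroup (Pc i).
pose v : {multiplicative H -> Lambda X} := (\val : H -> Lambda X).
have rel' : surface_relation a' b' c'.
  by apply: (surface_relation_inj (f := v)) => //; exact: val_inj.
have [f [fa fb fc]] := ex H a' b' c' rel'.
have := un _ (v \o f : {multiplicative _ -> _}) idfun.
move=> /(_ (fun i => congr1 v (fa i)) (fun i => congr1 v (fb i)) (fun i => congr1 v (fc i))).
move=> /(_ x) /= <-.
by rewrite /v; case: (f x) => y /= /asboolP.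
Qed.

End Presentation.

(** The interface between topology and algebra: orbits are studied from these properties alone.
    Half-twists are excluded by the condition on [move_puncture], since they exchange two
    punctures. *)
Record surface_action (L : groupType) (g n : nat) (a b : 'I_g -> L)
    (c : 'I_n -> L) (Phi : set (L -> L)) : Prop := SurfaceAction {
  action_rel : surface_relation a b c;
  action_gen : forall x, generated (range a `|` range b `|` range c) x;
  action_id : Phi id;
  action_comp : forall f h, Phi f -> Phi h -> Phi (f \o h);
  action_inv : forall f, Phi f -> exists2 h, Phi h & cancel h f;
  action_morph : forall f, Phi f -> {morph f : x y / (x * y)%g};
  action_move : forall s : move g n, move_puncture s =1 id ->
    exists2 f, Phi f & [/\ f \o a =1 move_alpha a b c s,
      f \o b =1 move_beta a b c s & f \o c =1 move_gamma b c s];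
  action_conj : forall f i, Phi f ->
    exists u, f (c i) = (u * c i * u^-1)%g }.

Section PureAction.
Context {R : realType} {n : nat} {X : punctured_surface R n}.

Definition pure_push : set (Lambda X -> Lambda X) :=
  [set f | exists2 h : pointed_homeo X,
     forall i, h (puncture X i) = puncture X i & f = push h].

Lemma pure_mulV (h : pointed_homeo X) :
  (forall i, h (puncture X i) = puncture X i) ->
  forall i, (h^-1)%g (puncture X i) = puncture X i.
Proof.
by move=> hp i; rewrite -[in LHS](hp i) /= homeo_VE homeoK.
Qed.

(** An isotopy is constant on the punctures, so every representative of a pure class is itself pure.
    The inverse in [act] disappears because pure homeomorphisms are closed under inversion. *)
Lemma pure_orbitE (G : groupType) (rho : Lambda X -> G) :
  pure_orbit rho = (fun f => conj_class (rho \o f)) @` pure_push.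
Proof.
apply/seteqP; split=> [C [m [h [[h0 h0p <-] [H [cH Hm H01 Hp]] ->]]]|C].
  exists (push (h^-1)%g) => //; exists (h^-1)%g => //; apply: pure_mulV => i.
  by have [_ <-] := H01 (puncture X i); rewrite Hp h0p.
move=> [f [h hp ->] <-]; exists (mapping_class (h^-1)%g), (h^-1)%g; split.
- by exists (h^-1)%g => //; exact: pure_mulV.
- exact: isotopic_refl.
- by rewrite /act invgK.
Qed.

Context {g : nat} (a b : 'I_g -> Lambda X) (c : 'I_n -> Lambda X).

(** Each elementary move conjugates the peripheral loops up to the permutation that it induces on
    the punctures, and this property survives products and inverses. *)
Lemma push_peripheral (T : move g n -> pointed_homeo X)
    (k : pointed_homeo X) : (forall s, realizes a b c s (T s)) ->
  generated (range T) k -> forall i, exists j u,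
    k (puncture X i) = puncture X j /\ push k (c i) = (u * c j * u^-1)%g.
Proof.
move=> realT; elim=> {k} [_ [s _ <-]||h k _ hP _ kP|h _ hP] i.
- have [_ _ pc pp] := realT s; rewrite pp [push _ _]pc {pc pp}.
  case: s => [k|k|k l kl|m k mg kn|k l kl] /=.
  + by exists i, 1%g; rewrite mul1g invg1 mulg1.
  + by exists i, 1%g; rewrite mul1g invg1 mulg1.
  + by exists i, 1%g; rewrite mul1g invg1 mulg1.
  + case: ifP => _; last by exists i, 1%g; rewrite mul1g invg1 mulg1.
    by exists i, (xi b c m k)^-1%g; rewrite invgK.
  + have lk : (k == l) = false.
      by apply/negP => /eqP E; move: kl; rewrite E => /n_Sn.
    case: eqP => [->|/eqP ik].
      by exists l, (c k); rewrite tpermL.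
    case: eqP => [->|/eqP il].
      by exists k, 1%g; rewrite tpermR mul1g invg1 mulg1.
    exists i, 1%g; rewrite mul1g invg1 mulg1 tpermD //.
    - by rewrite eq_sym.
    - by rewrite eq_sym.
- by exists i, 1%g; rewrite push_one mul1g invg1 mulg1.
- have [j [u [kE pE]]] := kP i; have [m [v [hE qE]]] := hP j.
  exists m, (push h u * v)%g; split.
    by rewrite /= homeo_mulE /= kE hE.
  pose p : {multiplicative Lambda X -> Lambda X} :=
    HB.pack (push h) (isMultiplicative.Build _ _ (push h) (push_morph h)).
  rewrite push_mul pE -[push h]/(p : _ -> _) !gmulfM multiplicativeV.
  by rewrite [p (c j)]qE invgM !mulgA.
- have [j hj] : exists j, h (puncture X j) = puncture X i.
    have : range (puncture X) (puncture X i) by exists i.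
    rewrite -{1}(homeo_punctures h) => -[_ [j _ <-] hj].
    by exists j.
  have [m [u [hE pE]]] := hP j.
  have mi : m = i by apply: (@puncture_inj _ _ X); rewrite -hE hj.
  pose p : {multiplicative Lambda X -> Lambda X} :=
    HB.pack (push (h^-1)%g)
      (isMultiplicative.Build _ _ (push (h^-1)%g) (push_morph (h^-1)%g)).
  exists j, (p u)^-1%g; split.
    by rewrite -hj /= homeo_VE homeoK.
  have : p (push h (c j)) = c j by rewrite /p /= -push_mul mulVg push_one.
  rewrite pE mi !gmulfM multiplicativeV => <-.
  by rewrite invgK !mulgA mulVg mul1g mulgVK.
Qed.

(** For the peripheral condition, a pure [h] is isotopic to an element generated by the [T s]. This
    changes [push h] by an inner automorphism only ([isotopic_push]), and the index [j] given by
    [push_peripheral] is [i] because isotopic maps agree on the punctures. *)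
Lemma standard_surface_action :
  is_standard a b c -> surface_action a b c pure_push.
Proof.
move=> [pres _ [T [realT surjT]]].
have [rel _ _] := pres.
split.
- exact: rel.
- exact: presentation_generated.
- by exists 1%g => //; apply/funext => x; rewrite push_one.
- move=> _ _ [h hp ->] [k kp ->]; exists (h * k)%g.
    by move=> i; rewrite /= homeo_mulE /= kp hp.
  by apply/funext => x; rewrite push_mul.
- move=> _ [h hp ->]; exists (push (h^-1)%g).
    by exists (h^-1)%g => //; exact: pure_mulV.
  by move=> x; rewrite -push_mul mulgV push_one.
- by move=> _ [h _ ->]; exact: push_morph.
- move=> s sid; have [pa pb pc pp] := realT s; exists (push (T s)) => //.
  by exists (T s) => // i; rewrite pp sid.
- move=> _ i [h hp ->]; have [k Tk hk] := surjT h.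
  have [v vE] := isotopic_push hk.
  have [j [u [kE pE]]] := push_peripheral realT Tk i.
  have ji : j = i.
    apply: (@puncture_inj _ _ X); rewrite -kE -[in RHS]hp.
    by have [H [_ _ H01 Hp]] := hk; have [_ <-] := H01 (puncture X i); rewrite Hp.
  exists (v * u)%g; rewrite ji in pE.
  apply: (@mulIg _ v); rewrite vE pE.
  by rewrite invgM !mulgA mulgVK.
Qed.

End PureAction.

(** * Powers and products of the elementary twists *)

Section Moves.
Context {L : groupType} {g n : nat} {a b : 'I_g -> L} {c : 'I_n -> L}.
Context {Phi : set (L -> L)} (act : surface_action a b c Phi).
Local Open Scope group_scope.

Lemma action_ind (P : L -> Prop) :
  (forall i, P (a i)) -> (forall i, P (b i)) -> (forall i, P (c i)) ->
  P 1 -> (forall x y, P x -> P y -> P (x * y)) ->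
  (forall x, P x -> P x^-1) -> forall x, P x.
Proof.
move=> Pa Pb Pc P1 PM PV x; elim: (action_gen act x) => //.
- by move=> _ [[]|] [i _ <-].
- by move=> y z _ Py _ Pz; exact: PM.
- by move=> y _ Py; exact: PV.
Qed.

Lemma action_invP f : Phi f -> exists h, [/\ Phi h, cancel h f & cancel f h].
Proof.
move=> Pf; have [h Ph fK] := action_inv act Pf.
have [f' Pf' hK] := action_inv act Ph.
exists h; split=> // x; rewrite -[in LHS](hK x) fK.
exact: hK.
Qed.

Lemma phi1 f : Phi f -> f 1 = 1.
Proof.
move=> /(action_morph act) fM.
by apply: (@mulIg _ (f 1)); rewrite -fM !mul1g.
Qed.

Lemma phiV f x : Phi f -> f x^-1 = (f x)^-1.
Proof.
move=> Pf; apply: (@mulIg _ (f x)).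
by rewrite -(action_morph act Pf) !mulVg phi1.
Qed.

Definition acts_as (f : L -> L) a' b' c' :=
  [/\ Phi f, f \o a =1 a', f \o b =1 b' & f \o c =1 c'].

(** Since [f] fixes [x], every iteration contributes exactly one more factor [x]. The same statement
    serves for a twist ([x] is [b k]) and for its inverse ([x] is the inverse of [b k]). *)
Lemma iter_alpha k x (f : L -> L) j : Phi f ->
  f \o a =1 [eta a with k |-> a k * x] -> f \o b =1 b -> f \o c =1 c ->
  f x = x ->
  exists h, acts_as h [eta a with k |-> a k * x ^+ j] b c /\ h x = x.
Proof.
move=> Pf fa fb fc fx; elim: j => [|j [h [[Ph ha hb hc] hx]]].
  exists id; split=> //; split=> // [|i /=]; first exact: action_id act.
  by case: eqP => // ->; rewrite mulg1.
exists (h \o f); split; last by rewrite /= fx.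
split=> [|i|i|i] /=.
- exact: (action_comp act).
- rewrite [f (a i)]fa /=; case: eqP => [|/eqP] ik; last first.
    by rewrite [LHS]ha /= (negbTE ik).
  rewrite (action_morph act Ph) [h (a k)]ha /= eqxx hx.
  by rewrite expgSr mulgA.
- by rewrite [f (b i)]fb [LHS]hb.
- by rewrite [f (c i)]fc [LHS]hc.
Qed.

Lemma iter_beta k x (f : L -> L) j : Phi f ->
  f \o b =1 [eta b with k |-> b k * x] -> f \o a =1 a -> f \o c =1 c ->
  f x = x ->
  exists h, acts_as h a [eta b with k |-> b k * x ^+ j] c /\ h x = x.
Proof.
move=> Pf fb fa fc fx; elim: j => [|j [h [[Ph ha hb hc] hx]]].
  exists id; split=> //; split=> // [|i /=]; first exact: action_id act.
  by case: eqP => // ->; rewrite mulg1.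
exists (h \o f); split; last by rewrite /= fx.
split=> [|i|i|i] /=.
- exact: (action_comp act).
- by rewrite [f (a i)]fa [LHS]ha.
- rewrite [f (b i)]fb /=; case: eqP => [|/eqP] ik; last first.
    by rewrite [LHS]hb /= (negbTE ik).
  rewrite (action_morph act Ph) [h (b k)]hb /= eqxx hx.
  by rewrite expgSr mulgA.
- by rewrite [f (c i)]fc [LHS]hc.
Qed.

Lemma alpha_moveX k j :
  exists f, acts_as f [eta a with k |-> a k * b k ^+ j] b c.
Proof.
have [//|f Pf [fa fb fc]] := action_move act (s := tau_alpha n k).
have [h [H _]] := iter_alpha j Pf fa fb fc (fb k).
by exists h.
Qed.

Lemma beta_moveX k j :
  exists f, acts_as f a [eta b with k |-> b k * a k ^+ j] c.
Proof.
have [//|f Pf [fa fb fc]] := action_move act (s := tau_beta n k).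
have [h [H _]] := iter_beta j Pf fb fa fc (fa k).
by exists h.
Qed.

Lemma alpha_moveV k j :
  exists f, acts_as f [eta a with k |-> a k * b k ^- j] b c.
Proof.
have [//|f Pf [fa fb fc]] := action_move act (s := tau_alpha n k).
have [h [Ph hf fh]] := action_invP Pf.
have hb : h \o b =1 b by move=> i /=; rewrite -[b i in LHS]fb /= fh.
have hc : h \o c =1 c by move=> i /=; rewrite -[c i in LHS]fc /= fh.
have ha : h \o a =1 [eta a with k |-> a k * (b k)^-1].
  move=> i /=; case: eqP => [->|/eqP ik].
    apply: (can_inj fh); rewrite hf (action_morph act Pf) (phiV _ Pf).
    by rewrite [f (a k)]fa [f (b k)]fb /= eqxx mulgK.
  have E : f (a i) = a i by rewrite [LHS]fa /= (negbTE ik).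
  by rewrite -[in LHS]E fh.
have hbk : h (b k)^-1 = (b k)^-1 by rewrite (phiV _ Ph) [h (b k)]hb.
have [h' [H _]] := iter_alpha j Ph ha hb hc hbk.
by exists h'; rewrite -expVgn.
Qed.

Lemma beta_moveV k j :
  exists f, acts_as f a [eta b with k |-> b k * a k ^- j] c.
Proof.
have [//|f Pf [fa fb fc]] := action_move act (s := tau_beta n k).
have [h [Ph hf fh]] := action_invP Pf.
have ha : h \o a =1 a by move=> i /=; rewrite -[a i in LHS]fa /= fh.
have hc : h \o c =1 c by move=> i /=; rewrite -[c i in LHS]fc /= fh.
have hb : h \o b =1 [eta b with k |-> b k * (a k)^-1].
  move=> i /=; case: eqP => [->|/eqP ik].
    apply: (can_inj fh); rewrite hf (action_morph act Pf) (phiV _ Pf).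
    by rewrite [f (a k)]fa [f (b k)]fb /= eqxx mulgK.
  have E : f (b i) = b i by rewrite [LHS]fb /= (negbTE ik).
  by rewrite -[in LHS]E fh.
have hak : h (a k)^-1 = (a k)^-1 by rewrite (phiV _ Ph) [h (a k)]ha.
have [h' [H _]] := iter_beta j Ph hb ha hc hak.
by exists h'; rewrite -expVgn.
Qed.

(** The inverse beta twist substituted into the alpha twist. Up to one more twist this is a quarter
    turn of the handle, which lets statements about [a k] be transferred to [b k]. *)
Lemma swap_move k : exists f,
  acts_as f [eta a with k |-> a k * b k] [eta b with k |-> (a k)^-1] c.
Proof.
have [f [Pf fa fb fc]] := alpha_moveX k 1.
have [h [Ph ha hb hc]] := beta_moveV k 1.
exists (f \o h); split=> [|i|i|i] /=.
- exact: (action_comp act).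
- by rewrite [h _]ha [LHS]fa /= expg1.
- rewrite [h _]hb /=; case: eqP => ik; last by rewrite [LHS]fb.
  rewrite (action_morph act Pf) expg1 (phiV _ Pf) [f (a k)]fa [f (b k)]fb.
  by rewrite /= eqxx expg1 invgM mulgA mulgV mul1g.
- by rewrite [h _]hc [LHS]fc.
Qed.

Lemma theta_move (k l : 'I_g) : l = k.+1 :> nat -> exists f, acts_as f
  [eta a with k |-> a k * theta a b k l, l |-> (theta a b k l)^-1 * a l]
  [eta b with k |-> (theta a b k l)^-1 * b k * theta a b k l] c.
Proof.
move=> lk; have [//|f Pf [fa fb fc]] := action_move act (s := tau_theta n lk).
by exists f.
Qed.

Lemma xi_move (m : 'I_g) (k : 'I_n) : m.+1 = g -> (k.+1 < n)%N ->
  exists f, acts_as f [eta a with m |-> a m * xi b c m k]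
    [eta b with m |-> (xi b c m k)^-1 * b m * xi b c m k]
    (fun i => if (i <= k)%N then (xi b c m k)^-1 * c i * xi b c m k else c i).
Proof.
move=> mg kn; have [//|f Pf [fa fb fc]] := action_move act (s := tau_xi mg kn).
by exists f.
Qed.

End Moves.

(** * Orbits of characters *)

Section Characters.
Context {L : groupType} {K : fieldType}.

Definition is_char (f : L -> K) :=
  f 1%g = 1 /\ {morph f : x y / (x * y)%g >-> x * y}.

Context {f : L -> K} (fch : is_char f).

Lemma char1 : f 1%g = 1. Proof. exact: fch.1. Qed.

Lemma charM x y : f (x * y)%g = f x * f y. Proof. exact: fch.2. Qed.

Lemma char_neq0 x : f x != 0.
Proof.
apply/eqP => fx; have /eqP := char1.
by rewrite -(mulgV x) charM fx mul0r eq_sym oner_eq0.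
Qed.

Lemma charV x : f x^-1%g = (f x)^-1.
Proof.
by apply: (mulIf (char_neq0 x)); rewrite -charM mulVg char1 mulVf ?char_neq0.
Qed.

Lemma charX x j : f (x ^+ j)%g = f x ^+ j.
Proof.
by elim: j => [|j IH]; rewrite ?char1 // expgS charM IH exprS.
Qed.

Lemma char_comp (h : L -> L) : h 1%g = 1%g -> {morph h : x y / (x * y)%g} ->
  is_char (f \o h).
Proof. by move=> h1 hM; split=> [|x y] /=; rewrite ?h1 ?char1 // hM charM. Qed.

Lemma char_conj x u : f (u * x * u^-1)%g = f x.
Proof. by rewrite !charM charV mulrAC mulfV ?char_neq0 // mul1r. Qed.

Lemma char_prod (I : Type) (r : seq I) (P : pred I) (F : I -> L) :
  f (\prod_(i <- r | P i) F i)%g = \prod_(i <- r | P i) f (F i).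
Proof. exact: (big_morph f charM char1). Qed.

End Characters.

Section Powers.
Context {K : fieldType}.

Implicit Types x y e : K.

Definition pow_of (e x : K) := exists j, x = e ^+ j.

Lemma pow_of1 e : pow_of e 1. Proof. by exists 0. Qed.

Lemma pow_of_refl e : pow_of e e. Proof. by exists 1. Qed.

Lemma pow_ofM e x y : pow_of e x -> pow_of e y -> pow_of e (x * y).
Proof. by move=> [i ->] [j ->]; exists (i + j)%N; rewrite exprD. Qed.

Lemma pow_of_trans x e d : pow_of d e -> pow_of e x -> pow_of d x.
Proof. by move=> [i ->] [j ->]; exists (i * j)%N; rewrite exprM. Qed.

Context {N : nat} {z : K} (pz : N.-primitive_root z).

Lemma prim_gt0 : (0 < N)%N. Proof. exact: prim_order_gt0 pz. Qed.

Lemma unity_pow x : x ^+ N = 1 -> pow_of z x.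
Proof. by move=> /(prim_rootP pz) [i ->]; exists i. Qed.

Lemma unityV x : x ^+ N = 1 -> x^-1 ^+ N = 1.
Proof. by move=> xN; rewrite exprVn xN invr1. Qed.

Lemma unityM x y : x ^+ N = 1 -> y ^+ N = 1 -> (x * y) ^+ N = 1.
Proof. by move=> xN yN; rewrite exprMn xN yN mulr1. Qed.

Lemma unityX x j : x ^+ N = 1 -> (x ^+ j) ^+ N = 1.
Proof. by move=> xN; rewrite exprAC xN expr1n. Qed.

Lemma unity_neq0 x : x ^+ N = 1 -> x != 0.
Proof.
move=> xN; apply/eqP => x0; move/eqP: xN.
by rewrite x0 expr0n gtn_eqF ?prim_gt0 // eq_sym oner_eq0.
Qed.

Lemma pow_ofV e x : e ^+ N = 1 -> pow_of e x -> pow_of e x^-1.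
Proof.
move=> eN [j ->]; exists (j * N.-1)%N.
have xN : (e ^+ j) ^+ N = 1 by exact: unityX.
apply: (mulIf (unity_neq0 xN)); rewrite mulVf ?unity_neq0 //.
by rewrite exprM -exprSr prednK ?prim_gt0.
Qed.

Lemma pow_of_prim x : x ^+ N = 1 -> pow_of x z -> N.-primitive_root x.
Proof.
move=> xN [j zE]; have [d dx dN] := prim_order_exists prim_gt0 xN.
suff -> : N = d by [].
apply/eqP; rewrite eqn_dvd dN andbT (prim_order_dvd pz).
by rewrite zE exprAC (prim_expr_order dx) expr1n.
Qed.

Lemma prim_pow_of x y : N.-primitive_root x -> y ^+ N = 1 ->
  exists j, y = x ^+ j.
Proof. by move=> px /(prim_rootP px) [i ->]; exists i. Qed.

Lemma prim_inv x : N.-primitive_root x -> N.-primitive_root x^-1.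
Proof.
move=> px; have xN := prim_expr_order px.
apply: pow_of_prim; first exact: unityV.
have [j ->] := prim_pow_of px (prim_expr_order pz).
apply: (@pow_of_trans _ x); last by exists j.
by rewrite -{2}[x]invrK; apply: pow_ofV; [exact: unityV|exact: pow_of_refl].
Qed.

End Powers.

Section CharacterOrbits.
Context {L : groupType} {g n : nat} {a b : 'I_g -> L} {c : 'I_n -> L}.
Context {Phi : set (L -> L)} (act : surface_action a b c Phi).
Context {K : fieldType}.
Implicit Types (f : L -> K) (k l : 'I_g).

Lemma char_phi f h : is_char f -> Phi h -> is_char (f \o h).
Proof.
move=> fch Ph; apply: (char_comp fch); first exact: (phi1 act Ph).
exact: (action_morph act).
Qed.

Lemma char_phi_c f h i : is_char f -> Phi h -> f (h (c i)) = f (c i).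
Proof. by move=> fch /(action_conj act i) [u ->]; exact: char_conj. Qed.

Lemma char_eq f f' : is_char f -> is_char f' ->
  f \o a =1 f' \o a -> f \o b =1 f' \o b -> f \o c =1 f' \o c -> f =1 f'.
Proof.
move=> fch fch' ea eb ec; apply: (action_ind act) => //.
- by rewrite !char1.
- by move=> x y ex ey; rewrite !charM // ex ey.
- by move=> x ex; rewrite !charV // ex.
Qed.

(** Only values of the character are recorded: [h] may move the other handles as long as [f] does
    not notice. *)
Definition reach k f (x y : K) := exists2 h, Phi h &
  [/\ f (h (a k)) = x, f (h (b k)) = y &
      forall i, i != k -> f (h (a i)) = f (a i) /\ f (h (b i)) = f (b i)].

Lemma reach_refl k f : reach k f (f (a k)) (f (b k)).
Proof. by exists id => //; exact: action_id act. Qed.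

Section OneHandle.
Variables (k : 'I_g) (f : L -> K).
Hypothesis fch : is_char f.

Lemma reach_move h h' x y : Phi h ->
  [/\ f (h (a k)) = x, f (h (b k)) = y &
      forall i, i != k -> f (h (a i)) = f (a i) /\ f (h (b i)) = f (b i)] ->
  Phi h' -> (forall i, i != k -> h' (a i) = a i /\ h' (b i) = b i) ->
  reach k f (f (h (h' (a k)))) (f (h (h' (b k)))).
Proof.
move=> Ph [_ _ hi] Ph' hi'; exists (h \o h').
  exact: (action_comp act).
split=> // i ik; have [E1 E2] := hi' i ik; rewrite /= E1 E2.
exact: hi.
Qed.

Lemma reach_alphaX j x y : reach k f x y -> reach k f (x * y ^+ j) y.
Proof.
move=> [h Ph hE]; have [h' [Ph' ha hb _]] := alpha_moveX act k j.
have fhch := char_phi fch Ph; have [hx hy _] := hE.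
have := reach_move Ph hE Ph'; rewrite [h' (b k)]hb [h' (a k)]ha /= eqxx.
rewrite -[f (h (_ * _)%g)]/((f \o h) _) (charM fhch) (charX fhch) /= hx hy.
by apply => i ik; split; [rewrite [LHS]ha /= (negbTE ik)|exact: hb].
Qed.

Lemma reach_alphaV j x y : reach k f x y -> reach k f (x / y ^+ j) y.
Proof.
move=> [h Ph hE]; have [h' [Ph' ha hb _]] := alpha_moveV act k j.
have fhch := char_phi fch Ph; have [hx hy _] := hE.
have := reach_move Ph hE Ph'; rewrite [h' (b k)]hb [h' (a k)]ha /= eqxx.
rewrite -[f (h (_ * _)%g)]/((f \o h) _) (charM fhch) (charV fhch).
rewrite (charX fhch) /= hx hy.
by apply => i ik; split; [rewrite [LHS]ha /= (negbTE ik)|exact: hb].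
Qed.

(** [swap_move] gives (x y, x^-1), and one more alpha twist removes the factor x. *)
Lemma reach_swap x y : reach k f x y -> reach k f y x^-1.
Proof.
move=> [h Ph hE]; have [h' [Ph' ha hb _]] := swap_move act k.
have fhch := char_phi fch Ph; have [hx hy _] := hE.
have xyN0 : x != 0 by rewrite -hx; exact: (char_neq0 fch).
have := reach_move Ph hE Ph'; rewrite [h' (b k)]hb [h' (a k)]ha /= eqxx.
rewrite -![f (h _)]/((f \o h) _) (charM fhch) (charV fhch) /= hx hy => H.
have /(reach_alphaX 1) : reach k f (x * y) x^-1.
  by apply: H => i ik; rewrite [h' _]ha [h' _]hb /= (negbTE ik).
by rewrite expr1 mulrAC mulfV // mul1r.
Qed.

Lemma reach_betaX j x y : reach k f x y -> reach k f x (y * x ^+ j).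
Proof.
move=> /reach_swap /(reach_alphaV j); rewrite exprVn invrK.
by do 3 move=> /reach_swap; rewrite !invrK.
Qed.

Lemma reach_betaV j x y : reach k f x y -> reach k f x (y / x ^+ j).
Proof.
move=> /reach_swap /(reach_alphaX j); rewrite exprVn.
by do 3 move=> /reach_swap; rewrite !invrK.
Qed.

Context {N : nat} {z : K} (pz : N.-primitive_root z).

(** The twists subtract one exponent from the other, so this is Euclid's algorithm, by induction on
    the sum of the exponents. The surviving value [e] generates the two initial ones. *)
Lemma reach_euclid i j : reach k f (z ^+ i) (z ^+ j) ->
  exists e, [/\ reach k f 1 e, e ^+ N = 1, pow_of e (z ^+ i) &
                pow_of e (z ^+ j)].
Proof.
have [m] := ubnP (i + j); elim: m i j => // m IH i j ijm.
have zj q : (z ^+ q) ^+ N = 1 by exact/unityX/prim_expr_order.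
have z0 q : z ^+ q != 0 by apply: (unity_neq0 pz).
case: (posnP i) => [-> R|i0].
  exists (z ^+ j); split=> //; first exact: pow_of1.
  exact: pow_of_refl.
case: (posnP j) => [-> R|j0].
  exists (z ^+ i)^-1; split.
  - exact: (reach_swap R).
  - exact: (unityV (zj i)).
  - rewrite -{2}[z ^+ i]invrK; apply: (pow_ofV pz); last exact: pow_of_refl.
    exact: (unityV (zj i)).
  - exact: pow_of1.
case: (leqP i j) => [ij|/ltnW ij].
  move=> /(reach_betaV 1); rewrite expr1 -{1}(subnK ij) exprD mulfK //.
  move=> /IH [|e [R eN ei eji]]; first by rewrite subnKC //; lia.
  exists e; split=> //; rewrite -(subnKC ij) exprD; exact: pow_ofM.
move=> /(reach_alphaV 1); rewrite expr1 -{1}(subnK ij) exprD mulfK //.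
move=> /IH [|e [R eN ei eji]]; first by rewrite subnK //; lia.
exists e; split=> //; rewrite -(subnK ij) exprD; exact: pow_ofM.
Qed.

(** A primitive value at one loop of the handle lets a twist set the value at the other loop freely.
    It suffices to pass through a pair whose first entry is primitive. *)
Lemma reach_any x y x' y' : x' ^+ N = 1 -> y' ^+ N = 1 ->
  N.-primitive_root x \/ N.-primitive_root y ->
  x ^+ N = 1 -> y ^+ N = 1 ->
  N.-primitive_root x' \/ N.-primitive_root y' ->
  reach k f x y -> reach k f x' y'.
Proof.
move=> x'N y'N; wlog py : x y / N.-primitive_root y.
  move=> H [px|py] xN yN p' R; last by apply: (H x y) => //; right.
  apply: (H y x^-1) => //.
  - exact: (prim_inv pz).
  - by right; apply: (prim_inv pz).
  - exact: unityV.
  - exact: reach_swap.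
move=> _ xN yN p' R.
have Rx t : t ^+ N = 1 -> reach k f t y.
  move=> tN; have [j jE] := prim_pow_of py (unityM tN (unityV xN)).
  by have := reach_alphaX j R; rewrite -jE mulrCA mulfV ?mulr1 ?(unity_neq0 pz).
have Ry s t : N.-primitive_root s -> t ^+ N = 1 -> reach k f s t.
  move=> ps tN; have [j jE] := prim_pow_of ps (unityM tN (unityV yN)).
  have := reach_betaX j (Rx s (prim_expr_order ps)).
  by rewrite -jE mulrCA mulfV ?mulr1 ?(unity_neq0 pz).
case: p' => [p'|p']; first exact: Ry.
have [j jE] := prim_pow_of p' (unityM x'N (unityV y'N)).
have := reach_alphaX j (Ry y' y' p' y'N).
by rewrite -jE mulrCA mulfV ?mulr1 ?(unity_neq0 pz).
Qed.

End OneHandle.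

End CharacterOrbits.

(** * Gathering the image of a character in the last handle *)

Section Transitivity.
Context {L : groupType} {g n : nat} {a b : 'I_g -> L} {c : 'I_n -> L}.
Context {Phi : set (L -> L)} (act : surface_action a b c Phi).
Context {K : fieldType}.
Implicit Types (f : L -> K) (k l : 'I_g).

Definition peripheral (k : 'I_n) : L := (\prod_(i < n | (i <= k)%N) c i)%g.

(** In an abelian target [theta a b k l] becomes b_k / b_l and the conjugations disappear, so only
    the two alpha values change. *)
Lemma char_theta k l f : is_char f -> l = k.+1 :> nat ->
  exists2 h, Phi h & [/\ f (h (a k)) = f (a k) * (f (b k) / f (b l)),
    f (h (a l)) = f (a l) * (f (b l) / f (b k)),
    (forall i, i != k -> i != l -> f (h (a i)) = f (a i)) &
    forall i, f (h (b i)) = f (b i)].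
Proof.
move=> fch lk; have [h [Ph ha hb hc]] := theta_move act lk.
have th : f (theta a b k l) = f (b k) / f (b l).
  by rewrite !(charM fch) !(charV fch); field; rewrite !(char_neq0 fch).
have kl : (l == k) = false by apply/eqP => E; move: lk; rewrite E => /n_Sn.
exists h => //; split=> [||i ik il|i].
- by rewrite [h _]ha /= eqxx (charM fch) th.
- by rewrite [h _]ha /= kl eqxx (charM fch) (charV fch) th invf_div mulrC.
- by rewrite [h _]ha /= (negbTE ik) (negbTE il).
- rewrite [h _]hb /=; case: eqP => // ->.
  by rewrite 2!(charM fch) (charV fch) mulrAC mulVf ?mul1r ?(char_neq0 fch).
Qed.

Lemma char_xi (m : 'I_g) (k : 'I_n) f : is_char f ->
  m.+1 = g -> (k.+1 < n)%N ->
  exists2 h, Phi h & [/\ f (h (a m)) = f (a m) * (f (b m) / f (peripheral k)),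
    (forall i, i != m -> f (h (a i)) = f (a i)) &
    forall i, f (h (b i)) = f (b i)].
Proof.
move=> fch mg kn; have [h [Ph ha hb hc]] := xi_move act mg kn.
exists h => //; split=> [|i im|i].
- by rewrite [h _]ha /= eqxx !(charM fch) (charV fch) [(f (_ : L))^-1 * _]mulrC.
- by rewrite [h _]ha /= (negbTE im).
- rewrite [h _]hb /=; case: eqP => // ->.
  by rewrite 2!(charM fch) (charV fch) mulrAC mulVf ?mul1r ?(char_neq0 fch).
Qed.

Lemma peripheral_last (k : 'I_n) : k.+1 = n ->
  peripheral k = (\prod_(i < g) (a i * b i * (a i)^-1 * (b i)^-1))^-1%g.
Proof.
move=> kn.
apply: (@mulgI _ (\prod_(i < g) (a i * b i * (a i)^-1 * (b i)^-1))%g).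
rewrite mulgV -[RHS](action_rel act) /peripheral; congr (_ * _)%g.
by apply: eq_bigl => i; rewrite -ltnS kn ltn_ord.
Qed.

Lemma char_peripheral_last (k : 'I_n) f : is_char f -> k.+1 = n ->
  f (peripheral k) = 1.
Proof.
move=> fch kn; rewrite peripheral_last // (charV fch) (char_prod fch) big1 ?invr1 //.
move=> i _; rewrite !(charM fch) !(charV fch).
by field; rewrite !(char_neq0 fch).
Qed.

Lemma peripheralS (k l : 'I_n) : l = k.+1 :> nat ->
  peripheral l = (peripheral k * c l)%g.
Proof.
move=> lk; pose c' i := odflt 1%g (omap c (insub i)).
have E (j : 'I_n) : peripheral j = (\prod_(0 <= i < j.+1) c' i)%g.
  rewrite /peripheral (big_nat_widen _ _ _ _ _ (ltn_ord j)) big_mkord.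
  by apply: eq_bigr => i _; rewrite /c' valK.
by rewrite !E lk big_nat_recr //= -lk /c' valK.
Qed.

Lemma char_phi_peripheral f h (k : 'I_n) : is_char f -> Phi h ->
  f (h (peripheral k)) = f (peripheral k).
Proof.
move=> fch Ph; rewrite -[LHS]/((f \o h) _) (char_prod (char_phi act fch Ph)).
rewrite (char_prod fch); by apply: eq_bigr => i _; rewrite /= (char_phi_c act _ fch Ph).
Qed.

Section Gather.
Context {N : nat} {z : K} (pz : N.-primitive_root z).

Lemma char_handle f h k : is_char f -> Phi h ->
  (forall x, f x ^+ N = 1) -> exists h' e,
  [/\ Phi h', f (h' (a k)) = 1, f (h' (b k)) = e, e ^+ N = 1 &
    [/\ pow_of e (f (h (a k))), pow_of e (f (h (b k))) &
    forall i, i != k -> f (h' (a i)) = f (h (a i)) /\ f (h' (b i)) = f (h (b i))]].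
Proof.
move=> fch Ph fN; have fhch := char_phi act fch Ph.
have [i' iE] := unity_pow pz (fN (h (a k))).
have [j' jE] := unity_pow pz (fN (h (b k))).
have := reach_refl act k (f \o h); rewrite /= iE jE.
move=> /(reach_euclid act fhch pz) [e [[h' Ph' [h1 he hi]] eN ei ej]].
exists (h \o h'), e; split=> //; exact: (action_comp act).
Qed.

(** Induction on the handles: the generator [e] collected so far is carried into the next handle by
    [theta], and Euclid's algorithm there produces a generator of both contributions. *)
Lemma char_gather_handles f k : is_char f -> (forall x, f x ^+ N = 1) ->
  exists h e, [/\ Phi h, f (h (a k)) = 1, f (h (b k)) = e, e ^+ N = 1 &
    (forall i : 'I_g, (i <= k)%N -> pow_of e (f (a i)) /\ pow_of e (f (b i))) /\
    forall i : 'I_g, (k < i)%N -> f (h (a i)) = f (a i) /\ f (h (b i)) = f (b i)].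
Proof.
move=> fch fN; case: k => m; elim: m => [|m IH] mg.
  have [h [e [Ph h1 he eN [ea eb hi]]]] :=
    char_handle (Ordinal mg) fch (action_id act) fN.
  exists h, e; split=> //; split=> i /=.
    by rewrite leqn0 => /eqP i0; rewrite (_ : i = Ordinal mg) //; exact: val_inj.
  by move=> i0; apply: hi; apply/eqP => E; rewrite E in i0.
have mg' : (m < g)%N by exact: ltnW.
have [h [e [Ph h1 he eN [ei hi]]]] := IH mg'.
set k := Ordinal mg' in ei hi h1 he; set l := Ordinal mg.
have kl : k != l by apply/eqP => -[] /n_Sn.
have [h2 [e2 [Ph2 h21 h2e e2N [ea2 eb2 hi2]]]] := char_handle l fch Ph fN.
(* Handle [l] holds (1, e2) and becomes (e2 / e, e2); a generator of these two values also has [e]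
   among its powers. *)
have [h3 Ph3 [h3k h3l h3a h3b]] :=
  char_theta (l := l) (k := k) (char_phi act fch Ph2) erefl.
have Ph23 := action_comp act Ph2 Ph3.
have [h4 [e4 [Ph4 h41 h4e e4N [ea4 eb4 hi4]]]] := char_handle l fch Ph23 fN.
rewrite /= in h3k h3l ea4 eb4 h3b h3a.
have e2e4 : pow_of e4 e2 by move: eb4; rewrite h3b h2e.
have h2bk : f (h2 (b k)) = e by have [_ ->] := hi2 k kl.
have ee4 : pow_of e4 e.
  move: ea4; rewrite h3l h21 mul1r h2e h2bk => /(pow_ofV pz e4N).
  rewrite invf_div => /(pow_ofM e2e4).
  by rewrite mulrC mulfVK // (unity_neq0 pz).
have l_i (i : 'I_g) : (m.+1 < i)%N -> i != l.
  by move=> mi; apply/eqP => E; rewrite E ltnn in mi.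
exists h4, e4; split=> //; split=> i.
  rewrite leq_eqVlt => /orP [/eqP il|im].
    have -> : i = l by exact: val_inj.
    have [E1 E2] := hi l (ltnSn m).
    rewrite -E1 -E2; split; exact: pow_of_trans e2e4 _.
  have [] := ei i im.
  by split; apply: pow_of_trans ee4 _.
move=> mi; have il := l_i i mi; have ik : i != k.
  by apply/eqP => E; rewrite E /= ltnNge leqnSn in mi.
have [-> ->] := hi4 i il; rewrite /= h3a // h3b.
by have [-> ->] := hi2 i il; apply: hi; exact: ltnW.
Qed.

(** After the handles, the peripheral products are absorbed one at a time by [xi]. The final [e]
    generates the values at all generators, hence also [z], and is therefore primitive. *)
Lemma char_gather f (m : 'I_g) : is_char f -> (forall x, f x ^+ N = 1) ->
  m.+1 = g -> (exists x, f x = z) ->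
  exists h, [/\ Phi h, f (h (a m)) = 1 & N.-primitive_root (f (h (b m)))].
Proof.
move=> fch fN mg [x fx].
have step q : (q < n)%N -> exists h e, [/\ Phi h, f (h (a m)) = 1,
    f (h (b m)) = e, e ^+ N = 1 &
    (forall i, pow_of e (f (a i)) /\ pow_of e (f (b i))) /\
    forall i : 'I_n, (i < q)%N -> pow_of e (f (peripheral i))].
  elim: q => [_|q IH qn].
    have [h [e [Ph h1 he eN [ei _]]]] := char_gather_handles m fch fN.
    exists h, e; split=> //; split=> // i; apply: ei.
    by rewrite -ltnS mg.
  have [h [e [Ph h1 he eN [ei eP]]]] := IH (ltnW qn).
  pose k := Ordinal (ltnW qn).
  have [h2 Ph2 [h2a _ h2b]] := char_xi (k := k) (char_phi act fch Ph) mg qn.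
  have [h3 [e3 [Ph3 h31 h3e e3N [ea3 eb3 _]]]] :=
    char_handle m fch (action_comp act Ph Ph2) fN.
  rewrite /= in h2a h2b ea3 eb3.
  rewrite h2b he in eb3.
  exists h3, e3; split=> //; split.
    by move=> i; have [] := ei i; split; apply: pow_of_trans eb3 _.
  move=> i; rewrite ltnS leq_eqVlt => /orP [/eqP ik|iq]; last first.
    by apply: pow_of_trans eb3 _; exact: eP.
  have -> : i = k by exact: val_inj.
  move: ea3; rewrite h2a h1 he mul1r => /(pow_ofV pz e3N).
  rewrite invf_div => /(pow_ofM eb3); rewrite mulrC mulfVK ?(unity_neq0 pz) //.
  by rewrite /= (char_phi_peripheral _ fch Ph).
have [h [e [Ph h1 he eN [ei eP]]]] : exists h e, [/\ Phi h, f (h (a m)) = 1,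
    f (h (b m)) = e, e ^+ N = 1 &
    (forall i, pow_of e (f (a i)) /\ pow_of e (f (b i))) /\
    forall i : 'I_n, pow_of e (f (peripheral i))].
  case: (posnP n) => [n0|n0].
    have [h [e [Ph h1 he eN [ei _]]]] := char_gather_handles m fch fN.
    exists h, e; split=> //; split=> i; last by have := ltn_ord i; lia.
    by apply: ei; rewrite -ltnS mg.
  have [|h [e [Ph h1 he eN [ei eP]]]] := step n.-1; first by rewrite prednK.
  exists h, e; split=> //; split=> // i.
  case: (ltnP i n.-1) => [|ni]; first exact: eP.
  (* There is no [xi] move for the last index, but there the peripheral product is inverse to a
     product of commutators, so its value is 1. *)
  rewrite char_peripheral_last //; first exact: pow_of1.
  by have := ltn_ord i; lia.
have ec i : pow_of e (f (c i)).
  case: i => -[|i] ni.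
    have := eP (Ordinal ni); rewrite /peripheral (big_pred1 (Ordinal ni)) //.
    by move=> j; rewrite /= leqn0; apply/eqP/eqP => [?|-> //]; exact: val_inj.
  have := eP (Ordinal ni).
  rewrite (@peripheralS (Ordinal (ltnW ni)) (Ordinal ni)) // (charM fch).
  move=> /(pow_ofM (pow_ofV pz eN (eP (Ordinal (ltnW ni))))).
  by rewrite mulKf // (char_neq0 fch).
exists h; split=> //; rewrite he; apply: (pow_of_prim pz eN); rewrite -fx.
move: (x); apply: (action_ind act (P := fun y => pow_of e (f y))) => [i|i|i||y y' ey ey'|y ey].
- by have [] := ei i.
- by have [] := ei i.
- exact: ec.
- by rewrite (char1 fch); exact: pow_of1.
- by rewrite (charM fch); exact: pow_ofM.
- by rewrite (charV fch); apply: (pow_ofV pz).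
Qed.

End Gather.

End Transitivity.

(** * Distributing prescribed values over the handles *)

Section Spread.
Context {L : groupType} {g n : nat} {a b : 'I_g -> L} {c : 'I_n -> L}.
Context {Phi : set (L -> L)} (act : surface_action a b c Phi).
Context {K : fieldType} {N : nat} {z : K} (pz : N.-primitive_root z).
Implicit Types (f : L -> K) (k l : 'I_g).

Lemma char_thetaX k l f j : is_char f -> l = k.+1 :> nat ->
  exists2 h, Phi h & [/\ f (h (a k)) = f (a k) * (f (b k) / f (b l)) ^+ j,
    (forall i, i != k -> i != l -> f (h (a i)) = f (a i)) &
    forall i, f (h (b i)) = f (b i)].
Proof.
move=> fch lk; elim: j => [|j [h Ph [hk ha hb]]].
  by exists id; [exact: action_id act|split=> //; rewrite mulr1].
have [h' Ph' [hk' _ ha' hb']] := char_theta act (char_phi act fch Ph) lk.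
exists (h \o h'); first exact: (action_comp act).
rewrite /= in hk' ha' hb'; split=> [|i ik il|i] /=.
- by rewrite hk' hk !hb exprSr -mulrA.
- by rewrite ha' ?ha.
- by rewrite hb' hb.
Qed.

Lemma char_set_handle f k x y : is_char f -> (forall x, f x ^+ N = 1) ->
  N.-primitive_root (f (a k)) \/ N.-primitive_root (f (b k)) ->
  N.-primitive_root x \/ N.-primitive_root y -> x ^+ N = 1 -> y ^+ N = 1 ->
  exists2 h, Phi h & [/\ f (h (a k)) = x, f (h (b k)) = y &
   forall i, i != k -> f (h (a i)) = f (a i) /\ f (h (b i)) = f (b i)].
Proof.
move=> fch fN p p' xN yN.
exact: (reach_any act fch pz xN yN p (fN _) (fN _) p' (reach_refl act k f)).
Qed.

(* A primitive value in one handle can be used to adjust the neighbouring one: *)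
(* [theta] followed by [tau_alpha^-1] divides [f (a k)] by [f (b l)]. *)
Lemma char_set_pair f k l x y x' y' : is_char f -> (forall x, f x ^+ N = 1) ->
  l = k.+1 :> nat ->
  N.-primitive_root (f (a l)) \/ N.-primitive_root (f (b l)) ->
  x ^+ N = 1 -> y ^+ N = 1 -> x' ^+ N = 1 -> y' ^+ N = 1 ->
  N.-primitive_root x' \/ N.-primitive_root y' ->
  exists2 h, Phi h &
    [/\ f (h (a k)) = x, f (h (b k)) = y, f (h (a l)) = x', f (h (b l)) = y' &
     forall i, i != k -> i != l ->
       f (h (a i)) = f (a i) /\ f (h (b i)) = f (b i)].
Proof.
move=> fch fN lk p xN yN x'N y'N p'.
have kl : k != l by apply/eqP => E; move: lk; rewrite E => /n_Sn.
have zN : z ^+ N = 1 by exact: prim_expr_order.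
have step h t : Phi h -> t ^+ N = 1 ->
    N.-primitive_root (f (h (a l))) \/ N.-primitive_root (f (h (b l))) ->
    exists2 h', Phi h' & [/\ f (h' (a k)) = t, f (h' (b k)) = f (h (b k)),
      N.-primitive_root (f (h' (b l))) & forall i, i != k -> i != l ->
       f (h' (a i)) = f (h (a i)) /\ f (h' (b i)) = f (h (b i))].
  move=> Ph tN ph.
  have [h1 Ph1 [_ h1b h1i]] := char_set_handle (char_phi act fch Ph)
    (fun x => fN _) ph (or_intror pz) (expr1n _ N) zN.
  have Phh1 := action_comp act Ph Ph1.
  (* With [z] at [b l], the j-th power of [theta] followed by that of the inverse alpha twist
     multiplies [f (a k)] by z^-j; [j] is chosen so that [t] results. *)
  have [j jE] := prim_pow_of pz (unityM (fN (h (h1 (a k)))) (unityV tN)).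
  have [h2 Ph2 [h2k h2a h2b]] :=
    char_thetaX (k := k) (l := l) j (char_phi act fch Phh1) lk.
  have Phh2 := action_comp act Phh1 Ph2.
  have [h3 [Ph3 h3a h3b h3c]] := alpha_moveV act k j.
  exists (h \o h1 \o h2 \o h3); first exact: (action_comp act).
  rewrite /= in h1b h1i h2k h2a h2b.
  split=> [||| i ik il] /=.
  - rewrite [h3 (a k)]h3a /= eqxx -[LHS]/((f \o (h \o h1 \o h2)) _).
    have fch2 := char_phi act fch Phh2.
    rewrite (charM fch2) (charV fch2) (charX fch2) /= h2k h2b h1b.
    have bN0 := char_neq0 fch (h (h1 (b k))).
    rewrite expr_div_n -jE; field.
    by rewrite (char_neq0 fch) expf_neq0 // (unity_neq0 pz).
  - by rewrite [h3 _]h3b h2b; have [_ ->] := h1i k kl.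
  - by rewrite [h3 _]h3b h2b h1b.
  - rewrite [h3 (b i)]h3b [h3 (a i)]h3a /= (negbTE ik) h2b h2a //.
    exact: h1i.
(* [step] controls [f (a k)] alone. It first places a primitive value there, which allows [f (b k)]
   to be set to [y] inside handle [k]; a second use then installs [x]. *)
have [h1 Ph1 [h1a h1b h1l h1i]] :=
  step id z (action_id act) zN p.
rewrite /= in h1b h1i.
have [h2 Ph2 [h2a h2b h2i]] := char_set_handle (k := k) (char_phi act fch Ph1)
  (fun x => fN _) (or_introl (eq_ind_r (fun x => N.-primitive_root x) pz h1a))
  (or_introl pz) zN yN.
rewrite /= in h2a h2b h2i.
have lNk : l != k by rewrite eq_sym.
have [E1 E2] := h2i l lNk.
have p2 : N.-primitive_root (f (h1 (h2 (b l)))) by rewrite E2.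
have [h3 Ph3 [h3a h3b h3l h3i]] :=
  step _ x (action_comp act Ph1 Ph2) xN (or_intror p2).
have [h4 Ph4 [h4a h4b h4i]] := char_set_handle (k := l) (char_phi act fch Ph3)
  (fun x => fN _) (or_intror h3l) p' x'N y'N.
rewrite /= in h3a h3b h3i h4a h4b h4i.
exists (h3 \o h4); first exact: (action_comp act).
have [F1 F2] := h4i k kl.
split=> //= [||i ik il].
- by rewrite F1.
- by rewrite F2 h3b.
- have [-> ->] := h4i i il; have [-> ->] := h3i i ik il.
  by have [-> ->] := h2i i ik; have [-> ->] := h1i i ik il.
Qed.

Lemma char_spread f (m : 'I_g) (u v : 'I_g -> K) : is_char f ->
  (forall x, f x ^+ N = 1) -> m.+1 = g ->
  N.-primitive_root (f (a m)) \/ N.-primitive_root (f (b m)) ->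
  (forall i, u i ^+ N = 1) -> (forall i, v i ^+ N = 1) ->
  N.-primitive_root (u m) \/ N.-primitive_root (v m) ->
  exists2 h, Phi h & f \o h \o a =1 u /\ f \o h \o b =1 v.
Proof.
move=> fch fN mg p uN vN pu.
have zN : z ^+ N = 1 by exact: prim_expr_order.
have down d : (d <= m)%N -> exists2 h, Phi h & forall i : 'I_g, (m - d <= i)%N ->
    N.-primitive_root (f (h (a i))) \/ N.-primitive_root (f (h (b i))).
  elim: d => [_|d IH dm].
    exists id; first exact: action_id act.
    by move=> i mi; suff -> : i = m by []; apply: val_inj => /=; have := ltn_ord i; lia.
  have [h Ph hp] := IH (ltnW dm).
  have kg : (m - d.+1 < g)%N by have := ltn_ord m; lia.
  have lg : (m - d < g)%N by have := ltn_ord m; lia.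
  pose k := Ordinal kg; pose l := Ordinal lg.
  have lk : l = k.+1 :> nat by rewrite /=; lia.
  have [h' Ph' [h'k _ h'l _ h'i]] := char_set_pair (char_phi act fch Ph)
    (fun x => fN _) lk (hp l (leqnn _)) zN zN zN zN (or_introl pz).
  exists (h \o h'); first exact: (action_comp act).
  move=> i mi; case: (eqVneq i k) => [->|ik]; first by left; rewrite [f _]h'k.
  case: (eqVneq i l) => [->|il]; first by left; rewrite [f _]h'l.
  have := h'i i ik il; rewrite /= => -[-> ->]; apply: hp.
  by move: ik; rewrite -val_eqE /=; lia.
have up d : (d <= m)%N -> exists2 h, Phi h & (forall i : 'I_g, (d <= i)%N ->
    N.-primitive_root (f (h (a i))) \/ N.-primitive_root (f (h (b i)))) /\
    forall i : 'I_g, (i < d)%N -> f (h (a i)) = u i /\ f (h (b i)) = v i.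
  elim: d => [_|d IH dm].
    have [h Ph hp] := down m (leqnn _).
    by exists h => //; split=> // i _; apply: hp; rewrite subnn.
  have [h Ph [hp hu]] := IH (ltnW dm).
  have kg : (d < g)%N by have := ltn_ord m; lia.
  have lg : (d.+1 < g)%N by have := ltn_ord m; lia.
  pose k := Ordinal kg; pose l := Ordinal lg.
  have [h' Ph' [h'k h'k2 h'l _ h'i]] := char_set_pair (k := k) (l := l)
    (char_phi act fch Ph) (fun x => fN _) erefl (hp l (leqnSn _))
    (uN k) (vN k) zN zN (or_introl pz).
  exists (h \o h'); first exact: (action_comp act).
  split=> i di.
    case: (eqVneq i l) => [->|il]; first by left; rewrite [f _]h'l.
    have ik : i != k by rewrite -val_eqE /=; lia.
    have := h'i i ik il; rewrite /= => -[-> ->]; apply: hp; exact: ltnW.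
  case: (eqVneq i k) => [->|ik]; first by [].
  have il : i != l by rewrite -val_eqE /=; lia.
  have := h'i i ik il; rewrite /= => -[-> ->]; apply: hu.
  by move: ik; rewrite -val_eqE /=; lia.
have [h Ph [hp hu]] := up m (leqnn _).
have [h' Ph' [h'a h'b h'i]] := char_set_handle (char_phi act fch Ph)
  (fun x => fN _) (hp m (leqnn _)) pu (uN m) (vN m).
rewrite /= in h'a h'b h'i.
exists (h \o h'); first exact: (action_comp act).
split=> i; rewrite /=; case: (eqVneq i m) => [->|im] //.
  have [-> _] := h'i i im; have [//|-> //] := hu i.
  by move: im; rewrite -val_eqE /=; have := ltn_ord i; lia.
have [_ ->] := h'i i im; have [//|_ -> //] := hu i.
by move: im; rewrite -val_eqE /=; have := ltn_ord i; lia.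
Qed.

Lemma char_orbit f (m : 'I_g) (u v : 'I_g -> K) : is_char f ->
  (forall x, f x ^+ N = 1) -> (exists x, f x = z) -> m.+1 = g ->
  (forall i, u i ^+ N = 1) -> (forall i, v i ^+ N = 1) ->
  N.-primitive_root (u m) \/ N.-primitive_root (v m) ->
  exists2 h, Phi h & f \o h \o a =1 u /\ f \o h \o b =1 v.
Proof.
move=> fch fN fz mg uN vN p.
have [h [Ph _ hb]] := char_gather act pz fch fN mg fz.
have [h' Ph' [ha' hb']] := char_spread (char_phi act fch Ph) (fun x => fN _) mg
  (or_intror hb) uN vN p.
by exists (h \o h'); first exact: (action_comp act).
Qed.

End Spread.

(** * Orbits of affine representations *)

Section Cocycles.
Context {L : groupType} {K : fieldType}.

(** Equivalently, the affine maps z -> chi(x) z + tau(x) compose like the elements x. *)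
Definition is_cocycle (chi tau : L -> K) :=
  is_char chi /\ forall x y, tau (x * y)%g = tau x + chi x * tau y.

Context {chi tau : L -> K} (coc : is_cocycle chi tau).

Let ch : is_char chi := coc.1.

Lemma cocycleM x y : tau (x * y)%g = tau x + chi x * tau y.
Proof. exact: coc.2. Qed.

Lemma cocycle1 : tau 1%g = 0.
Proof.
have /eqP := cocycleM 1%g 1%g.
by rewrite mulg1 (char1 ch) mul1r -subr_eq0 opprD addNKr oppr_eq0 => /eqP.
Qed.

Lemma cocycleV x : tau x^-1%g = - (tau x / chi x).
Proof.
apply/eqP; rewrite -addr_eq0 addrC; have x0 := char_neq0 ch x.
apply/eqP/(mulfI x0); rewrite mulr0 mulrDr mulrCA mulfV ?mulr1 //.
by rewrite -cocycleM mulgV cocycle1.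
Qed.

Lemma cocycleX x s j : tau x = (chi x - 1) * s ->
  tau (x ^+ j)%g = (chi x ^+ j - 1) * s.
Proof.
move=> xs; elim: j => [|j IH]; first by rewrite cocycle1 subrr mul0r.
by rewrite expgS cocycleM IH xs exprS; ring.
Qed.

Lemma cocycleX1 x j : chi x = 1 -> tau (x ^+ j)%g = tau x *+ j.
Proof.
move=> x1; elim: j => [|j IH]; first by rewrite cocycle1.
by rewrite expgS cocycleM IH x1 mul1r mulrS.
Qed.

Lemma cocycle_comp (h : L -> L) : h 1%g = 1%g -> {morph h : x y / (x * y)%g} ->
  is_cocycle (chi \o h) (tau \o h).
Proof.
move=> h1 hM; split; first exact: char_comp.
by move=> x y; rewrite /= hM cocycleM.
Qed.

Lemma cocycle_prod0 (I : Type) (r : seq I) (P : pred I) (F : I -> L) :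
  (forall i, P i -> tau (F i) = 0) -> tau (\prod_(i <- r | P i) F i)%g = 0.
Proof.
move=> F0; elim/big_ind: _ => //; first exact: cocycle1.
by move=> x y x0 y0; rewrite cocycleM x0 y0 mulr0 addr0.
Qed.

Lemma cocycle_shift w : is_cocycle chi (fun x => tau x - (1 - chi x) * w).
Proof. by split=> // x y; rewrite cocycleM (charM ch); ring. Qed.

End Cocycles.

(** * Non-split cocycles whose orbit is finite *)

Section FiniteOrbits.
Context {L : groupType} {g n : nat} {a b : 'I_g -> L} {c : 'I_n -> L}.
Context {Phi : set (L -> L)} (act : surface_action a b c Phi).
Context {K : numFieldType}.
Implicit Types (chi tau : L -> K) (k l : 'I_g).

(** Conjugation of the maps z -> chi(x) z + tau(x) by z -> s z + w. *)
Definition affine_conj chi tau chi' tau' :=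
  chi =1 chi' /\
  exists s w, s != 0 /\ forall x, tau' x = s * tau x + (1 - chi x) * w.

(** [tau] is not a coboundary: the affine maps have no common fixed point. *)
Definition nonsplit chi tau :=
  forall w, ~ (forall x, tau x = (1 - chi x) * w).

(* The last condition is what a finite orbit provides by the pigeonhole principle. *)
Definition good chi tau :=
  [/\ is_cocycle chi tau, nonsplit chi tau &
   forall h : nat -> L -> L, (forall i, Phi (h i)) -> exists i j,
     (i < j)%N /\ affine_conj (chi \o h i) (tau \o h i) (chi \o h j) (tau \o h j)].

Lemma cocycle_phi chi tau h :
  is_cocycle chi tau -> Phi h -> is_cocycle (chi \o h) (tau \o h).
Proof.
move=> coc Ph; apply: (cocycle_comp coc); first exact: (phi1 act Ph).
exact: (action_morph act).
Qed.

Lemma nonsplit_phi chi tau h :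
  nonsplit chi tau -> Phi h -> nonsplit (chi \o h) (tau \o h).
Proof.
move=> ns /(action_invP act) [h' [_ hK _]] w sp; apply: (ns w) => x.
by rewrite -[x]hK; exact: sp.
Qed.

Lemma good_phi chi tau h : good chi tau -> Phi h -> good (chi \o h) (tau \o h).
Proof.
move=> [coc ns fin] Ph; split.
- exact: cocycle_phi.
- exact: nonsplit_phi.
- move=> h' Ph'; apply: (fin (fun i => h \o h' i)) => i.
  exact: (action_comp act).
Qed.

Lemma good_shift chi tau w : good chi tau ->
  good chi (fun x => tau x - (1 - chi x) * w).
Proof.
move=> [coc ns fin]; split; first exact: cocycle_shift.
  move=> w' sp; apply: (ns (w + w')) => x; rewrite mulrDr -sp; ring.
move=> h Ph; have [i [j [ij [eq_chi [s [w' [s0 E]]]]]]] := fin h Ph.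
exists i, j; split=> //; split=> //; exists s, (w' + s * w - w); split=> // x.
by have /= -> := E x; have /= <- := eq_chi x; ring.
Qed.

Lemma natr_mul_inj (y : K) i j : (i < j)%N -> y *+ i = y *+ j -> y = 0.
Proof.
move=> ij /eqP; rewrite -!(mulr_natr y) -subr_eq0 -mulrBr mulf_eq0 => /orP [/eqP //|].
by rewrite subr_eq0 eqr_nat => /eqP E; rewrite E ltnn in ij.
Qed.

(** If one of the two translations were nonzero, powers of the twist along its loop would fix it and
    add multiples of it to the other. A conjugation between two of the results has scale 1, so two
    distinct multiples would agree, which is impossible in characteristic 0. *)
Lemma good_handle chi tau k : good chi tau -> chi (a k) = 1 -> chi (b k) = 1 ->
  tau (a k) = 0 /\ tau (b k) = 0.
Proof.
move=> [coc ns fin] a1 b1; split.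
- have [h hE] := choice (fun j => beta_moveX act k j).
  have [i [j [ij [_ [s [w [s0 E]]]]]]] :=
    fin h (fun j => let: And4 P _ _ _ := hE j in P).
  apply/eqP; apply: contraT => y0.
  have ha q : h q (a k) = a k by have [_ ha _ _] := hE q; exact: ha.
  have hb q : h q (b k) = (b k * a k ^+ q)%g.
    by have [_ _ hb _] := hE q; rewrite [LHS]hb /= eqxx.
  have s1 : s = 1.
    have := E (a k); rewrite /= !ha a1 subrr mul0r addr0 => e.
    by apply: (mulIf y0); rewrite -e mul1r.
  have := E (b k); rewrite /= !hb s1 mul1r (charM coc.1) (charX coc.1) a1 b1.
  rewrite expr1n mulr1 subrr mul0r addr0 !(cocycleM coc) b1 !mul1r.
  rewrite !(cocycleX1 coc) // => /addrI /esym /(natr_mul_inj ij) y1.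
  by rewrite y1 eqxx in y0.
- have [h hE] := choice (fun j => alpha_moveX act k j).
  have [i [j [ij [_ [s [w [s0 E]]]]]]] :=
    fin h (fun j => let: And4 P _ _ _ := hE j in P).
  apply/eqP; apply: contraT => y0.
  have hb q : h q (b k) = b k by have [_ _ hb _] := hE q; exact: hb.
  have ha q : h q (a k) = (a k * b k ^+ q)%g.
    by have [_ ha _ _] := hE q; rewrite [LHS]ha /= eqxx.
  have s1 : s = 1.
    have := E (b k); rewrite /= !hb b1 subrr mul0r addr0 => e.
    by apply: (mulIf y0); rewrite -e mul1r.
  have := E (a k); rewrite /= !ha s1 mul1r (charM coc.1) (charX coc.1) a1 b1.
  rewrite expr1n mulr1 subrr mul0r addr0 !(cocycleM coc) a1 !mul1r.
  rewrite !(cocycleX1 coc) // => /addrI /esym /(natr_mul_inj ij) y1.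
  by rewrite y1 eqxx in y0.
Qed.

Section LastHandle.
Variable m : 'I_g.
Hypothesis mg : m.+1 = g.

Definition tame chi := forall i, i != m -> chi (a i) = 1 /\ chi (b i) = 1.

Definition special chi tau :=
  [/\ tame chi, chi (a m) != 1, chi (b m) = 1 & tau (b m) != 0].

(* Powers of [tau_alpha] move the fixed point of the image of [a m]; up to *)
(* conjugation this is only harmless if all other images are translations. *)
Lemma special_c chi tau i : good chi tau -> special chi tau -> chi (c i) = 1.
Proof.
move=> [coc ns fin] [_ am1 bm1 y0].
have [h hE] := choice (fun j => alpha_moveX act m j).
have [p [q [pq [_ [s [w [s0 E]]]]]]] :=
  fin h (fun j => let: And4 P _ _ _ := hE j in P).
have hb r : h r (b m) = b m by have [_ _ hb _] := hE r; exact: hb.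
have hc r j : h r (c j) = c j by have [_ _ _ hc] := hE r; exact: hc.
have ha r : h r (a m) = (a m * b m ^+ r)%g.
  by have [_ ha _ _] := hE r; rewrite [LHS]ha /= eqxx.
have s1 : s = 1.
  have := E (b m); rewrite /= !hb bm1 subrr mul0r addr0 => e.
  by apply: (mulIf y0); rewrite -e mul1r.
(* With scale 1 and no shift, the conjugation would identify the images of [a m] under two different
   powers of the twist. *)
have w0 : w != 0.
  apply/eqP => w0; have := E (a m); rewrite /= !ha s1 w0 mul1r mulr0 addr0.
  rewrite !(cocycleM coc) !(cocycleX1 coc) // => /addrI.
  move=> /(mulfI (char_neq0 coc.1 _)) /esym /(natr_mul_inj pq) y1.
  by rewrite y1 eqxx in y0.
have := E (c i); rewrite /= !hc s1 mul1r => /eqP.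
rewrite eq_sym -subr_eq0 addrAC subrr add0r mulf_eq0 (negbTE w0) orbF.
by rewrite subr_eq0 => /eqP.
Qed.

(* [theta] would turn a trivial handle next to the last one into a handle with *)
(* trivial characters and a nonzero translation. *)
Lemma special_genus chi tau : good chi tau -> special chi tau -> g = 1%N.
Proof.
move=> gd [tm am1 bm1 y0]; apply/eqP; apply: contraT => g1.
have kg : (m.-1 < g)%N by lia.
pose k := Ordinal kg; have mk : m = k.+1 :> nat by rewrite /=; lia.
have km : k != m by rewrite -val_eqE /=; lia.
have [coc _ _] := gd.
have [h [Ph ha hb _]] := theta_move act mk.
have [ak1 bk1] := tm k km; have [tak tbk] := good_handle gd ak1 bk1.
have th1 : chi (theta a b k m) = 1.
  rewrite !(charM coc.1) !(charV coc.1) bm1 bk1; field.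
  exact: (char_neq0 coc.1).
have tth : tau (theta a b k m) = - (chi (a m) * tau (b m)).
  rewrite !(cocycleM coc) !(cocycleV coc) !(charM coc.1) !(charV coc.1) tbk bm1.
  by field; rewrite (char_neq0 coc.1).
have hak : h (a k) = (a k * theta a b k m)%g by rewrite [LHS]ha /= eqxx.
have hbk : h (b k) = ((theta a b k m)^-1 * b k * theta a b k m)%g.
  by rewrite [LHS]hb /= eqxx.
have [] := @good_handle (chi \o h) (tau \o h) k.
- exact: good_phi.
- by rewrite /= hak (charM coc.1) ak1 th1 mulr1.
- by rewrite /= hbk 2!(charM coc.1) (charV coc.1) th1 bk1 invr1 !mulr1.
rewrite /= hak (cocycleM coc) ak1 tak add0r mul1r tth => /eqP.
by rewrite oppr_eq0 mulf_eq0 (negbTE y0) (negbTE (char_neq0 coc.1 _)).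
Qed.

Lemma acts_as_peripheral h (k : 'I_n) : Phi h -> h \o c =1 c ->
  h (peripheral (c := c) k) = peripheral (c := c) k.
Proof.
move=> Ph hc; rewrite /peripheral.
rewrite (big_morph h (action_morph act Ph) (phi1 act Ph)).
by apply: eq_bigr => i _; exact: hc.
Qed.

(* If no element of the orbit is special, then [tau] vanishes on all handles *)
(* once it is normalized at [a m]; pushing [peripheral k] into the last handle *)
(* by [xi] shows that it vanishes there too, so that the cocycle is split. *)
Lemma exists_special chi tau N z : good chi tau -> N.-primitive_root z ->
  (forall x, chi x ^+ N = 1) -> (exists x, chi x = z) ->
  exists2 h, Phi h & special (chi \o h) (tau \o h).
Proof.
move=> gd0 pz chiN chiz; apply: contrapT => nsp0.
have [coc0 _ _] := gd0; have zN := prim_expr_order pz.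
have z0 : z != 0 by exact: unity_neq0 pz _ zN.
pose u (i : 'I_g) := if i == m then z else 1.
have um : u m = z by rewrite /u eqxx.
have uN i : u i ^+ N = 1 by rewrite /u; case: eqP; rewrite ?expr1n.
have pu : N.-primitive_root (u m) \/ N.-primitive_root (1 : K).
  by left; rewrite um.
have [h0 Ph0 [h0a h0b]] := char_orbit act pz
  (v := fun=> 1) coc0.1 chiN chiz mg uN (fun i => expr1n _ _) pu.
(* The fixed point of the image of [a m], to be moved to 0. For z = 1 the quotient is 0 by
   convention, and [Za] gives the vanishing instead. *)
pose w := tau (h0 (a m)) / (1 - z).
pose chi1 := chi \o h0; pose tau1 x := tau (h0 x) - (1 - chi1 x) * w.
have gd1 : good chi1 tau1 by apply: good_shift; exact: good_phi.
have chi1a : chi1 (a m) = z by rewrite [LHS]h0a.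
have chi1b : chi1 (b m) = 1 by rewrite [LHS]h0b.
have tm1 : tame chi1.
  by move=> i im; rewrite [chi1 _]h0a [chi1 _]h0b /u (negbTE im).
have nsp h : Phi h -> ~ special (chi1 \o h) (tau1 \o h).
  move=> Ph [tm am1 bm1 y0]; apply: nsp0; exists (h0 \o h).
    exact: (action_comp act).
  split=> //; move: y0; rewrite /tau1 /= [chi1 _]bm1.
  by rewrite subrr mul0r subr0.
have [coc1 ns1 _] := gd1.
(* A nonzero translation here is excluded by [good_handle] if [a m] has trivial character, and
   otherwise by the assumption that nothing in the orbit is special. *)
have Zb h : Phi h -> tame (chi1 \o h) -> chi1 (h (b m)) = 1 ->
    tau1 (h (b m)) = 0.
  move=> Ph tm hb1; apply: contrapT => /eqP y0.
  case: (eqVneq (chi1 (h (a m))) 1) => [ha1|ha1]; last by apply: (nsp h Ph).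
  have [_ E] := good_handle (good_phi gd1 Ph) ha1 hb1.
  by move: y0; rewrite [tau1 _]E eqxx.
have Za h : Phi h -> tame (chi1 \o h) -> chi1 (h (a m)) = 1 ->
    tau1 (h (a m)) = 0.
  move=> Ph tm ha1; have [s [Ps sa sb _]] := swap_move act m.
  have hsb : s (b m) = (a m)^-1%g by rewrite [LHS]sb /= eqxx.
  have cocs := cocycle_phi coc1 Ph.
  have tms : tame (chi1 \o (h \o s)).
    move=> i im; have [] := tm i im.
    by rewrite /= [s (a i)]sa [s (b i)]sb /= (negbTE im).
  have := Zb (h \o s) (action_comp act Ph Ps) tms.
  rewrite /= hsb -[chi1 _]/((chi1 \o h) _) -[tau1 _]/((tau1 \o h) _).
  rewrite (charV cocs.1) (cocycleV cocs) /= ha1 invr1 mulr1 => /(_ erefl) /eqP.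
  by rewrite oppr_eq0 => /eqP.
have t1a : tau1 (a m) = 0.
  case: (eqVneq z 1) => z1; first by apply: (Za id (action_id act) tm1); rewrite chi1a.
  rewrite /tau1 chi1a /w; field.
  by rewrite subr_eq0 eq_sym.
have t1b : tau1 (b m) = 0 by exact: (Zb id (action_id act) tm1).
have t1 i : tau1 (a i) = 0 /\ tau1 (b i) = 0.
  case: (eqVneq i m) => [->|im]; first by split.
  have [ai bi] := tm1 i im; exact: (good_handle gd1 ai bi).
have tP (k : 'I_n) : tau1 (peripheral (c := c) k) = 0.
  have := ltn_ord k; rewrite leq_eqVlt => /orP [/eqP kn|kn].
    rewrite (peripheral_last act kn) (cocycleV coc1).
    rewrite (cocycle_prod0 coc1) ?mul0r ?oppr0 // => i _.
    have [ti ti'] := t1 i.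
    by rewrite !(cocycleM coc1) !(cocycleV coc1) ti ti'; ring.
  (* The value of [chi] in the last handle is moved from [a m] to [b m], with [tau] still zero on
     both, so that [xi] brings the translation of the peripheral product into [a m]. *)
  have [h1 [Ph1 h1a h1b h1c]] := swap_move act m.
  have [h2 [Ph2 h2a h2b h2c]] := alpha_moveX act m 1.
  have [h3 [Ph3 h3a h3b _]] := xi_move act mg kn.
  have Ph12 := action_comp act Ph1 Ph2.
  have Ph123 := action_comp act Ph12 Ph3.
  pose chi2 := chi1 \o (h1 \o h2); pose tau2 := tau1 \o (h1 \o h2).
  have coc2 : is_cocycle chi2 tau2 by exact: cocycle_phi.
  have h12a : (h1 \o h2) (a m) = (a m * b m * (a m)^-1)%g.
    rewrite /= [h2 _]h2a /= eqxx (action_morph act Ph1) [h1 _]h1a.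
    by rewrite expg1 [h1 _]h1b /= !eqxx.
  have h12b : (h1 \o h2) (b m) = (a m)^-1%g.
    by rewrite /= [h2 _]h2b [h1 _]h1b /= eqxx.
  have chi2a : chi2 (a m) = 1.
    rewrite /chi2 [LHS]/= -[h1 _]/((h1 \o h2) _) h12a.
    by rewrite (char_conj coc1.1).
  have tau2a : tau2 (a m) = 0.
    rewrite /tau2 [LHS]/= -[h1 _]/((h1 \o h2) _) h12a.
    by rewrite !(cocycleM coc1) (cocycleV coc1) t1a t1b; ring.
  have chi2b : chi2 (b m) = z^-1.
    rewrite /chi2 [LHS]/= -[h1 _]/((h1 \o h2) _) h12b.
    by rewrite (charV coc1.1) chi1a.
  have tau2b : tau2 (b m) = 0.
    rewrite /tau2 [LHS]/= -[h1 _]/((h1 \o h2) _) h12b.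
    by rewrite (cocycleV coc1) t1a mul0r oppr0.
  have tau2P : tau2 (peripheral (c := c) k) = tau1 (peripheral (c := c) k).
    by rewrite /tau2 /= !acts_as_peripheral.
  set P := peripheral k in tau2P *.
  pose X := xi b c m k.
  have XE : X = (P^-1 * b m)%g by [].
  have h3am : h3 (a m) = (a m * X)%g by rewrite [LHS]h3a /= eqxx.
  have h3bm : h3 (b m) = (X^-1 * b m * X)%g by rewrite [LHS]h3b /= eqxx.
  clearbody X P.
  have chiX : chi2 X = z^-1 / chi2 P.
    by rewrite XE (charM coc2.1) (charV coc2.1) chi2b mulrC.
  have tauX : tau2 X = - (tau2 P / chi2 P).
    by rewrite XE (cocycleM coc2) (cocycleV coc2) tau2b mulr0 addr0.
  have X0 : chi2 X != 0 := char_neq0 coc2.1 X.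
  have chi2XN : chi2 X ^+ N = 1 by exact: chiN.
  (* This power of the alpha twist cancels the character at [a m], as [Za] requires; the remaining
     translation is a nonzero multiple of that of the peripheral product. *)
  have [q qE] := prim_pow_of (prim_inv pz pz) (unityV chi2XN).
  have [h4 [Ph4 h4a h4b _]] := alpha_moveX act m q.
  pose chi3 := chi2 \o h3; pose tau3 := tau2 \o h3.
  have coc3 : is_cocycle chi3 tau3 by exact: cocycle_phi.
  have chi3a : chi3 (a m) = chi2 X.
    by rewrite /chi3 /= h3am [LHS](charM coc2.1) chi2a mul1r.
  have tau3a : tau3 (a m) = tau2 X.
    by rewrite /tau3 /= h3am [LHS](cocycleM coc2) tau2a add0r chi2a mul1r.
  have chi3b : chi3 (b m) = z^-1.
    rewrite /chi3 [LHS]/= h3bm 2!(charM coc2.1) (charV coc2.1) chi2b.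
    by rewrite mulrAC mulVf ?mul1r.
  have tau3b : tau3 (b m) = (chi3 (b m) - 1) * (tau2 X / chi2 X).
    rewrite chi3b /tau3 [LHS]/= h3bm 2!(cocycleM coc2) (cocycleV coc2).
    rewrite (charM coc2.1) (charV coc2.1) tau2b chi2b.
    by field; rewrite X0.
  have h4am : h4 (a m) = (a m * b m ^+ q)%g by rewrite [LHS]h4a /= eqxx.
  have := Za (h1 \o h2 \o h3 \o h4) (action_comp act Ph123 Ph4).
  rewrite [(_ \o h4) (a m)]/= h4am.
  rewrite -[chi1 _]/(chi3 (a m * b m ^+ q)%g) -[tau1 _]/(tau3 (a m * b m ^+ q)%g).
  rewrite (charM coc3.1) (charX coc3.1) chi3a chi3b -qE mulfV // => E.
  have /E /(_ erefl) : tame (chi1 \o (h1 \o h2 \o h3 \o h4)).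
    move=> i im; have := tm1 i im.
    rewrite /= [h4 (a i)]h4a [h4 (b i)]h4b /= (negbTE im).
    rewrite [h3 (a i)]h3a [h3 (b i)]h3b /= (negbTE im).
    rewrite [h2 (a i)]h2a [h2 (b i)]h2b /= (negbTE im).
    by rewrite [h1 (a i)]h1a [h1 (b i)]h1b /= (negbTE im).
  rewrite (cocycleM coc3) (cocycleX coc3 _ tau3b) chi3b -qE tau3a chi3a.
  have -> : tau2 X + chi2 X * (((chi2 X)^-1 - 1) * (tau2 X / chi2 X)) =
      tau2 X / chi2 X by field.
  rewrite tauX -tau2P => /eqP; rewrite mulf_eq0 oppr_eq0 mulf_eq0 !invr_eq0.
  by rewrite (negbTE X0) (negbTE (char_neq0 coc2.1 P)) !orbF => /eqP.
have tc i : tau1 (c i) = 0.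
  case: i => -[|i] ni.
    have := tP (Ordinal ni); rewrite /peripheral (big_pred1 (Ordinal ni)) //.
    by move=> j; rewrite /= leqn0; apply/eqP/eqP => [?|-> //]; exact: val_inj.
  have := tP (Ordinal ni).
  rewrite (@peripheralS _ _ _ (Ordinal (ltnW ni)) (Ordinal ni)) //.
  rewrite (cocycleM coc1) tP add0r => /eqP.
  by rewrite mulf_eq0 (negbTE (char_neq0 coc1.1 _)) => /eqP.
apply: (ns1 0) => x; rewrite mulr0; move: x; apply: (action_ind act).
- by move=> i; have [] := t1 i.
- by move=> i; have [] := t1 i.
- exact: tc.
- exact: (cocycle1 coc1).
- by move=> x y x0 y0; rewrite (cocycleM coc1) x0 y0 mulr0 addr0.
- by move=> x x0; rewrite (cocycleV coc1) x0 mul0r oppr0.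
Qed.

End LastHandle.
End FiniteOrbits.

(** * Reducible representations *)

Section ConjClasses.
Context {R : realType} {n : nat} {X : punctured_surface R n} {G : groupType}.
Implicit Types rho : Lambda X -> G.

Lemma conj_class_eq rho rho' : conj_class rho = conj_class rho' <->
  exists p, forall x, rho' x = (p * rho x * p^-1)%g.
Proof.
split=> [E|[p pE]].
  have : conj_class rho' rho' by exists 1%g => x; rewrite mul1g invg1 mulg1.
  by rewrite -E.
apply/seteqP; split=> r [q qE].
  exists (q * p^-1)%g => x; rewrite qE pE invgM invgK !mulgA.
  by rewrite mulgVK mulgVK.
by exists (q * p)%g => x; rewrite qE pE invgM !mulgA.
Qed.

End ConjClasses.

Section Matrices.
Context {K : fieldType}.

Lemma ord2P (i : 'I_2) : i = 0 \/ i = 1.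
Proof. by case: i => -[|[|//]] i2; [left|right]; exact: val_inj. Qed.

Lemma matrix2P (A B : 'M[K]_2) : A 0 0 = B 0 0 -> A 0 1 = B 0 1 ->
  A 1 0 = B 1 0 -> A 1 1 = B 1 1 -> A = B.
Proof.
move=> ? ? ? ?; apply/matrixP => i j.
by have [->|->] := ord2P i; have [->|->] := ord2P j.
Qed.

Lemma mx2_eq (A : 'M[K]_2) : A = mx2 (A 0 0) (A 0 1) (A 1 0) (A 1 1).
Proof.
by apply: matrix2P; rewrite mxE.
Qed.

Lemma mx2M (a b c d a' b' c' d' : K) :
  mx2 a b c d * mx2 a' b' c' d' =
  mx2 (a * a' + b * c') (a * b' + b * d') (c * a' + d * c') (c * b' + d * d').
Proof.
by apply: matrix2P; rewrite -mulmxE !mxE big_ord_recl big_ord1 !mxE.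
Qed.

Lemma mx2_inj (a b c d a' b' c' d' : K) :
  mx2 a b c d = mx2 a' b' c' d' -> [/\ a = a', b = b', c = c' & d = d'].
Proof.
move=> E; split.
- by have := congr1 (fun A : 'M_2 => A 0 0) E; rewrite !mxE.
- by have := congr1 (fun A : 'M_2 => A 0 1) E; rewrite !mxE.
- by have := congr1 (fun A : 'M_2 => A 1 0) E; rewrite !mxE.
- by have := congr1 (fun A : 'M_2 => A 1 1) E; rewrite !mxE.
Qed.

Lemma det_mx2 (a b c d : K) : \det (mx2 a b c d) = a * d - b * c.
Proof.
rewrite (expand_det_row _ 0) big_ord_recl big_ord1.
by rewrite /cofactor !det_mx11 !mxE /= expr0 expr1 mulN1r mul1r mulrN.
Qed.

Lemma mx2_unit (a b c d : K) :
  (mx2 a b c d \is a GRing.unit) = (a * d - b * c != 0).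
Proof. by rewrite -det_mx2 -unitfE. Qed.

Lemma mx2_scalar (a b c d : K) :
  is_scalar_mx (mx2 a b c d) = [&& a == d, b == 0 & c == 0].
Proof.
apply/is_scalar_mxP/and3P => [[s E]|[/eqP -> /eqP -> /eqP ->]].
  move: E; rewrite [s%:M]mx2_eq => /mx2_inj; rewrite !mxE /= => -[-> -> -> ->].
  by rewrite !eqxx.
by exists d; apply: matrix2P; rewrite !mxE ?mulr1n ?mulr0n.
Qed.

End Matrices.

Section Triangular.
Context {R : realType} {L : groupType}.
Local Notation K := R[i].
Implicit Types (rho : L -> GL2 R) (p q : GL2 R) (l chi tau : L -> K).

Lemma GL2_valM p q : units_val (p * q)%g = units_val p * units_val q.
Proof. by []. Qed.

Lemma GL2_val1 : units_val (1%g : GL2 R) = 1.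
Proof. by []. Qed.

(** Extracting the lower right entry [l] leaves the matrix of an affine map. *)
Definition triangular rho p l chi tau := forall x,
  units_val (p * rho x * p^-1)%g = mx2 (l x * chi x) (l x * tau x) 0 (l x).

Lemma triangular_comp rho p l chi tau (h : L -> L) :
  triangular rho p l chi tau ->
  triangular (rho \o h) p (l \o h) (chi \o h) (tau \o h).
Proof. by move=> tr x; exact: tr. Qed.

Lemma triangular_chars (rho : {multiplicative L -> GL2 R}) p (A B D : L -> K) :
  (forall x, units_val (p * rho x * p^-1)%g = mx2 (A x) (B x) 0 (D x)) ->
  exists l chi tau, [/\ is_char l, is_cocycle chi tau &
    triangular rho p l chi tau].
Proof.
move=> E.
have EM x y : mx2 (A (x * y)%g) (B (x * y)%g) 0 (D (x * y)%g) =
    mx2 (A x * A y) (A x * B y + B x * D y) 0 (D x * D y).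
  rewrite -E gmulfM; have -> : (p * (rho x * rho y) * p^-1 =
      (p * rho x * p^-1) * (p * rho y * p^-1))%g.
    by rewrite !mulgA mulgVK.
  by rewrite GL2_valM !E mx2M !mulr0 !mul0r !addr0 add0r.
have [A1 _ _ D1] : [/\ A 1%g = 1, B 1%g = 0, (0 : K) = 0 & D 1%g = 1].
  have := E 1%g; rewrite multiplicative1 mulg1 mulgV GL2_val1 => /esym.
  by rewrite [(1 : 'M_2)]mx2_eq !mxE /= => /mx2_inj.
have chA : is_char A by split=> // x y; have [] := mx2_inj (EM x y).
have chD : is_char D by split=> // x y; have [] := mx2_inj (EM x y).
exists D, (fun x => A x / D x), (fun x => B x / D x); split=> //.
  split; first split.
  - by rewrite A1 D1 divr1.
  - by move=> x y; rewrite (charM chA) (charM chD) invfM mulrACA.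
  - move=> x y; have [_ -> _ _] := mx2_inj (EM x y); rewrite (charM chD).
    by field; rewrite !(char_neq0 chD).
move=> x; rewrite E; congr mx2; rewrite mulrC mulfVK //; exact: char_neq0.
Qed.

(** The lower left entry of the conjugating matrix decides. If it is 0, the invariant line is
    preserved and the conjugation is affine; otherwise there is a second invariant line, so the
    diagonal characters are exchanged and [tau] splits. *)
Lemma triangular_conj rho rho' p p' l l' chi chi' tau tau' :
  is_char l -> is_char l' -> is_char chi -> is_char chi' ->
  triangular rho p l chi tau -> triangular rho' p' l' chi' tau' ->
  (exists q, forall x, rho' x = (q * rho x * q^-1)%g) ->
  (l =1 l' /\ affine_conj chi tau chi' tau') \/
  [/\ (forall x, l' x = l x * chi x), (forall x, l x = l' x * chi' x) &
      exists w, forall x, tau x = (1 - chi x) * w].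
Proof.
move=> lch lch' cch cch' tr tr' [q qE].
pose P := (p' * q * p^-1)%g.
have PE x : units_val P * mx2 (l x * chi x) (l x * tau x) 0 (l x) =
    mx2 (l' x * chi' x) (l' x * tau' x) 0 (l' x) * units_val P.
  rewrite -tr -tr' -!GL2_valM qE /P; congr units_val.
  by rewrite !mulgA !mulgVK.
have := unitsP P; move: PE; rewrite [units_val P]mx2_eq.
move: (units_val P 0 0) (units_val P 0 1) (units_val P 1 0) (units_val P 1 1).
move=> u v w d; clearbody P => PE; rewrite mx2_unit => det.
have PE0 := PE.
have {}PE x : [/\ u * (l x * chi x) = l' x * chi' x * u + l' x * tau' x * w,
    u * (l x * tau x) + v * l x = l' x * chi' x * v + l' x * tau' x * d,
    w * (l x * chi x) = l' x * w & w * (l x * tau x) + d * l x = l' x * d].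
  have := PE x; rewrite !mx2M !mulr0 !mul0r !addr0 !add0r.
  by move=> /mx2_inj [].
case: (eqVneq w 0) => w0; [left|right].
  move: det; rewrite w0 mulr0 subr0 mulf_eq0 negb_or => /andP [u0 d0].
  have ll x : l x = l' x.
    have [_ _ _] := PE x; rewrite w0 mul0r add0r mulrC => /(mulIf d0).
    by [].
  have cc x : chi x = chi' x.
    have [E _ _ _] := PE x; move: E.
    rewrite w0 mulr0 addr0 ll mulrC => /(mulIf u0) /mulfI; apply.
    exact: char_neq0.
  split=> //; split=> //; exists (u / d), (v / d); split.
    by rewrite mulf_neq0 ?invr_eq0.
  move=> x; have [_ E _ _] := PE x; move: E; rewrite -ll -cc => E.
  have lx0 := char_neq0 lch x.
  apply: (mulfI lx0); apply: (mulIf d0).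
  have -> : l x * tau' x * d = u * (l x * tau x) + v * l x - l x * chi x * v.
    by rewrite E; ring.
  by field; rewrite d0.
have lE x : l' x = l x * chi x.
  by have [_ _ E _] := PE x; apply: (mulIf w0); rewrite -E mulrC.
have tE x : tau x = (1 - chi x) * - (d / w).
  have [_ _ _] := PE x; rewrite lE => E.
  have lx0 := char_neq0 lch x.
  apply: (mulfI lx0); apply: (mulfI w0).
  have -> : w * (l x * tau x) = l x * chi x * d - d * l x by rewrite -E; ring.
  by field; rewrite w0.
split=> //; last by exists (- (d / w)).
(* Equality of determinants reads l^2 chi = l'^2 chi', and l' = l chi is already known. *)
move=> x; have := congr1 determinant (PE0 x).
rewrite -!mulmxE !det_mulmx mulrC => /mulIf E.
have {}/E : \det (mx2 u v w d) != 0 by rewrite det_mx2.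
have lx0 := char_neq0 lch x; have cx0 := char_neq0 cch x.
rewrite !det_mx2 lE !mulr0 !subr0 => E1.
have lcx0 : l x * chi x != 0 by rewrite mulf_neq0.
by apply: (mulfI lcx0); rewrite E1; ring.
Qed.

End Triangular.

(** * Counting finite sets and images of characters *)

Section Counting.
Context {T : choiceType} (S : set T).

(** The coding is a relation rather than a function because the data of a conjugacy class will
    depend on a representative. *)
Lemma set_card_le (D : finType) (rel : T -> D -> Prop) :
  (forall x, S x -> exists d, rel x d) ->
  (forall x y d, S x -> S y -> rel x d -> rel y d -> x = y) ->
  finite_set S /\ (set_card S <= #|D|)%N.
Proof.
move=> ex inj.
have fin : finite_set S.
  case: (pselect (exists x, S x)) => [[x0 Sx0]|nS]; last first.
    suff -> : S = set0 by exact: finite_set0.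
    by apply/seteqP; split=> // x Sx; case: nS; exists x.
  pose f d := if pselect (exists2 x, S x & rel x d) is left e
              then s2val (cid2 e) else x0.
  apply: (@sub_finite_set _ _ (f @` [set: D])); last exact/finite_image/finite_finset.
  move=> x Sx; have [d xd] := ex x Sx; exists d => //; rewrite /f.
  case: pselect => [e|[]]; last by exists x.
  by apply: (inj _ _ d) => //; [exact: s2valP|exact: (s2valP' (cid2 e))].
split=> //.
have exS (x : fset_set S) : exists d, rel (val x) d.
  by apply: ex; have := valP x; rewrite in_fset_set // inE.
have [f fE] := choice exS.
rewrite /set_card cardfE; apply: (@leq_card _ _ f) => x y fxy; apply: val_inj.
have Sv (u : fset_set S) : S (val u).
  by have := valP u; rewrite in_fset_set // inE.
by apply: (inj _ _ (f x)) => //; rewrite fxy.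
Qed.

Lemma set_card_ge (D : finType) (rel : D -> T -> Prop) : finite_set S ->
  (forall d, exists2 x, S x & rel d x) ->
  (forall d d' x, S x -> rel d x -> rel d' x -> d = d') ->
  (#|D| <= set_card S)%N.
Proof.
move=> fin ex inj.
have exS d : exists x : fset_set S, rel d (val x).
  have [x Sx dx] := ex d; have xS : x \in fset_set S.
    by rewrite in_fset_set // inE.
  by exists [` xS]%fset.
have [f fE] := choice exS.
rewrite /set_card cardfE; apply: (@leq_card _ _ f) => d d' fdd.
have Sf : S (val (f d)) by have := valP (f d); rewrite in_fset_set // inE.
apply: (inj _ _ (val (f d))) => //; rewrite fdd; exact: fE.
Qed.

Lemma finite_pigeonhole (u : nat -> T) : finite_set S -> (forall i, S (u i)) ->
  exists i j, (i < j)%N /\ u i = u j.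
Proof.
move=> fin Su; apply: contrapT => nE.
have uI : injective u.
  move=> i j uij; case: (ltngtP i j) => // ij; case: nE.
    by exists i, j.
  by exists j, i.
have := @set_card_ge 'I_(set_card S).+1 (fun d x => u d = x) fin.
rewrite card_ord ltnn => /(_ _ _) E; suff : false by [].
apply: E => [d|d d' x _ <- /uI E]; first by exists (u d).
by apply: val_inj.
Qed.

End Counting.

Section FiniteCharacters.
Context {L : groupType} {K : fieldType} (f : L -> K).
Hypothesis fch : is_char f.

(** A finite multiplicative group in a field is cyclic: its N elements are all N-th roots of unity,
    so one of them is primitive. *)
Lemma finite_char_prim : finite_set (range f) ->
  exists z, [/\ (set_card (range f)).-primitive_root z,
    forall x, f x ^+ set_card (range f) = 1 & exists x, f x = z].
Proof.
move=> fin; set N := set_card _; pose rs : seq K := fset_set (range f).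
have urs : uniq rs by exact: fset_uniq.
have mem y : (y \in rs) <-> exists x, f x = y.
  rewrite /rs [y \in _](in_fset_set fin) inE; split=> [[x _ <-]|[x <-]]; first by exists x.
  by exists x.
have rs1 : 1 \in rs by apply/mem; exists 1%g; exact: char1.
have N0 : (0 < N)%N by rewrite /N /set_card cardfs_gt0; apply/fset0Pn; exists 1.
have fN x : f x ^+ N = 1.
  (* Multiplication by [f x] permutes the image, hence multiplies the product of its elements by
     f(x)^N without changing it. *)
  have pm : perm_eq [seq f x * y | y <- rs] rs.
    apply: uniq_perm => //.
      rewrite map_inj_uniq // => y y'; apply: mulfI; exact: char_neq0.
    move=> y; apply/mapP/idP => [[y' /mem [x' <-] ->]|/mem [x' <-]].
      by apply/mem; exists (x * x')%g; exact: charM.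
    exists (f (x^-1 * x')%g); first by apply/mem; exists (x^-1 * x')%g.
    by rewrite -(charM fch) mulgA mulgV mul1g.
  have p0 : \prod_(y <- rs) y != 0.
    rewrite prodf_seq_neq0; apply/allP => y /mem [x' <-] /=.
    exact: char_neq0.
  apply: (mulIf p0); rewrite mul1r -[RHS](perm_big _ pm) big_map /=.
  by rewrite big_split /= big_const_seq count_predT iter_mulr_1.
have := @cyclic.has_prim_root _ N rs N0; case/(_ _ urs (leqnn _))/hasP.
  by apply/allP => y /mem [x <-]; apply/unity_rootP.
by move=> z /mem zf pz; exists z.
Qed.

End FiniteCharacters.

(** * Finite order of the diagonal characters *)

Section Torsion.
Context {L : groupType} {g n : nat} {a b : 'I_g -> L} {c : 'I_n -> L}.
Context {Phi : set (L -> L)} (act : surface_action a b c Phi).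
Context {K : fieldType} (f1 f2 : L -> K).
Hypotheses (ch1 : is_char f1) (ch2 : is_char f2).
Hypothesis fin : forall h : nat -> L -> L, (forall i, Phi (h i)) ->
  exists i j, (i < j)%N /\
    ((f1 \o h i =1 f1 \o h j /\ f2 \o h i =1 f2 \o h j) \/
     (f1 \o h i =1 f2 \o h j /\ f2 \o h i =1 f1 \o h j)).

Definition torsion x := exists2 M, (0 < M)%N & f1 x ^+ M = 1 /\ f2 x ^+ M = 1.

Lemma torsionM x y : torsion x -> torsion y -> torsion (x * y)%g.
Proof.
move=> [M M0 [x1 x2]] [N N0 [y1 y2]]; exists (M * N)%N.
  by rewrite muln_gt0 M0.
have p (f : L -> K) : is_char f -> f x ^+ M = 1 -> f y ^+ N = 1 ->
    f (x * y)%g ^+ (M * N) = 1.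
  by move=> fch xM yN; rewrite charM // exprMn exprM xM mulnC exprM yN !expr1n mulr1.
by split; exact: p.
Qed.

Lemma torsionV x : torsion x -> torsion x^-1%g.
Proof.
move=> [M M0 [x1 x2]]; exists M => //.
by rewrite !charV // !exprVn x1 x2 invr1.
Qed.

Lemma torsion1 : torsion 1%g.
Proof. by exists 1%N => //; rewrite !char1. Qed.

(* In the case where [f1] and [f2] are exchanged, their values at [y] coincide, *)
(* and multiplying the two equations at [x] eliminates [f1 x] and [f2 x]. *)
Lemma torsion_shear h x y : Phi h ->
  (forall f : L -> K, is_char f -> f (h x) = f x * f y /\ f (h y) = f y) ->
  torsion y.
Proof.
move=> Ph hxy; have Pi i : Phi (iter i (fun u => h \o u) id).
  elim: i => [|i IH]; first exact: action_id act.
  exact: (action_comp act).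
have iterE (f : L -> K) i : is_char f ->
    f (iter i (fun u => h \o u) id x) = f x * f y ^+ i /\
    f (iter i (fun u => h \o u) id y) = f y.
  elim: i f => [|i IH] f fch; first by rewrite mulr1.
  have [E1 E2] := IH _ (char_phi act fch Ph).
  have [F1 F2] := hxy f fch; rewrite /= in E1 E2.
  by rewrite iterS /= E1 E2 F1 F2 exprS mulrA.
have y0 (f : L -> K) m : is_char f -> f y ^+ m != 0.
  by move=> fch; rewrite expf_neq0 // char_neq0.
have [i [j [ij E]]] := fin Pi; exists (2 * (j - i))%N; first by lia.
have pow (f : L -> K) : is_char f -> f y ^+ (2 * i) = f y ^+ (2 * j) ->
    f y ^+ (2 * (j - i)) = 1.
  move=> fch e; apply: (mulIf (y0 f (2 * i)%N fch)).
  by rewrite -exprD mul1r e -mulnDr subnK // ltnW.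
case: E => -[E1 E2].
  have F1 := E1 x; have F2 := E2 x; rewrite /= in F1 F2.
  have [e1 _] := iterE f1 i ch1; have [e2 _] := iterE f1 j ch1.
  have [e3 _] := iterE f2 i ch2; have [e4 _] := iterE f2 j ch2.
  rewrite e1 e2 in F1; rewrite e3 e4 in F2.
  move: F1 F2 => /(mulfI (char_neq0 ch1 x)) F1 /(mulfI (char_neq0 ch2 x)) F2.
  by split; apply: pow => //; rewrite !(mulnC 2) !exprM ?F1 ?F2.
have F1 := E1 x; have F2 := E2 x; have G := E1 y; rewrite /= in F1 F2 G.
have [e1 e1'] := iterE f1 i ch1; have [e2 e2'] := iterE f1 j ch1.
have [e3 e3'] := iterE f2 i ch2; have [e4 e4'] := iterE f2 j ch2.
rewrite e1 e4 in F1; rewrite e3 e2 in F2; rewrite e1' e4' in G.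
have P : f1 y ^+ (2 * i) = f1 y ^+ (2 * j).
  have x0 : f1 x * f2 x != 0 by rewrite mulf_neq0 ?char_neq0.
  apply: (mulfI x0); rewrite !mul2n -!addnn !exprD.
  have -> : f1 x * f2 x * (f1 y ^+ i * f1 y ^+ i) =
    (f1 x * f1 y ^+ i) * (f2 x * f2 y ^+ i) by rewrite G; ring.
  by rewrite F1 F2 G; ring.
split; apply: pow => //.
by rewrite -G.
Qed.

(** Handle generators and inverses of peripheral products all occur as multipliers of shears, so
    [torsion_shear] applies; each gamma is a quotient of consecutive peripheral products. *)
Lemma torsion_all (m : 'I_g) : m.+1 = g -> forall x, torsion x.
Proof.
move=> mg.
have ta k : torsion (a k).
  have [h [Ph ha hb _]] := beta_moveX act k 1.
  apply: (@torsion_shear h (b k)) => // f fch.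
  by rewrite [h (b k)]hb [h (a k)]ha /= eqxx expg1 charM.
have tb k : torsion (b k).
  have [h [Ph ha hb _]] := alpha_moveX act k 1.
  apply: (@torsion_shear h (a k)) => // f fch.
  by rewrite [h (b k)]hb [h (a k)]ha /= eqxx expg1 charM.
have tP (k : 'I_n) : torsion (peripheral (c := c) k).
  have := ltn_ord k; rewrite leq_eqVlt => /orP [/eqP kn|kn].
    by exists 1%N => //; rewrite !(char_peripheral_last act).
  rewrite -[peripheral k]invgK; apply: torsionV.
  (* Combined with the inverse alpha twist, [xi] divides the value at [a m] by that of the
     peripheral product, the factor of [b m] cancelling. *)
  have [h1 [Ph1 h1a h1b _]] := xi_move act mg kn.
  have [h2 [Ph2 h2a h2b h2c]] := alpha_moveV act m 1.
  have Ph := action_comp act Ph1 Ph2.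
  apply: (@torsion_shear (h1 \o h2) (a m)) => // f fch.
  have fch1 := char_phi act fch Ph1.
  split; last first.
    have fchh := char_phi act fch Ph.
    rewrite (charV fch) -[LHS]/((f \o (h1 \o h2)) _) (charV fchh) /=.
    by rewrite (char_phi_peripheral act k fch Ph).
  rewrite /= [h2 _]h2a /= eqxx expg1 -[LHS]/((f \o h1) _) (charM fch1).
  rewrite (charV fch1) /= [h1 (a m)]h1a [h1 (b m)]h1b /= eqxx.
  have : f (xi b c m k) = f (b m) / f (peripheral (c := c) k).
    by rewrite (charM fch) (charV fch) mulrC.
  move: (xi b c m k) => Z fZ; rewrite !(charM fch) !(charV fch) fZ.
  by field; rewrite !(char_neq0 fch).
have tc i : torsion (c i).
  case: i => -[|i] ni.
    have := tP (Ordinal ni); rewrite /peripheral (big_pred1 (Ordinal ni)) //.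
    by move=> j; rewrite /= leqn0; apply/eqP/eqP => [?|-> //]; exact: val_inj.
  have := torsionM (torsionV (tP (Ordinal (ltnW ni)))) (tP (Ordinal ni)).
  rewrite (@peripheralS _ _ _ (Ordinal (ltnW ni)) (Ordinal ni)) //.
  by rewrite mulgA mulVg mul1g.
apply: (action_ind act) => //.
- exact: torsion1.
- exact: torsionM.
- exact: torsionV.
Qed.

Lemma common_exponent (I : finType) (F : I -> L) : (forall i, torsion (F i)) ->
  exists2 M, (0 < M)%N & forall i, f1 (F i) ^+ M = 1 /\ f2 (F i) ^+ M = 1.
Proof.
move=> tF; have [M ME] := choice (fun i => match tF i with
  ex_intro2 M M0 E => ex_intro (fun M => (0 < M)%N /\ f1 (F i) ^+ M = 1
    /\ f2 (F i) ^+ M = 1) M (conj M0 E) end).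
exists (\prod_i M i)%N; first by apply: prodn_gt0 => i; have [] := ME i.
move=> i; have [_ [E1 E2]] := ME i.
by rewrite (bigD1 i) //= !exprM E1 E2 !expr1n.
Qed.

Lemma torsion_exponent (m : 'I_g) : m.+1 = g ->
  exists2 M, (0 < M)%N & forall x, f1 x ^+ M = 1 /\ f2 x ^+ M = 1.
Proof.
move=> mg; have tor := torsion_all mg.
have [A A0 AE] := common_exponent (fun i => tor (a i)).
have [B B0 BE] := common_exponent (fun i => tor (b i)).
have [C C0 CE] := common_exponent (fun i => tor (c i)).
exists (A * B * C)%N; first by rewrite !muln_gt0 A0 B0.
apply: (action_ind act) => [i|i|i||x y [x1 x2] [y1 y2]|x [x1 x2]].
- by have [E1 E2] := AE i; rewrite -mulnA !(exprM _ A) E1 E2 !expr1n.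
- have [E1 E2] := BE i.
  by rewrite (mulnC A) -mulnA !(exprM _ B) E1 E2 !expr1n.
- have [E1 E2] := CE i.
  by rewrite mulnC !(exprM _ C) E1 E2 !expr1n.
- by rewrite !char1 // !expr1n.
- by rewrite !charM // !exprMn x1 x2 y1 y2 mulr1.
- by rewrite !charV // !exprVn x1 x2 invr1.
Qed.

End Torsion.

Lemma finite_unity (K : closedFieldType) M : (0 < M)%N ->
  finite_set [set x : K | x ^+ M = 1].
Proof.
move=> M0; have [r rE] := closed_field_poly_normal ('X^M - 1 : {poly K}).
apply: (@sub_finite_set _ _ [set` r]); last exact: finite_seq.
move=> x /= xM; have : root ('X^M - 1) x.
  by rewrite rootE !hornerE xM subrr.
by rewrite rE (monicP (monicXnsubC _ M0)) scale1r root_prod_XsubC.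
Qed.

Section Homs.
Context {R : realType} {L : groupType}.
Local Notation K := R[i].

Lemma hom_char (lam : {multiplicative L -> Cstar R}) :
  is_char (fun x => units_val (lam x)).
Proof. by split=> [|x y]; rewrite ?multiplicative1 ?gmulfM. Qed.

Lemma char_hom (f : L -> K) : is_char f ->
  exists lam : {multiplicative L -> Cstar R}, forall x, units_val (lam x) = f x.
Proof.
move=> fch.
have fu x : f x \is a GRing.unit by rewrite unitfE; exact: char_neq0.
pose lam x : Cstar R := Units (fu x).
have lamM : {morph lam : x y / (x * y)%g}.
  by move=> x y; apply: val_inj; rewrite /= (charM fch).
pose lam' : {multiplicative L -> Cstar R} :=
  HB.pack lam (isMultiplicative.Build _ _ lam lamM).
by exists lam'.
Qed.

Lemma range_units (lam : L -> Cstar R) :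
  finite_set (range (fun x => units_val (lam x))) <-> finite_set (range lam).
Proof.
have E : range (fun x => units_val (lam x)) = units_val @` range lam.
  by rewrite image_comp.
rewrite E; split=> [fin|]; last exact: finite_image.
apply: sub_finite_set (finite_preimage _ fin); first exact: preimage_image.
by move=> x y _ _; exact: val_inj.
Qed.

Lemma set_card_units (lam : L -> Cstar R) : finite_set (range lam) ->
  set_card (range (fun x => units_val (lam x))) = set_card (range lam).
Proof.
move=> fin; rewrite /set_card.
have -> : range (fun x => units_val (lam x)) = units_val @` range lam.
  by rewrite image_comp.
rewrite fset_set_image // card_imfset //; exact: val_inj.
Qed.

Lemma GL2_eq (p q : GL2 R) : units_val p = units_val q -> p = q.
Proof. exact: val_inj. Qed.

Lemma triangular_conj_inv (rho rho' : L -> GL2 R) p p' l chi chi' tau tau' :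
  triangular rho p l chi tau -> triangular rho' p' l chi' tau' ->
  affine_conj chi tau chi' tau' ->
  exists q, forall x, rho' x = (q * rho x * q^-1)%g.
Proof.
move=> tr tr' [cc [s [w [s0 E]]]].
have Pu : mx2 s w 0 1 \is a GRing.unit by rewrite mx2_unit mulr1 mulr0 subr0.
pose P : GL2 R := Units Pu.
exists (p'^-1 * P * p)%g => x.
have PE : (P * (p * rho x * p^-1) = (p' * rho' x * p'^-1) * P)%g.
  apply: GL2_eq; rewrite GL2_valM tr [RHS]GL2_valM tr' /= !mx2M.
  by congr mx2; rewrite ?E -?cc; ring.
have -> : (p'^-1 * P * p * rho x * (p'^-1 * P * p)^-1 =
   p'^-1 * (P * (p * rho x * p^-1)) * P^-1 * p')%g.
  by rewrite !invgM invgK !mulgA.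
by rewrite PE !mulgA mulVg mul1g mulgK mulgVK.
Qed.

End Homs.

Section Reducible.
Context {R : realType} {n : nat} {X : punctured_surface R n}.
Local Notation K := R[i].

Lemma reducible_triangular (rho : {multiplicative Lambda X -> GL2 R}) :
  reducible rho -> exists p l chi tau,
  [/\ is_char l, is_cocycle chi tau & triangular rho p l chi tau].
Proof.
move=> [v v0 inv].
have [q qv] : exists q : GL2 R, units_val q *m delta_mx 0 0 = v.
  case: (eqVneq (v 0 0) 0) => v00.
    have v10 : v 1 0 != 0.
      apply: contraNneq v0 => v10; apply/eqP/matrixP => i j.
      by rewrite !mxE (ord1 j); have [->|->] := ord2P i.
    have u : mx2 (v 0 0) 1 (v 1 0) 0 \is a GRing.unit.
      by rewrite mx2_unit mulr0 sub0r mul1r oppr_eq0.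
    exists (Units u); apply/matrixP => i j; rewrite (ord1 j) mxE big_ord_recl big_ord1.
    rewrite !mxE /= mulr1 mulr0 addr0.
    by have [->|->] := ord2P i.
  have u : mx2 (v 0 0) 0 (v 1 0) 1 \is a GRing.unit.
    by rewrite mx2_unit mulr1 mul0r subr0.
  exists (Units u); apply/matrixP => i j; rewrite (ord1 j) mxE big_ord_recl big_ord1.
  rewrite !mxE /= mulr1 mulr0 addr0.
  by have [->|->] := ord2P i.
pose M x := units_val (q^-1 * rho x * q)%g.
have M10 x : M x 1 0 = 0.
  have [k kE] := inv x.
  have : M x *m delta_mx 0 0 = k *: (delta_mx 0 0 : 'cV[K]_2).
    have -> : M x *m delta_mx 0 0 = units_val (q^-1)%g *m (units_val (rho x) *m v).
      by rewrite -qv !mulmxA.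
    rewrite kE -scalemxAr -qv mulmxA.
    have -> : units_val (q^-1)%g *m units_val q = 1%:M.
      by rewrite [LHS](_ : _ = units_val (q^-1 * q)%g) // mulVg.
    by rewrite mul1mx.
  move=> /matrixP /(_ 1 0); rewrite !mxE big_ord_recl big_ord1 !mxE /=.
  by rewrite mulr0 mulr1 mulr0 addr0.
have E x : units_val (q^-1 * rho x * (q^-1)^-1)%g =
    mx2 (M x 0 0) (M x 0 1) 0 (M x 1 1).
  by rewrite invgK -[units_val _]/(M x) -(M10 x) -mx2_eq.
have [l [chi [tau [lch coc tr]]]] := triangular_chars E.
by exists (q^-1)%g, l, chi, tau.
Qed.

Lemma direct_sum_triangular (rho : Lambda X -> GL2 R)
    (lam1 lam2 : {multiplicative Lambda X -> Cstar R}) :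
  is_direct_sum rho lam1 lam2 -> exists p,
  triangular rho p (fun x => units_val (lam2 x))
    (fun x => units_val (lam1 x) / units_val (lam2 x)) (fun=> 0).
Proof.
move=> [p pE]; exists p => x; rewrite pE mulr0; congr mx2.
by rewrite mulrC mulfVK // (char_neq0 (hom_char lam2)).
Qed.

(** The translation by [- w] carries the common fixed point to 0, after which all matrices are
    diagonal. *)
Lemma split_direct_sum (rho : Lambda X -> GL2 R) p l chi tau w :
  is_char l -> is_char chi ->
  triangular rho p l chi tau -> (forall x, tau x = (1 - chi x) * w) ->
  exists lam1 lam2 : {multiplicative Lambda X -> Cstar R},
    [/\ (forall x, units_val (lam1 x) = l x * chi x),
        (forall x, units_val (lam2 x) = l x) & is_direct_sum rho lam1 lam2].
Proof.
move=> lch cch tr sp.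
have lcch : is_char (fun x => l x * chi x).
  by split=> [|x y]; rewrite ?(char1 lch) ?(char1 cch) ?mulr1 // !charM //; ring.
have [lam1 E1] := char_hom lcch; have [lam2 E2] := char_hom lch.
exists lam1, lam2; split=> //.
have Pu : mx2 1 (- w) 0 1 \is a GRing.unit.
  by rewrite mx2_unit mulr1 mulr0 subr0 oner_eq0.
pose P : GL2 R := Units Pu.
exists (P * p)%g => x; rewrite E1 E2.
have -> : (P * p * rho x * (P * p)^-1 = P * (p * rho x * p^-1) * P^-1)%g.
  by rewrite invgM !mulgA.
rewrite 2!GL2_valM tr; apply: (mulIr (unitsP P)); rewrite divrK ?(unitsP P) //.
by rewrite /= !mx2M; congr mx2; rewrite ?sp; ring.
Qed.

End Reducible.

(** * The shape of a representation with finite orbit *)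

Section FiniteImpliesForm.
Context {R : realType} {g n : nat} {X : punctured_surface R n}.
Context {alpha beta : 'I_g -> Lambda X} {gamma : 'I_n -> Lambda X}.
Hypothesis act : surface_action alpha beta gamma (@pure_push R n X).
Local Notation K := R[i].
Local Notation Phi := (@pure_push R n X).

Lemma cocycle_hom (chi tau : Lambda X -> K) : is_cocycle chi tau ->
  exists rho : {multiplicative Lambda X -> GL2 R},
    forall x, units_val (rho x) = mx2 (chi x) (tau x) 0 1.
Proof.
move=> coc.
have ru x : mx2 (chi x) (tau x) 0 1 \is a GRing.unit.
  by rewrite mx2_unit mulr0 subr0 mulr1; exact: (char_neq0 coc.1).
pose r x : GL2 R := Units (ru x).
have rM : {morph r : x y / (x * y)%g}.
  move=> x y; apply: GL2_eq; rewrite /= mx2M (charM coc.1) (cocycleM coc).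
  by congr mx2; ring.
pose r' : {multiplicative Lambda X -> GL2 R} :=
  HB.pack r (isMultiplicative.Build _ _ r rM).
by exists r'.
Qed.

Lemma twist_triangular (lam : Lambda X -> Cstar R) (rho : Lambda X -> GL2 R)
    (chi tau : Lambda X -> K) :
  (forall x, units_val (rho x) = mx2 (chi x) (tau x) 0 1) ->
  triangular (twist lam rho) 1%g (fun x => units_val (lam x)) chi tau.
Proof.
move=> E x; rewrite mul1g invg1 mulg1 /= E.
by apply: matrix2P; rewrite !mxE //= ?mulr0 ?mulr1.
Qed.

(** This is the surface relation evaluated by [tau]. It explains why the translation of beta_1 is
    tied to the sum of the c_i in rho_(mu,c). *)
Lemma cocycle_relation (chi tau : Lambda X -> K) (m : 'I_g) :
  is_cocycle chi tau -> g = 1%N -> chi (beta m) = 1 ->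
  (forall i, chi (gamma i) = 1) ->
  \sum_i tau (gamma i) = (1 - chi (alpha m)) * tau (beta m).
Proof.
move=> coc g1 bm1 c1.
have sumE (s : seq 'I_n) : tau (\prod_(i <- s) gamma i)%g =
    \sum_(i <- s) tau (gamma i).
  elim: s => [|i s IH]; first by rewrite !big_nil (cocycle1 coc).
  by rewrite !big_cons (cocycleM coc) c1 mul1r IH.
have := congr1 tau (action_rel act); rewrite (cocycle1 coc) (cocycleM coc).
have -> : (\prod_(i < g) (alpha i * beta i * (alpha i)^-1 * (beta i)^-1) =
    alpha m * beta m * (alpha m)^-1 * (beta m)^-1)%g.
  by apply: big_pred1 => i; apply/esym/eqP/val_inj => /=;
     have := ltn_ord i; have := ltn_ord m; lia.
rewrite sumE !(cocycleM coc) !(cocycleV coc) !(charM coc.1) !(charV coc.1).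
have a0 := char_neq0 coc.1 (alpha m).
rewrite bm1 => E; apply/eqP; rewrite -subr_eq0 -[X in _ == X]E; apply/eqP.
by field.
Qed.

Lemma orbit_conj (rho : Lambda X -> GL2 R) (h : nat -> Lambda X -> Lambda X) :
  finite_set (pure_orbit rho) -> (forall i, Phi (h i)) ->
  exists i j, (i < j)%N /\
    exists q, forall x, rho (h j x) = (q * rho (h i x) * q^-1)%g.
Proof.
rewrite pure_orbitE => fin Ph.
have [|i [j [ij E]]] := finite_pigeonhole (u := fun i => conj_class (rho \o h i)) fin.
  by move=> i; exists (h i).
by exists i, j; split=> //; move/conj_class_eq: E.
Qed.

Lemma finite_orbit_form (rho : {multiplicative Lambda X -> GL2 R}) :
  (0 < g)%N -> reducible rho -> finite_set (pure_orbit rho) ->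
  (exists lambda1 lambda2 : {multiplicative Lambda X -> Cstar R},
        [/\ finite_set (range lambda1), finite_set (range lambda2) &
            is_direct_sum rho lambda1 lambda2])
     \/
     [/\ g = 1%N, (0 < n)%N &
       exists (N : nat) (mu : R[i]) (c : 'I_n -> R[i])
         (lambda : {multiplicative Lambda X -> Cstar R})
         (rho0 : {multiplicative Lambda X -> GL2 R}),
         [/\ (0 < N)%N /\ N.-unity_root mu, mu != 1 /\ \sum_i c i = 1,
             finite_set (range lambda),
             is_rho_mu_c alpha beta gamma mu c rho0 &
             pure_orbit (twist lambda rho0) (conj_class rho)]].
Proof.
move=> g0 /reducible_triangular [p [l [chi [tau [lch coc tr]]]]] fin.
have gm : (g.-1 < g)%N by lia.
pose m := Ordinal gm; have mg : m.+1 = g by rewrite /= prednK.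
have lcch : is_char (fun x => l x * chi x).
  split=> [|x y]; first by rewrite (char1 lch) (char1 coc.1) mulr1.
  by rewrite (charM lch) (charM coc.1); ring.
have alt (h : nat -> Lambda X -> Lambda X) (Ph : forall i, Phi (h i)) :
    exists i j, (i < j)%N /\ (l \o h i =1 l \o h j /\
      affine_conj (chi \o h i) (tau \o h i) (chi \o h j) (tau \o h j) \/
    [/\ (forall x, l (h j x) = l (h i x) * chi (h i x)),
        (forall x, l (h i x) = l (h j x) * chi (h j x)) &
      exists w, forall x, tau (h i x) = (1 - chi (h i x)) * w]).
  have [i [j [ij cj]]] := orbit_conj fin Ph; exists i, j; split=> //.
  apply: (triangular_conj _ _ _ _ (triangular_comp (h i) tr)
    (triangular_comp (h j) tr) cj); apply: (char_phi act) => //; exact: coc.1.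
have [M M0 ME] : exists2 M, (0 < M)%N &
    forall x, (l x * chi x) ^+ M = 1 /\ l x ^+ M = 1.
  apply: (torsion_exponent act lcch lch _ mg) => h Ph.
  have [i [j [ij [[E [F _]]|[E F _]]]]] := alt h Ph; exists i, j; split=> //.
    left; split=> // x; have := E x; have := F x; rewrite /= => -> -> //.
  by right; split=> x /=.
have finM (f : Lambda X -> K) : (forall x, f x ^+ M = 1) -> finite_set (range f).
  move=> fM; apply: sub_finite_set (finite_unity _ M0).
  by move=> _ [x _ <-]; exact: fM.
case: (pselect (exists w, forall x, tau x = (1 - chi x) * w)) => [[w sp]|ns].
  left; have [lam1 [lam2 [E1 E2 ds]]] := split_direct_sum lch coc.1 tr sp.
  exists lam1, lam2; split=> //; apply/range_units/finM => x.
    by rewrite E1; have [] := ME x.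
  by rewrite E2; have [] := ME x.
right.
have chiM x : chi x ^+ M = 1.
  by have [] := ME x; rewrite exprMn => + E; rewrite E mul1r.
have ns' : nonsplit chi tau by move=> w sp; apply: ns; exists w.
(* Non-splitness rules out the exchange of the diagonal characters, so the pigeonhole principle
   always yields an affine conjugation. *)
have gd : good (Phi := Phi) chi tau.
  split=> // h Ph; have [i [j [ij [[_ E]|[_ _ [w sp]]]]]] := alt h Ph.
    by exists i, j.
  by have := nonsplit_phi act ns' (Ph i) sp.
have [z [pz zN zx]] := finite_char_prim coc.1 (finM _ chiM).
have [h Ph sp] := exists_special act mg gd pz zN zx.
have gdh := good_phi act gd Ph.
have g1 := special_genus act mg gdh sp.
have c1 i := special_c act i gdh sp.
have [coch _ _] := gdh.
have [_ am1 bm1 y0] := sp; rewrite /= in am1 bm1 y0 c1.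
have S := cocycle_relation coch g1 bm1 c1; rewrite /= in S.
set sg := \sum_i tau (h (gamma i)) in S.
have mu1 : 1 - chi (h (alpha m)) != 0 by rewrite subr_eq0 eq_sym.
have sg0 : sg != 0 by rewrite S mulf_neq0.
have n0 : (0 < n)%N.
  rewrite lt0n; apply: contraNneq sg0 => n0; apply/eqP/big1 => i.
  by have := ltn_ord i; lia.
split=> //.
(* Division by [sg] makes the translations at the punctures sum to 1, and [w] is the shift that
   makes the image of alpha_1 diagonal. *)
pose mu := chi (h (alpha m)); pose w := - (sg^-1 * tau (h (alpha m)) / (1 - mu)).
pose tau0 x := sg^-1 * tau (h x) + (1 - chi (h x)) * w.
have coc0 : is_cocycle (chi \o h) tau0.
  split=> [|x y]; first exact: coch.1.
  rewrite /tau0 -[chi (h (_ * _)%g)]/((chi \o h) _) -[tau (h (_ * _)%g)]/((tau \o h) _).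
  by rewrite (charM coch.1) (cocycleM coch) /=; ring.
have [rho0 rho0E] := cocycle_hom coc0.
have [lam lamE] := char_hom (char_phi act lch Ph).
(* [M] is a common exponent; it may be larger than the order of [mu]. *)
exists M, mu, (fun i => sg^-1 * tau (h (gamma i))), lam, rho0.
have km (k : 'I_g) : k = m by apply: val_inj => /=; have := ltn_ord k; lia.
split.
- by split=> //; apply/unity_rootP; exact: chiM.
- by split=> //; rewrite -mulr_sumr mulVf.
- by apply/range_units/finM => x; rewrite lamE; have [] := ME (h x).
- split=> [k|k|i]; rewrite rho0E ?(km k) /tau0 /=; congr mx2 => //.
  + by rewrite /w -/mu; field; rewrite mu1.
  + rewrite bm1 subrr mul0r addr0 S -/mu; field.
    by rewrite y0 mu1 subr_eq0 am1.
  + by rewrite c1 subrr mul0r addr0.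
have trt : triangular (twist lam rho0) 1%g (l \o h) (chi \o h) tau0.
  move=> x; have := twist_triangular lam rho0E x.
  by rewrite lamE.
have [q qE] : exists q, forall x, (rho \o h) x = (q * twist lam rho0 x * q^-1)%g.
  apply: (triangular_conj_inv trt (triangular_comp h tr)); split=> //.
  exists sg, (- (sg * w)); split=> // x; rewrite /tau0 /=.
  by field.
have [h' [Ph' hh' _]] := action_invP act Ph.
rewrite pure_orbitE; exists h' => //; apply/conj_class_eq.
by exists q => x /=; rewrite -qE /= hh'.
Qed.

End FiniteImpliesForm.

(** * Cardinality estimates *)

Section CharacterEstimates.
Context {R : realType} {g n : nat} {X : punctured_surface R n}.
Context {alpha beta : 'I_g -> Lambda X} {gamma : 'I_n -> Lambda X}.
Hypothesis act : surface_action alpha beta gamma (@pure_push R n X).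
Local Notation K := R[i].
Local Notation Phi := (@pure_push R n X).

(** Both characters keep their values at the punctures, so an element of the orbit is determined by
    its 2g values on the handles, all of which lie in the image of [rho]. *)
Lemma direct_sum_upper (rho : {multiplicative Lambda X -> GL2 R})
    (lam1 lam2 : {multiplicative Lambda X -> Cstar R}) :
  finite_set (range lam1) -> finite_set (range lam2) ->
  is_direct_sum rho lam1 lam2 ->
  finite_set (pure_orbit rho) /\
  (set_card (pure_orbit rho) <= set_card (range rho) ^ (2 * g))%N.
Proof.
move=> fin1 fin2 [p pE].
have rhoE x y : lam1 x = lam1 y -> lam2 x = lam2 y -> rho x = rho y.
  move=> E1 E2; have : (p * rho x * p^-1 = p * rho y * p^-1)%g.
    by apply: GL2_eq; rewrite !pE E1 E2.
  by move=> /mulIg /mulgI.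
have lamE x y : rho x = rho y -> lam1 x = lam1 y /\ lam2 x = lam2 y.
  move=> E; have := pE x; rewrite E pE => /mx2_inj [E1 _ _ E2].
  by split; apply: val_inj.
have fin : finite_set (range rho).
  pose A := fset_set (range lam1); pose B := fset_set (range lam2).
  have [||//] := @set_card_le _ (range rho) (A * B)%type
      (fun r d => exists x, [/\ r = rho x, val d.1 = lam1 x & val d.2 = lam2 x]).
    move=> _ [x _ <-].
    have xA : lam1 x \in A by rewrite in_fset_set // inE; exists x.
    have xB : lam2 x \in B by rewrite in_fset_set // inE; exists x.
    by exists ([` xA]%fset, [` xB]%fset), x.
  move=> r r' d _ _ [x [-> E1 E2]] [y [-> E1' E2']].
  by apply: rhoE; rewrite -?E1 -?E2 ?E1' ?E2'.
pose A := fset_set (range rho).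
have mem x : rho x \in A by rewrite in_fset_set // inE; exists x.
have cardA : #|{ffun 'I_g * bool -> A}| = (set_card (range rho) ^ (2 * g))%N.
  by rewrite card_ffun card_prod card_ord card_bool -cardfE mulnC.
rewrite -cardA pure_orbitE.
apply: (set_card_le (rel := fun C (d : {ffun 'I_g * bool -> A}) =>
  exists2 f, Phi f & [/\ C = conj_class (rho \o f),
    (forall i, val (d (i, false)) = rho (f (alpha i))) &
    (forall i, val (d (i, true)) = rho (f (beta i)))])).
  move=> _ [f Pf <-].
  exists [ffun i => if i.2 then [` mem (f (beta i.1))]%fset
                    else [` mem (f (alpha i.1))]%fset].
  by exists f => //; split=> // i; rewrite ffunE.
move=> C C' d _ _ [f Pf [-> fa fb]] [f' Pf' [-> fa' fb']].
congr conj_class; apply/funext => x /=.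
have E (lam : {multiplicative Lambda X -> Cstar R}) :
    (forall x y, rho x = rho y -> lam x = lam y) -> lam (f x) = lam (f' x).
  move=> lr; have lch := hom_char lam; apply: val_inj => /=.
  apply: (char_eq act (char_phi act lch Pf) (char_phi act lch Pf')) => i.
  - by congr units_val; apply: lr; rewrite -fa fa'.
  - by congr units_val; apply: lr; rewrite -fb fb'.
  - by rewrite /= (char_phi_c act i lch Pf) (char_phi_c act i lch Pf').
by apply: rhoE; apply: E => y y' /lamE [].
Qed.

Section Lower.
Variables (rho : Lambda X -> GL2 R) (f f' : Lambda X -> K) (m : 'I_g).
Hypotheses (fch : is_char f) (ffin : finite_set (range f)) (mg : m.+1 = g).
Hypothesis finS : finite_set (pure_orbit rho).
Local Notation N := (set_card (range f)).

(** The excluded loop is alpha of the last handle, where a primitive value is kept so that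
    [char_orbit] applies; this explains the exponent 2g - 1. *)
Definition free_index := {x : 'I_g * bool | x != (m, false)}.

Lemma card_free_index : #|{: free_index}| = (2 * g - 1)%N.
Proof.
rewrite card_sig; have := cardC1 (m, false).
by rewrite card_prod card_ord card_bool mulnC -subn1.
Qed.

Definition realizes_values (d : {ffun free_index -> 'I_N}) z
    (h : Lambda X -> Lambda X) := forall i : free_index,
  f (h (if (val i).2 then beta (val i).1 else alpha (val i).1)) = z ^+ d i.

Lemma exists_values z (d : {ffun free_index -> 'I_N}) :
  N.-primitive_root z -> (forall x, f x ^+ N = 1) -> (exists x, f x = z) ->
  exists2 h, Phi h & realizes_values d z h.
Proof.
move=> pz fN fz; have zN := prim_expr_order pz.
(* The default [z] is used only at the excluded loop. *)
pose u b (i : 'I_g) := if insub (i, b) is Some k then z ^+ d k else z.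
have uN b i : u b i ^+ N = 1.
  by rewrite /u; case: insub => // k; exact: unityX.
have um : u false m = z by rewrite /u insubF //= eqxx.
have pu : N.-primitive_root (u false m) \/ N.-primitive_root (u true m).
  by left; rewrite um.
have [h Ph [ha hb]] := char_orbit act pz fch fN fz mg (uN false) (uN true) pu.
exists h => // -[[i b] ib] /=.
have uE : u b i = z ^+ d (exist _ (i, b) ib) by rewrite /u (insubT (fun x => x != (m, false)) ib).
by rewrite -uE; case: b {ib uE}; [exact: hb|exact: ha].
Qed.

Lemma values_inj z d d' h h' : N.-primitive_root z ->
  realizes_values d z h -> realizes_values d' z h' -> f \o h =1 f \o h' ->
  d = d'.
Proof.
move=> pz dh dh' E; apply/ffunP => i; apply: val_inj => /=.
apply/eqP; have := eq_prim_root_expr pz (d i) (d' i).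
rewrite -dh -dh' [f (h _)]E eqxx => /esym.
by rewrite !modn_small.
Qed.

Lemma char_lower1 :
  (forall h h', Phi h -> Phi h' ->
    (exists q, forall x, rho (h' x) = (q * rho (h x) * q^-1)%g) ->
    f \o h =1 f \o h') ->
  (N ^ (2 * g - 1) <= set_card (pure_orbit rho))%N.
Proof.
move=> inv; have [z [pz fN fz]] := finite_char_prim fch ffin.
have -> : (N ^ (2 * g - 1))%N = #|{ffun free_index -> 'I_N}|.
  by rewrite card_ffun card_free_index card_ord.
apply: (set_card_ge (rel := fun d C => exists2 h, Phi h &
  C = conj_class (rho \o h) /\ realizes_values d z h)) => // [d|d d' C _].
  have [h Ph dh] := exists_values d pz fN fz.
  exists (conj_class (rho \o h)); last by exists h.
  by rewrite pure_orbitE; exists h.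
move=> [h Ph [-> dh]] [h' Ph' [/conj_class_eq E dh']].
by apply: (values_inj pz dh dh'); exact: inv.
Qed.

(* The bit records whether [f \o h] is the character chosen for the class. *)
Lemma char_lower2 :
  (forall h h', Phi h -> Phi h' ->
    (exists q, forall x, rho (h' x) = (q * rho (h x) * q^-1)%g) ->
    f \o h =1 f \o h' \/ f \o h' =1 f' \o h) ->
  (N ^ (2 * g - 1) <= 2 * set_card (pure_orbit rho))%N.
Proof.
move=> inv; have [z [pz fN fz]] := finite_char_prim fch ffin.
have -> : (N ^ (2 * g - 1))%N = #|{ffun free_index -> 'I_N}|.
  by rewrite card_ffun card_free_index card_ord.
have exF (C : set (Lambda X -> GL2 R)) : exists h,
    pure_orbit rho C -> Phi h /\ C = conj_class (rho \o h).
  case: (pselect (pure_orbit rho C)) => [|nC]; last by exists id.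
  by rewrite pure_orbitE => -[h Ph <-]; exists h.
have [F FE] := choice exF.
pose S := fset_set (pure_orbit rho).
have -> : (2 * set_card (pure_orbit rho))%N = #|{: S * bool}|.
  by rewrite card_prod card_bool -cardfE mulnC.
pose rel (d : {ffun free_index -> 'I_N}) (s : S * bool) := exists2 h, Phi h &
  [/\ val s.1 = conj_class (rho \o h), realizes_values d z h &
      s.2 = `[< f \o h =1 f \o F (val s.1) >]].
have ex d : exists s, rel d s.
  have [h Ph dh] := exists_values d pz fN fz.
  have hS : conj_class (rho \o h) \in S.
    by rewrite in_fset_set // inE pure_orbitE; exists h.
  exists ([` hS]%fset, `[< f \o h =1 f \o F (conj_class (rho \o h)) >]).
  by exists h.
have [r rE] := choice ex.
apply: (@leq_card _ _ r) => d d' rdd.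
have [h Ph [hC dh hb]] := rE d; have [h' Ph' [hC' dh' hb']] := rE d'.
rewrite -rdd in hC' hb'; rewrite hb in hb'.
have SC : pure_orbit rho (val (r d).1) by rewrite hC pure_orbitE; exists h.
have [PF FC] := FE _ SC.
apply: (values_inj pz dh dh').
have E1 : exists q, forall x, rho (h x) = (q * rho (F (val (r d).1) x) * q^-1)%g.
  by apply/conj_class_eq; rewrite -FC -hC.
have E2 : exists q, forall x, rho (h' x) = (q * rho (F (val (r d).1) x) * q^-1)%g.
  by apply/conj_class_eq; rewrite -FC -hC'.
have [e1|e1] := inv _ _ PF Ph E1; have [e2|e2] := inv _ _ PF Ph' E2.
- by move=> x; rewrite -e1 -e2.
- have : `[< f \o h =1 f \o F (val (r d).1) >] by apply/asboolP => x; rewrite e1.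
  by rewrite hb' => /asboolP e3 x; rewrite e3 -e1.
- have : `[< f \o h' =1 f \o F (val (r d).1) >] by apply/asboolP => x; rewrite e2.
  by rewrite -hb' => /asboolP e3 x; rewrite e3 -e2.
- by move=> x; rewrite e1 e2.
Qed.

End Lower.

(** By [triangular_conj], conjugate elements of the orbit have the same two characters, possibly
    exchanged. A class thus carries at most two values of each of them, whence the factor 2. *)
Lemma direct_sum_lower (rho : {multiplicative Lambda X -> GL2 R})
    (lam1 lam2 : {multiplicative Lambda X -> Cstar R}) : (0 < g)%N ->
  finite_set (range lam1) -> finite_set (range lam2) ->
  is_direct_sum rho lam1 lam2 ->
  (set_card (range lam1) ^ (2 * g - 1) <= 2 * set_card (pure_orbit rho))%N /\
  (set_card (range lam2) ^ (2 * g - 1) <= 2 * set_card (pure_orbit rho))%N.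
Proof.
move=> g0 fin1 fin2 ds; have [p tr] := direct_sum_triangular ds.
have [finS _] := direct_sum_upper fin1 fin2 ds.
have gm : (g.-1 < g)%N by lia.
pose m := Ordinal gm; have mg : m.+1 = g by rewrite /= prednK.
set f1 := fun x => units_val (lam1 x); set f2 := fun x => units_val (lam2 x).
have ch1 : is_char f1 := hom_char lam1; have ch2 : is_char f2 := hom_char lam2.
have f2N x : f2 x != 0 by exact: char_neq0.
have qch : is_char (fun x => f1 x / f2 x).
  split=> [|x y]; first by rewrite (char1 ch1) (char1 ch2) divr1.
  by rewrite (charM ch1) (charM ch2) invfM mulrACA.
have inv h h' : Phi h -> Phi h' ->
    (exists q, forall x, rho (h' x) = (q * rho (h x) * q^-1)%g) ->
    (f1 \o h =1 f1 \o h' /\ f2 \o h =1 f2 \o h') \/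
    (f1 \o h' =1 f2 \o h /\ f2 \o h' =1 f1 \o h).
  move=> Ph Ph' cj.
  have := triangular_conj (char_phi act ch2 Ph) (char_phi act ch2 Ph')
    (char_phi act qch Ph) (char_phi act qch Ph')
    (triangular_comp h tr) (triangular_comp h' tr) cj.
  rewrite /= -/f1 -/f2; case=> [[E [F _]]|[E F _]]; [left|right]; split=> // x /=.
  - have /= := F x; have /= := E x; rewrite -/f1 -/f2 => ->.
    by move=> /divIf; apply.
  - by have := F x; rewrite mulrC mulfVK // => ->.
  - by have := E x; rewrite mulrC mulfVK // => ->.
rewrite -(set_card_units fin1) -(set_card_units fin2); split.
  apply: (char_lower2 (f' := f2) ch1 _ mg finS); first exact/range_units.
  by move=> h h' Ph Ph' /(inv h h' Ph Ph') [[]|[]]; [left|right].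
apply: (char_lower2 (f' := f1) ch2 _ mg finS); first exact/range_units.
by move=> h h' Ph Ph' /(inv h h' Ph Ph') [[]|[]]; [left|right].
Qed.

End CharacterEstimates.

(** * Genus one with translations at the punctures *)

Section UnipotentCase.
Context {R : realType} {g n : nat} {X : punctured_surface R n}.
Context {alpha beta : 'I_g -> Lambda X} {gamma : 'I_n -> Lambda X}.
Hypothesis act : surface_action alpha beta gamma (@pure_push R n X).
Local Notation K := R[i].
Local Notation Phi := (@pure_push R n X).
Variables (m : 'I_g) (mg : m.+1 = g) (g1 : g = 1%N).

Lemma handle1 (k : 'I_g) : k = m.
Proof. by apply: val_inj => /=; have := ltn_ord k; lia. Qed.

Lemma cocycle_eq (chi tau tau' : Lambda X -> K) :
  is_cocycle chi tau -> is_cocycle chi tau' ->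
  tau \o alpha =1 tau' \o alpha -> tau \o beta =1 tau' \o beta ->
  tau \o gamma =1 tau' \o gamma -> tau =1 tau'.
Proof.
move=> coc coc' ea eb ec; apply: (action_ind act) => // [|x y ex ey|x ex].
- by rewrite (cocycle1 coc) (cocycle1 coc').
- by rewrite (cocycleM coc) (cocycleM coc') ex ey.
- by rewrite (cocycleV coc) (cocycleV coc') ex.
Qed.

Lemma coboundary (chi : Lambda X -> K) w : is_char chi ->
  is_cocycle chi (fun x => (1 - chi x) * w).
Proof. by move=> cch; split=> // x y; rewrite (charM cch); ring. Qed.

(** The surface relation now says that the affine maps of alpha and beta commute. A fixed point of
    the one that is not a translation is then fixed by both, and trivially by the gammas. *)
Lemma cocycle_split (chi tau : Lambda X -> K) : is_cocycle chi tau ->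
  chi (alpha m) != 1 \/ chi (beta m) != 1 -> (forall i, chi (gamma i) = 1) ->
  (forall i, tau (gamma i) = 0) -> exists w, forall x, tau x = (1 - chi x) * w.
Proof.
move=> coc ab c1 c0; have a0 := char_neq0 coc.1 (alpha m).
have b0 := char_neq0 coc.1 (beta m).
have rel : (1 - chi (beta m)) * tau (alpha m) = (1 - chi (alpha m)) * tau (beta m).
  have := congr1 tau (action_rel act); rewrite (cocycle1 coc) (cocycleM coc).
  rewrite [tau (\prod_(j < n) _)%g](cocycle_prod0 coc) // mulr0 addr0.
  have -> : (\prod_(i < g) (alpha i * beta i * (alpha i)^-1 * (beta i)^-1) =
      alpha m * beta m * (alpha m)^-1 * (beta m)^-1)%g.
    by apply: big_pred1 => i; rewrite (handle1 i) /= eqxx.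
  rewrite !(cocycleM coc) !(cocycleV coc) !(charM coc.1) !(charV coc.1) => E.
  apply/eqP; rewrite -subr_eq0 -[X in _ == X]E; apply/eqP.
  by field; rewrite a0 b0.
have gens w : tau (alpha m) = (1 - chi (alpha m)) * w ->
    tau (beta m) = (1 - chi (beta m)) * w -> forall x, tau x = (1 - chi x) * w.
  move=> ea eb; apply: (cocycle_eq coc (coboundary w coc.1)) => i /=.
  - by rewrite (handle1 i).
  - by rewrite (handle1 i).
  - by rewrite c0 c1 subrr mul0r.
case: ab => ne.
  exists (tau (alpha m) / (1 - chi (alpha m))); apply: gens.
    by rewrite mulrC divfK // subr_eq0 eq_sym.
  by rewrite mulrA rel mulrAC mulfV ?mul1r // subr_eq0 eq_sym.
exists (tau (beta m) / (1 - chi (beta m))); apply: gens.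
  by rewrite mulrA -rel mulrAC mulfV ?mul1r // subr_eq0 eq_sym.
by rewrite mulrC divfK // subr_eq0 eq_sym.
Qed.

Lemma cocycle_phi_c (chi tau : Lambda X -> K) h i : is_cocycle chi tau ->
  chi (gamma i) = 1 -> Phi h ->
  exists u, tau (h (gamma i)) = chi u * tau (gamma i).
Proof.
move=> coc ci /(action_conj act i) [u ->]; exists u.
rewrite !(cocycleM coc) (cocycleV coc) !(charM coc.1) ci; field.
exact: (char_neq0 coc.1).
Qed.

Variables (rho : Lambda X -> GL2 R) (p : GL2 R) (l chi tau : Lambda X -> K).
Hypotheses (lch : is_char l) (coc : is_cocycle chi tau).
Hypothesis tr : triangular rho p l chi tau.
Hypotheses (lfin : finite_set (range l)) (chic : forall i, chi (gamma i) = 1).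
Variables (N : nat) (mu : K).
Hypotheses (pmu : N.-primitive_root mu) (mu1 : mu != 1).
Hypotheses (chia : chi (alpha m) = mu) (chib : chi (beta m) = 1).
Variable i0 : 'I_n.
Hypothesis ti0 : tau (gamma i0) != 0.
Local Notation N2 := (set_card (range l)).
Local Notation n' := #|[set i | tau (gamma i) != 0]%SET|.

(** The translations only matter up to a common factor; [i0] is the reference puncture that fixes
    this factor and accounts for the exponent n' - 1. *)
Let E := ([set i | tau (gamma i) != 0] :\ i0)%SET.
Local Notation index := {i | i \in E}.

Lemma card_index : #|{: index}| = (n' - 1)%N.
Proof.
rewrite card_sig [RHS](_ : _ = #|E|); first by apply: eq_card.
by rewrite (cardsD1 i0 [set _ | _]%SET) inE ti0 add1n subn1.
Qed.

Lemma N_gt1 : (1 < N)%N.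
Proof.
have N0 := prim_order_gt0 pmu; rewrite ltn_neqAle N0 andbT eq_sym.
apply: contraNneq mu1 => N1; have := prim_expr_order pmu.
by rewrite N1 expr1 => ->.
Qed.

Lemma chiN x : chi x ^+ N = 1.
Proof.
have muN := prim_expr_order pmu.
apply: (action_ind act (P := fun x => chi x ^+ N = 1)) => [i|i|i||y z yN zN|y yN].
- by rewrite (handle1 i) chia.
- by rewrite (handle1 i) chib expr1n.
- by rewrite chic expr1n.
- by rewrite (char1 coc.1) expr1n.
- by rewrite (charM coc.1) exprMn yN zN mulr1.
- by rewrite (charV coc.1) exprVn yN invr1.
Qed.

Lemma chi_ab h : Phi h -> chi (h (alpha m)) != 1 \/ chi (h (beta m)) != 1.
Proof.
move=> Ph; apply: contrapT => /not_orP [/negP/negPn/eqP ha /negP/negPn/eqP hb].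
have [h' [_ hh' _]] := action_invP act Ph.
have cst1_ch : is_char (fun _ : Lambda X => 1 : K) by split=> [|x y] /=; rewrite ?mulr1.
have triv : chi \o h =1 (fun=> 1).
  apply: (char_eq act (char_phi act coc.1 Ph) cst1_ch) => i /=.
  - by rewrite (handle1 i).
  - by rewrite (handle1 i).
  - by rewrite (char_phi_c act i coc.1 Ph).
by have := triv (h' (alpha m)); rewrite /= hh' chia => /eqP; rewrite (negbTE mu1).
Qed.

Lemma tau_c h i : Phi h ->
  exists2 q, q ^+ N = 1 & tau (h (gamma i)) = q * tau (gamma i).
Proof.
move=> Ph; have [u ->] := cocycle_phi_c coc (chic i) Ph.
by exists (chi u) => //; exact: chiN.
Qed.

Lemma tau_c_neq0 h i : Phi h ->
  (tau (h (gamma i)) == 0) = (tau (gamma i) == 0).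
Proof.
move=> Ph; have [q qN ->] := tau_c i Ph.
by rewrite mulf_eq0 (negbTE (unity_neq0 pmu qN)).
Qed.

Definition slopes h (d : {ffun index -> 'I_N}) := forall i : index,
  tau (h (gamma (val i))) =
  tau (gamma (val i)) * (tau (h (gamma i0)) / tau (gamma i0)) * mu ^+ d i.

Lemma unit_ord x : x ^+ N = 1 -> exists d : 'I_N, x = mu ^+ d.
Proof. by move=> /(prim_rootP pmu) [d ->]; exists d. Qed.

Lemma exists_slopes h : Phi h -> exists d, slopes h d.
Proof.
move=> Ph; have q0N : (tau (h (gamma i0)) / tau (gamma i0)) ^+ N = 1.
  by have [q0 q0N ->] := tau_c i0 Ph; rewrite mulfK.
have q00 := unity_neq0 pmu q0N.
have exd (i : index) : exists d : 'I_N, tau (h (gamma (val i))) =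
    tau (gamma (val i)) * (tau (h (gamma i0)) / tau (gamma i0)) * mu ^+ d.
  have [q qN ->] := tau_c (val i) Ph.
  have [d dE] := unit_ord (unityM qN (unityV q0N)).
  by exists d; rewrite -dE; field; rewrite ti0 (tau_c_neq0 i0 Ph) ti0.
have [d dE] := choice exd; exists (finfun d) => i; rewrite ffunE; exact: dE.
Qed.

Lemma char_h_eq f h h' : is_char f -> Phi h -> Phi h' ->
  f (h (alpha m)) = f (h' (alpha m)) -> f (h (beta m)) = f (h' (beta m)) ->
  f \o h =1 f \o h' :> (Lambda X -> K).
Proof.
move=> fch Ph Ph' ea eb.
apply: (char_eq act (char_phi act fch Ph) (char_phi act fch Ph')) => i /=.
- by rewrite (handle1 i).
- by rewrite (handle1 i).
- by rewrite (char_phi_c act i fch Ph) (char_phi_c act i fch Ph').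
Qed.

(** After rescaling at [i0], the two cocycles agree at every puncture, so [cocycle_split] makes
    their difference a coboundary, which is the shift of the conjugation. *)
Lemma slopes_conj h h' d : Phi h -> Phi h' -> slopes h d -> slopes h' d ->
  chi (h (alpha m)) = chi (h' (alpha m)) ->
  chi (h (beta m)) = chi (h' (beta m)) ->
  affine_conj (chi \o h) (tau \o h) (chi \o h') (tau \o h').
Proof.
move=> Ph Ph' hd hd' ea eb.
have cc := char_h_eq coc.1 Ph Ph' ea eb.
split=> //.
pose s := tau (h' (gamma i0)) / tau (h (gamma i0)).
have h00 : tau (h (gamma i0)) != 0 by rewrite tau_c_neq0.
have h'00 : tau (h' (gamma i0)) != 0 by rewrite tau_c_neq0.
pose tau3 x := tau (h' x) - s * tau (h x).
have coch := cocycle_phi act coc Ph; have coch' := cocycle_phi act coc Ph'.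
have coc3 : is_cocycle (chi \o h) tau3.
  split=> [|x y]; first exact: coch.1.
  rewrite /tau3 -![tau (h _)]/((tau \o h) _) -![tau (h' _)]/((tau \o h') _).
  by rewrite (cocycleM coch) (cocycleM coch') -!cc; ring.
have c3 i : tau3 (gamma i) = 0.
  rewrite /tau3; case: (eqVneq i i0) => [->|ii0]; first by rewrite divfK ?subrr.
  case: (boolP (i \in E)) => [iE|].
    rewrite (hd (exist _ i iE)) (hd' (exist _ i iE)) /= /s.
    move: (mu ^+ _) => e; by field; rewrite ti0 h00.
  rewrite !inE ii0 /= negbK => /eqP ti.
  have [q _ ->] := tau_c i Ph; have [q' _ ->] := tau_c i Ph'.
  by rewrite ti !mulr0 subrr.
have [|w wE] := cocycle_split coc3 (chi_ab Ph) _ c3.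
  by move=> i; rewrite /= (char_phi_c act i coc.1 Ph).
exists s, w; split; first by rewrite mulf_neq0 ?invr_eq0.
by move=> x; have := wE x; rewrite /tau3 /= => <-; rewrite addrC subrK.
Qed.

(** The three factors count the pairs of values of [chi] on the handle, where (1, 1) is impossible
    by [chi_ab], the slopes, and the pairs of values of [l]. *)
Lemma unipotent_upper : finite_set (pure_orbit rho) /\
  (set_card (pure_orbit rho) <= (N ^ 2 - 1) * N ^ (n' - 1) * N2 ^ 2)%N.
Proof.
have N0 := ltnW N_gt1; pose o : 'I_N := Ordinal N0.
pose A := fset_set (range l).
have mem x : l x \in A by rewrite in_fset_set // inE; exists x.
pose D := ({q : 'I_N * 'I_N | q != (o, o)} * {ffun index -> 'I_N} * (A * A))%type.
have -> : ((N ^ 2 - 1) * N ^ (n' - 1) * N2 ^ 2)%N = #|{: D}|.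
  rewrite !card_prod card_sig card_ffun card_index card_ord -!cardfE mulnn.
  by have := cardC1 (o, o); rewrite card_prod card_ord mulnn -subn1 => <-.
rewrite pure_orbitE.
apply: (set_card_le (rel := fun C (d : D) => exists2 h, Phi h &
  [/\ C = conj_class (rho \o h),
      chi (h (alpha m)) = mu ^+ (val d.1.1).1 /\
      chi (h (beta m)) = mu ^+ (val d.1.1).2, slopes h d.1.2 &
      l (h (alpha m)) = val d.2.1 /\ l (h (beta m)) = val d.2.2])).
  move=> _ [h Ph <-].
  have [x xE] := unit_ord (chiN (h (alpha m))).
  have [y yE] := unit_ord (chiN (h (beta m))).
  have [d dE] := exists_slopes Ph.
  have xy : (x, y) != (o, o).
    apply/eqP => -[x0 y0]; have := chi_ab Ph.
    by rewrite xE yE x0 y0 expr0 eqxx => -[].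
  exists (exist _ (x, y) xy, d, ([` mem (h (alpha m))]%fset, [` mem (h (beta m))]%fset)).
  by exists h.
move=> C C' d _ _ [h Ph [-> [ha hb] hd [la lb]]] [h' Ph' [-> [ha' hb'] hd' [la' lb']]].
apply/conj_class_eq.
have ll : l \o h =1 l \o h'.
  by apply: (char_h_eq lch) => //; rewrite ?la ?la' ?lb ?lb'.
have tr' : triangular (rho \o h') p (l \o h) (chi \o h') (tau \o h').
  by move=> x; rewrite [(l \o h) x]ll; exact: tr.
apply: (triangular_conj_inv (triangular_comp h tr) tr').
by apply: (slopes_conj Ph Ph' hd hd'); rewrite ?ha ?ha' ?hb ?hb'.
Qed.

Hypothesis taub : tau (beta m) != 0.

Lemma unipotent_nonsplit : nonsplit chi tau.
Proof.
move=> w sp; move: taub; rewrite sp chib subrr mul0r eqxx.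
by [].
Qed.

Lemma unipotent_conj h h' : Phi h -> Phi h' ->
  (exists q, forall x, rho (h' x) = (q * rho (h x) * q^-1)%g) ->
  l \o h =1 l \o h' /\ affine_conj (chi \o h) (tau \o h) (chi \o h') (tau \o h').
Proof.
move=> Ph Ph' cj.
have [//|[_ _ [w sp]]] := triangular_conj (char_phi act lch Ph)
  (char_phi act lch Ph') (char_phi act coc.1 Ph) (char_phi act coc.1 Ph')
  (triangular_comp h tr) (triangular_comp h' tr) cj.
by have := nonsplit_phi act unipotent_nonsplit Ph sp.
Qed.

(** A non-split class determines [l], so [char_lower1] applies without the factor 2, and its
    exponent 2g - 1 is 1. *)
Lemma unipotent_lower_char : (N2 <= set_card (pure_orbit rho))%N.
Proof.
have [finS _] := unipotent_upper.
have := @char_lower1 _ _ _ _ _ _ _ act rho l m lch lfin mg finS.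
rewrite g1 muln1 subn1 expn1; apply => h h' Ph Ph' /(unipotent_conj Ph Ph') [].
by [].
Qed.

Section Scaling.
Variables (psi sigma : Lambda X -> K).
Hypotheses (cocp : is_cocycle psi sigma) (psic : forall i, psi (gamma i) = 1).
Hypothesis (psib : psi (beta m) = mu).

(* [xi] multiplies the translations of the first punctures by the inverse of *)
(* [psi (beta m)], and [tau_alpha^-1] then restores the character. *)
Lemma scale_step (k : 'I_n) q : (k.+1 < n)%N -> exists2 h, Phi h &
  psi \o h =1 psi /\ forall i, sigma (h (gamma i)) =
    (if (i <= k)%N then mu ^- q else 1) * sigma (gamma i).
Proof.
move=> kn.
have psiP h : Phi h -> psi (h (peripheral (c := gamma) k)) = 1.
  move=> Ph; rewrite (char_phi_peripheral act k cocp.1 Ph).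
  by rewrite (char_prod cocp.1) big1.
elim: q => [|q [h Ph [hpsi hs]]].
  exists id; first exact: action_id act.
  by split=> // i; rewrite expr0 invr1 if_same mul1r.
have [h1 [Ph1 h1a h1b h1c]] := xi_move act mg kn.
have [h2 [Ph2 h2a h2b h2c]] := alpha_moveV act m 1.
have Ph12 := action_comp act Ph1 Ph2.
have coch := cocycle_phi act cocp Ph.
have psiX : psi (h (xi beta gamma m k)) = mu.
  rewrite -[LHS]/((psi \o h) _) (charM coch.1) (charV coch.1) /= psiP //.
  by rewrite invr1 mul1r -psib; exact: hpsi.
have psihc i : psi (h (gamma i)) = 1 by rewrite [LHS]hpsi.
have mu0 : mu != 0 by exact: unity_neq0 pmu _ (prim_expr_order pmu).
exists (h \o (h1 \o h2)); first exact: (action_comp act).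
split=> [|i].
  have Phh := action_comp act Ph Ph12.
  apply: (char_eq act (char_phi act cocp.1 Phh) cocp.1) => i.
  - rewrite /= (handle1 i) [h2 _]h2a /= eqxx expg1 (action_morph act Ph1).
    rewrite (phiV act _ Ph1) [h1 (alpha m)]h1a [h1 (beta m)]h1b /= eqxx.
    move: psiX; move: (xi beta gamma m k) => Y psiY.
    rewrite -[LHS]/((psi \o h) _) !(charM coch.1) !(charV coch.1).
    rewrite !(charM coch.1) !(charV coch.1) /= psiY.
    have -> : psi (h (beta m)) = mu by rewrite [LHS]hpsi.
    have -> : psi (h (alpha m)) = psi (alpha m) by exact: hpsi.
    by field.
  - rewrite /= (handle1 i) [h2 _]h2b [h1 _]h1b /= eqxx.
    move: psiX; move: (xi beta gamma m k) => Y psiY.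
    rewrite -[LHS]/((psi \o h) _) !(charM coch.1) !(charV coch.1) /= psiY.
    have -> : psi (h (beta m)) = mu by rewrite [LHS]hpsi.
    by rewrite psib; field.
  - by rewrite /= (char_phi_c act i cocp.1 Phh).
rewrite /= [h2 _]h2c [h1 _]h1c /=; case: leqP => ik; last first.
  by rewrite hs leqNgt ik.
move: psiX; move: (xi beta gamma m k) => Y psiY.
rewrite -[LHS]/((sigma \o h) _) !(cocycleM coch) (cocycleV coch).
rewrite !(charM coch.1) (charV coch.1) /= psiY psihc hs ik.
by rewrite exprS; field; rewrite mu0 expf_neq0.
Qed.

End Scaling.

Lemma scale_all (psi sigma : Lambda X -> K) (r : 'I_n -> K) :
  is_cocycle psi sigma -> (forall i, psi (gamma i) = 1) -> psi (beta m) = mu ->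
  (0 < n)%N -> (forall i, r i ^+ N = 1) ->
  exists h t, [/\ Phi h, t ^+ N = 1, psi \o h =1 psi &
    forall i, sigma (h (gamma i)) = t * r i * sigma (gamma i)].
Proof.
move=> cocp psic psib n0 rN.
have step k : (k < n)%N -> exists h t, [/\ Phi h, t ^+ N = 1, psi \o h =1 psi &
    forall i : 'I_n, sigma (h (gamma i)) =
      (if (i <= k)%N then t * r i else 1) * sigma (gamma i)].
  elim: k => [_|k IH kn].
    exists id, (r (Ordinal n0))^-1; split=> // [||i].
    - exact: action_id act.
    - exact: unityV.
    - rewrite leqn0; case: eqP => [i0'|_]; last by rewrite mul1r.
      rewrite (_ : i = Ordinal n0); last exact: val_inj.
      by rewrite mulVf ?mul1r // (unity_neq0 pmu).
  have [h [t [Ph tN hpsi hs]]] := IH (ltnW kn).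
  (* The next puncture still has factor 1. Dividing the earlier factors and [t] by mu^q = t r(k+1)
     turns this 1 into the required new t times r(k+1). *)
  have [q qE] := unity_pow pmu (unityM tN (rN (Ordinal kn))).
  have [||h' Ph' [h'psi h's]] := scale_step (cocycle_phi act cocp Ph) _ _
    (k := Ordinal (ltnW kn)) q kn.
  - by move=> i; rewrite [LHS]hpsi.
  - by rewrite [LHS]hpsi.
  have muqN : (mu ^+ q) ^+ N = 1 by apply: unityX; exact: prim_expr_order.
  have q0 := unity_neq0 pmu muqN.
  exists (h \o h'), (t / mu ^+ q); split=> [||x|i].
  - exact: (action_comp act).
  - exact: unityM tN (unityV muqN).
  - by rewrite [LHS]h'psi; exact: hpsi.
  - rewrite [LHS]h's /= hs [RHS]mulrC; case: (ltngtP i k.+1) => [ik|ik|ik].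
    + by rewrite -ltnS ik; ring.
    + by rewrite leqNgt (ltnW ik) /=; ring.
    + rewrite (_ : i = Ordinal kn); last exact: val_inj.
      rewrite /= ltnn mulrAC qE mulfV //; ring.
have [|h [t [Ph tN hpsi hs]]] := step n.-1; first by rewrite prednK.
exists h, t; split=> // i; rewrite hs ifT //.
by have := ltn_ord i; lia.
Qed.

(* The move [h3] to the prescribed character scales the translations by factors *)
(* depending only on the character, hence they can be compensated beforehand. *)
Lemma unipotent_reach x y (r : 'I_n -> K) : (0 < n)%N ->
  x ^+ N = 1 -> y ^+ N = 1 -> N.-primitive_root x \/ N.-primitive_root y ->
  (forall i, r i ^+ N = 1) ->
  exists h t, [/\ Phi h, t != 0, chi (h (alpha m)) = x /\ chi (h (beta m)) = y &
    forall i, tau (h (gamma i)) = t * r i * tau (gamma i)].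
Proof.
move=> n0 xN yN pxy rN; have muN := prim_expr_order pmu.
have [h1 Ph1 [h1a h1b]] := char_orbit act pmu (u := fun=> 1) (v := fun=> mu)
  coc.1 chiN (ex_intro _ _ chia) mg (fun=> expr1n _ _) (fun=> muN) (or_intror pmu).
pose psi := chi \o h1; pose sigma := tau \o h1.
have cocp : is_cocycle psi sigma := cocycle_phi act coc Ph1.
have psic i : psi (gamma i) = 1 by rewrite /psi /= (char_phi_c act i coc.1 Ph1).
have psib : psi (beta m) = mu by exact: h1b.
have psiN z : psi z ^+ N = 1 by exact: chiN.
have [h3 Ph3 [h3a h3b]] := char_spread act pmu (u := fun=> x) (v := fun=> y)
  cocp.1 psiN mg (or_intror (eq_ind_r (fun z => N.-primitive_root z) pmu psib))
  (fun=> xN) (fun=> yN) pxy.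
have [u uE] := choice (fun i => action_conj act i Ph3).
have [v vE] := choice (fun i => cocycle_phi_c coc (chic i) Ph1).
(* [v i] and [u i] are the conjugators by which [h1] and [h3] act on gamma_i; their factors are
   divided out in advance. *)
pose r' i := r i / (psi (u i) * chi (v i)).
have r'N i : r' i ^+ N = 1.
  by apply: unityM => //; apply: unityV; apply: unityM; [exact: psiN|exact: chiN].
have [h2 [t [Ph2 tN h2psi h2s]]] := scale_all cocp psic psib n0 r'N.
exists (h1 \o h2 \o h3), t; split.
- by do 2 apply: (action_comp act) => //.
- exact: unity_neq0 pmu _ tN.
- split; first by rewrite -[LHS]/((psi \o h2) _) h2psi; exact: h3a.
  by rewrite -[LHS]/((psi \o h2) _) h2psi; exact: h3b.
move=> i; have coc2 := cocycle_phi act cocp Ph2.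
have c1 : (psi \o h2) (gamma i) = 1 by rewrite h2psi.
rewrite -[LHS]/((sigma \o h2) _) uE !(cocycleM coc2) (cocycleV coc2).
rewrite !(charM coc2.1) c1 [(psi \o h2) (u i)]h2psi [(sigma \o h2) (gamma i)]h2s.
rewrite [sigma (gamma i)]vE /r'.
by field; rewrite (char_neq0 cocp.1) (char_neq0 coc.1).
Qed.

Lemma card_coprime : #|[pred i : 'I_N | coprime i N]| = totient N.
Proof.
rewrite totient_count_coprime big_mkord -sum1_card big_mkcond /=.
by apply: eq_bigr => i _; rewrite inE coprime_sym; case: coprime.
Qed.

(** The complement consists of pairs with both entries non-coprime to N, and N^2 - (N - phi)^2 = phi
    (2N - phi). *)
Lemma card_coprime_pair :
  #|[pred q : 'I_N * 'I_N | coprime q.1 N || coprime q.2 N]|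
  = (totient N * (2 * N - totient N))%N.
Proof.
set A := [pred i : 'I_N | coprime i N].
set B := [pred q : 'I_N * 'I_N | _].
have EC : #|[predC B]| = ((N - totient N) * (N - totient N))%N.
  have cA : #|[predC A]| = (N - totient N)%N.
    by rewrite -card_coprime -[X in (X - _)%N](card_ord N) -(cardC A) addKn.
  rewrite -cA -cardX; apply: eq_card => q.
  by rewrite !inE negb_or.
have tN : (totient N <= N)%N.
  by rewrite -card_coprime -[leqRHS](card_ord N) max_card.
have := cardC B; rewrite EC card_prod card_ord.
move: #|B| (totient N) tN => B' T TN E'.
by nia.
Qed.

Lemma unipotent_lower :
  (totient N * (2 * N - totient N) * N ^ (n' - 1) <= set_card (pure_orbit rho))%N.
Proof.
have [finS _] := unipotent_upper.
have n0 : (0 < n)%N by apply: leq_trans (ltn_ord i0).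
have muN := prim_expr_order pmu.
pose D := ({q : 'I_N * 'I_N | coprime q.1 N || coprime q.2 N} *
  {ffun index -> 'I_N})%type.
have -> : (totient N * (2 * N - totient N) * N ^ (n' - 1))%N = #|{: D}|.
  rewrite card_prod card_ffun card_index card_ord card_sig -card_coprime_pair.
  by congr (_ * _)%N; apply: eq_card.
apply: (set_card_ge (rel := fun (d : D) C => exists2 h, Phi h &
  [/\ C = conj_class (rho \o h),
      chi (h (alpha m)) = mu ^+ (val d.1).1,
      chi (h (beta m)) = mu ^+ (val d.1).2 & slopes h d.2])) => //.
  move=> [[[x y] xy] d].
  (* The default 1 is taken at [i0], so the factors relative to the reference puncture are exactly
     those prescribed by [d]. *)
  pose r (i : 'I_n) := if insub i is Some k then mu ^+ d k else 1.
  have rN i : r i ^+ N = 1.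
    by rewrite /r; case: insub => [k|]; rewrite ?expr1n // unityX.
  have [h [t [Ph t0 [ha hb] hc]]] : exists h t, [/\ Phi h, t != 0,
      chi (h (alpha m)) = mu ^+ x /\ chi (h (beta m)) = mu ^+ y &
      forall i, tau (h (gamma i)) = t * r i * tau (gamma i)].
    apply: unipotent_reach => //; try exact: unityX.
    move: xy => /= /orP [xy|xy]; [left|right];
      by rewrite (prim_root_exp_coprime _ pmu).
  exists (conj_class (rho \o h)); first by rewrite pure_orbitE; exists h.
  exists h => //; split=> // i /=.
  have r0 : r i0 = 1 by rewrite /r insubF // !inE eqxx.
  have ri : r (val i) = mu ^+ d i by rewrite /r valK.
  rewrite !hc r0 ri; move: (mu ^+ _) => e; by field.
move=> d d' C _ [h Ph [-> ha hb hd]] [h' Ph' [/conj_class_eq cj ha' hb' hd']].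
have [_ [cc [s [w [s0 hw]]]]] := unipotent_conj Ph Ph' cj.
have expI (i j : 'I_N) : mu ^+ i = mu ^+ j -> i = j.
  move=> /eqP; rewrite (eq_prim_root_expr pmu) !modn_small // => /eqP.
  exact: val_inj.
case: d d' ha hb hd ha' hb' hd' => [[[x y] xy] d] [[[x' y'] xy'] d'] /=.
move=> ha hb hd ha' hb' hd'.
have ex : x = x' by apply: expI; rewrite -ha -ha'; exact: cc.
have ey : y = y' by apply: expI; rewrite -hb -hb'; exact: cc.
have ed : d = d'.
  apply/ffunP => i; apply: expI.
  have tg j : tau (h' (gamma j)) = s * tau (h (gamma j)).
    have := hw (gamma j); rewrite /= (char_phi_c act j coc.1 Ph) chic.
    by rewrite subrr mul0r addr0.
  have := tg (val i); rewrite (hd' i) (hd i) tg.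
  have : tau (gamma (val i)) != 0.
    by have := valP i; rewrite !inE => /andP [].
  have : tau (h (gamma i0)) != 0 by rewrite tau_c_neq0.
  move: (mu ^+ _) (mu ^+ _) (tau (h (gamma i0))) (tau (gamma (val i))) => e e' T0 T T00 T0'.
  have c0 : s * (T * T0 / tau (gamma i0)) != 0.
    by rewrite !mulf_neq0 ?invr_eq0.
  move=> E'; apply: (mulfI c0); apply/esym.
  by transitivity (T * (s * T0 / tau (gamma i0)) * e'); [ring|rewrite E'; ring].
by rewrite -ed; congr (_, _); apply: val_inj; rewrite /= ex ey.
Qed.

End UnipotentCase.

(** * Estimates for twists of rho_(mu,c) *)

Section RhoMuC.
Context {R : realType} {g n : nat} {X : punctured_surface R n}.
Context {alpha beta : 'I_g -> Lambda X} {gamma : 'I_n -> Lambda X}.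
Hypothesis act : surface_action alpha beta gamma (@pure_push R n X).
Local Notation K := R[i].
Local Notation Phi := (@pure_push R n X).

Lemma rho_mu_c_cocycle mu (c : 'I_n -> K)
    (rho0 : {multiplicative Lambda X -> GL2 R}) :
  is_rho_mu_c alpha beta gamma mu c rho0 -> exists chi tau,
  [/\ is_cocycle chi tau,
    forall x, units_val (rho0 x) = mx2 (chi x) (tau x) 0 1,
    (forall k, chi (alpha k) = mu),
    (forall k, chi (beta k) = 1 /\ tau (beta k) = - (mu - 1)^-1) &
    forall i, chi (gamma i) = 1 /\ tau (gamma i) = c i].
Proof.
move=> [ra rb rc]; pose T x := units_val (rho0 x).
have TM x y : T (x * y)%g = T x * T y by rewrite /T gmulfM GL2_valM.
have T1 : T 1%g = mx2 1 0 0 1.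
  by rewrite /T multiplicative1 GL2_val1; apply: matrix2P; rewrite !mxE.
have ut x : T x = mx2 (T x 0 0) (T x 0 1) 0 1.
  have [u [v ->]] : exists u v, T x = mx2 u v 0 1; last by rewrite !mxE.
  move: x; apply: (action_ind act) => [k|k|i||x y [u [v E]] [u' [v' E']]|x [u [v E]]].
  - by exists mu, 0; exact: ra.
  - by exists 1, (- (mu - 1)^-1); exact: rb.
  - by exists 1, (c i); exact: rc.
  - by exists 1, 0.
  - exists (u * u' + v * 0), (u * v' + v * 1).
    by rewrite TM E E' mx2M; congr mx2; ring.
  - have := unitsP (rho0 x); rewrite -[units_val _]/(T x) E mx2_unit.
    rewrite mulr1 mulr0 subr0 => u0.
    exists u^-1, (- (v / u)).
    have TxU : T x \is a GRing.unit by exact: unitsP.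
    apply: (mulIr TxU); rewrite -TM mulVg T1 E mx2M.
    by congr mx2; field.
exists (fun x => T x 0 0), (fun x => T x 0 1); split=> //.
- split=> [|x y]; first split=> [|x y].
  + by rewrite T1 mxE.
  + by rewrite TM [T x]ut [T y]ut mx2M !mxE /= mulr0 addr0.
  + by rewrite TM [T x]ut [T y]ut mx2M !mxE /= mulr1 addrC.
- by move=> k; rewrite /T ra mxE.
- by move=> k; rewrite /T rb !mxE.
- by move=> i; rewrite /T rc !mxE.
Qed.

(** The bounds of the genus one case apply: a reference puncture exists because the c_i sum to 1,
    and the image of gamma_i is scalar exactly when its translation is 0, so n' counts the same
    punctures. *)
Lemma rho_mu_c_estimates (N : nat) mu (c : 'I_n -> K)
    (lam : {multiplicative Lambda X -> Cstar R})
    (rho0 : {multiplicative Lambda X -> GL2 R}) (rho : Lambda X -> GL2 R) :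
  g = 1%N -> N.-primitive_root mu -> mu != 1 -> \sum_i c i = 1 ->
  finite_set (range lam) -> is_rho_mu_c alpha beta gamma mu c rho0 ->
  rho =1 twist lam rho0 ->
  let N2 := set_card (range lam) in
  let n' := #|[set i : 'I_n | ~~ is_scalar_mx (units_val (rho (gamma i)))]%SET| in
  [/\ finite_set (pure_orbit rho),
    (maxn N2 (totient N * (2 * N - totient N) * N ^ (n' - 1))
       <= set_card (pure_orbit rho))%N &
    (set_card (pure_orbit rho) <= (N ^ 2 - 1) * N ^ (n' - 1) * N2 ^ 2)%N].
Proof.
move=> g1 pmu mu1 c1 lfin /rho_mu_c_cocycle [chi [tau [coc rE ca cb cc]]] rhoE.
have g0 : (0 < g)%N by rewrite g1.
pose m := Ordinal g0; have mg : m.+1 = g by rewrite /= g1.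
pose l x := units_val (lam x); have lch : is_char l := hom_char lam.
have tr : triangular rho 1%g l chi tau.
  by move=> x; rewrite rhoE; exact: twist_triangular.
have [bm1 taub] := cb m.
have chic i : chi (gamma i) = 1 by have [] := cc i.
have tauc i : tau (gamma i) = c i by have [] := cc i.
have taub0 : tau (beta m) != 0 by rewrite taub oppr_eq0 invr_eq0 subr_eq0.
have [i0 ti0] : exists i0, tau (gamma i0) != 0.
  apply: contrapT => nE; have /eqP := c1; rewrite big1 ?(eq_sym 0) ?oner_eq0 //.
  by move=> i _; apply/eqP/negPn/negP => ci; apply: nE; exists i; rewrite tauc.
have lfin' : finite_set (range l) by exact/range_units.
move=> N2 n'; have N2E : N2 = set_card (range l) by rewrite set_card_units.
have n'E : n' = #|[set i | tau (gamma i) != 0]%SET|.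
  rewrite /n'; congr #|pred_of_set _|; apply/setP => i; rewrite !inE; congr negb.
  have := tr (gamma i); rewrite mul1g invg1 mulg1 chic => ->.
  rewrite mx2_scalar mulr1 !eqxx andbT /= mulf_eq0.
  by rewrite (negbTE (char_neq0 lch _)).
have [fin up] := unipotent_upper act mg g1 lch coc tr lfin' chic pmu mu1 (ca m) bm1 ti0.
split=> //; last by rewrite N2E n'E.
rewrite geq_max N2E n'E; apply/andP; split.
  exact: (unipotent_lower_char act mg g1 lch coc tr lfin' chic pmu mu1 (ca m) bm1 ti0).
exact: (unipotent_lower act mg g1 lch coc tr lfin' chic pmu mu1 (ca m) bm1 ti0).
Qed.

Lemma pure_orbit_sub (G : groupType) (rho rho' : Lambda X -> G) :
  pure_orbit rho (conj_class rho') -> pure_orbit rho' `<=` pure_orbit rho.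
Proof.
rewrite !pure_orbitE => -[h Ph /conj_class_eq [q qE]] _ [f Pf <-].
exists (h \o f); first exact: (action_comp act).
by apply/conj_class_eq; exists q => x /=; rewrite qE.
Qed.

End RhoMuC.

Theorem theorem2 (R : realType) (g n : nat) (X : punctured_surface R n)
    (alpha beta : 'I_g -> Lambda X) (gamma : 'I_n -> Lambda X)
    (hstd : is_standard alpha beta gamma) (hg : (0 < g)%N)
    (rho : {multiplicative Lambda X -> GL2 R}) (hred : reducible rho) :
  (finite_set (pure_orbit rho) <->
     (exists lambda1 lambda2 : {multiplicative Lambda X -> Cstar R},
        [/\ finite_set (range lambda1), finite_set (range lambda2) &
            is_direct_sum rho lambda1 lambda2])
     \/
     [/\ g = 1%N, (0 < n)%N &
       exists (N : nat) (mu : R[i]) (c : 'I_n -> R[i])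
         (lambda : {multiplicative Lambda X -> Cstar R})
         (rho0 : {multiplicative Lambda X -> GL2 R}),
         [/\ (0 < N)%N /\ N.-unity_root mu, mu != 1 /\ \sum_i c i = 1,
             finite_set (range lambda),
             is_rho_mu_c alpha beta gamma mu c rho0 &
             pure_orbit (twist lambda rho0) (conj_class rho)]])
  /\
  (forall lambda1 lambda2 : {multiplicative Lambda X -> Cstar R},
     finite_set (range lambda1) -> finite_set (range lambda2) ->
     is_direct_sum rho lambda1 lambda2 ->
     2^-1 * (maxn (set_card (range lambda1) ^ (2 * g - 1))
                  (set_card (range lambda2) ^ (2 * g - 1)))%:R
       <= (set_card (pure_orbit rho))%:R :> rat
     /\ (set_card (pure_orbit rho) <= set_card (range rho) ^ (2 * g))%N)
  /\
  (forall (N : nat) (mu : R[i]) (c : 'I_n -> R[i])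
     (lambda : {multiplicative Lambda X -> Cstar R})
     (rho0 : {multiplicative Lambda X -> GL2 R}),
     g = 1%N -> (0 < n)%N ->
     N.-primitive_root mu -> mu != 1 -> \sum_i c i = 1 ->
     finite_set (range lambda) ->
     is_rho_mu_c alpha beta gamma mu c rho0 ->
     rho =1 twist lambda rho0 ->
     let N2 := set_card (range lambda) in
     let n' := #|[set i : 'I_n | ~~ is_scalar_mx (units_val (rho (gamma i)))]%SET| in
     (maxn N2 (totient N * (2 * N - totient N) * N ^ (n' - 1))
        <= set_card (pure_orbit rho))%N
     /\ (set_card (pure_orbit rho) <= (N ^ 2 - 1) * N ^ (n' - 1) * N2 ^ 2)%N).
Proof.
have act := standard_surface_action hstd.
split; [split|split].
- exact: (finite_orbit_form act hg hred).
- move=> [[lam1 [lam2 [fin1 fin2 ds]]]|].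
    by have [] := direct_sum_upper act fin1 fin2 ds.
  move=> [g1 n0 [N [mu [c [lam [rho0 [[N0 muN] [mu1 c1] lfin rmc orb]]]]]]].
  (* The estimates need the exact order of [mu], which may be a proper divisor of [N]. *)
  have [d pmu _] := prim_order_exists N0 (unity_rootP muN).
  have [fin _ _] := rho_mu_c_estimates act g1 pmu mu1 c1 lfin rmc (fun=> erefl).
  exact: sub_finite_set (pure_orbit_sub act orb) fin.
- move=> lam1 lam2 fin1 fin2 ds; split; last first.
    by have [] := direct_sum_upper act fin1 fin2 ds.
  have [lo1 lo2] := direct_sum_lower act hg fin1 fin2 ds.
  rewrite ler_pdivrMl // -natrM ler_nat geq_max lo1; exact: lo2.
- move=> N mu c lam rho0 g1 n0 pmu mu1 c1 lfin rmc rhoE N2 n'.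
  by have [] := rho_mu_c_estimates act g1 pmu mu1 c1 lfin rmc rhoE.
Qed.
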